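(* Suppose a target is located on a star according to a balanced hiding distribution $h$. Then $h$ is simply searchable if and only if it is forward biased. Moreover, $h$ is strongly simply searchable if and only if it is strictly forward biased.
   Context: A star is a (finite) tree network with exactly one node of degree greater than 1, and this node is the root $O$. Its arcs $j=1,\dots,n$ join $O$ to the leaf nodes and have lengths $\lambda_j>0$, with $\mu=\sum_j\lambda_j$. Points of the star $Q$ may be interior points of arcs; $\lambda$ is length measure, $d$ the path-length metric, and $P(x,y)$ the path from $x$ to $y$. A hiding distribution $h$ is a Borel probability measure on $Q$. The search density of a region $R$ with $\lambda(R)>0$ is $\rho(R)=h(R)/\lambda(R)$. A hiding distribution on a rooted tree is balanced if at every branch node (the root and all other nodes of degree at least 3) all the branches have the same search density; the branches at $x$ are the connected components of $Q_x\setminus\{x\}$, where $Q_x$ is the set of points whose path to $O$ contains $x$. On a star this says that the arcs (with $O$ removed) all have the same search density. Let $F_j(x)$ be the probability that the target is on arc $j$ at distance at most $x$ from $O$, and $h_j=F_j(\lambda_j)$. $h$ is forward biased if for all $j$, $$F_j(x)\le H_j(x):=\frac{x+(h_j\mu-\lambda_j)^+}{x+\mu-\lambda_j}\quad\text{for all }0\le x\le\lambda_j,$$ where $y^+=\max\{y,0\}$. $h$ is strictly forward biased if it is forward biased and this inequality is strict for all $j$ and all $0<x<\lambda_j$. A search is a function $S:[0,\infty)\to Q$ with $S(0)=O$ and $d(S(t_1),S(t_2))\le t_2-t_1$ for $0\le t_1<t_2$; the behaviour of $S$ after all of $Q$ has been covered is irrelevant (disregarded). Put $T(S,x)=\min\{t\ge0:S(t)=x\}$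 (or $+\infty$) and $T(S,h)=\int_Q T(S,x)\,dh(x)$. A search is optimal if it minimizes $T(S,h)$ over all searches. All searches considered are assumed normal: whenever $t_1<t_2$ and $S([t_1,t_2])=P(S(t_1),S(t_2))$, then for $0\le s\le t_2-t_1$, $S(t_1+s)$ is the point of $P(S(t_1),S(t_2))$ at distance $s$ from $S(t_1)$. A depth-first (DF) search is a sequence of arcs traversed at unit speed, starting and ending at $O$, such that when leaving a node the unique arc towards the root is chosen only if all the other arcs at the node have been traversed, each arc being traversed exactly once in each direction; on a star, this means touring the arcs one after another in some order. $h$ is simply searchable if some DF search is optimal, and strongly simply searchable if the only optimal searches are DF. *)

(* Defs.v *)
From HB Require Import structures.
From mathcomp Require Export all_boot all_order all_algebra all_fingroup.
From mathcomp Require Export all_classical all_reals all_analysis.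
From mathcomp Require Import lra.

Set Implicit Arguments.
Unset Strict Implicit.
Unset Printing Implicit Defensive.

Import Order.TTheory GRing.Theory Num.Theory.
Import numFieldNormedType.Exports.

Local Open Scope classical_set_scope.
Local Open Scope ring_scope.

Section StarNetwork.
Context {R : realType} {n : nat} (lam : 'I_n -> R).

(* [None] is the root O; [Some (j, x)] with 0 < x <= lam j is the point of
   arc j at distance x from O, so that x = lam j is the leaf node. *)
Definition star : Type :=
  option {p : 'I_n * R | (0 < p.2) && (p.2 <= lam p.1)}.

HB.instance Definition _ := Choice.on star.
HB.instance Definition _ := isPointed.Build star None.

Definition root : star := None.

(* [pt j 0 = root]; outside of 0 <= x <= lam j the value is junk (the root). *)
Definition pt (j : 'I_n) (x : R) : star := insub (j, x).

Definition arc (p : star) : option 'I_n := omap (fun u => (val u).1) p.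

Definition radius (p : star) : R := if p is Some u then (val u).2 else 0.

Definition star_dist (p q : star) : R :=
  if arc p == arc q then `|radius p - radius q| else radius p + radius q.

Definition total_length : R := \sum_(j < n) lam j.

Lemma radius_ge0 p : 0 <= radius p.
Proof. by case: p => [[[j x] /= /andP[x0 _]]|//]; exact: ltW. Qed.

Lemma radius0_root p : radius p = 0 -> p = root.
Proof.
by case: p => [u|//] /= u0; have /andP[] := valP u; rewrite u0 ltxx.
Qed.

Lemma star_ext p q : arc p = arc q -> radius p = radius q -> p = q.
Proof.
case: p => [[[i x] Px]|]; case: q => [[[j y] Py]|] //= [ij] xy.
by congr Some; apply: val_inj; rewrite /= ij xy.
Qed.

Lemma star_dist0_eq p q : star_dist p q = 0 -> p = q.
Proof.
rewrite /star_dist; case: eqP => [pq /eqP|npq /eqP].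
  by rewrite normr_eq0 subr_eq0 => /eqP; exact: star_ext pq.
rewrite paddr_eq0 ?radius_ge0// => /andP[/eqP p0 /eqP q0].
by rewrite (radius0_root p0) (radius0_root q0).
Qed.

Lemma star_distxx p : star_dist p p = 0.
Proof. by rewrite /star_dist eqxx subrr normr0. Qed.

Lemma star_dist_sym p q : star_dist p q = star_dist q p.
Proof. by rewrite /star_dist eq_sym distrC [radius p + _]addrC. Qed.

Lemma star_dist_triangle q p r :
  star_dist p r <= star_dist p q + star_dist q r.
Proof.
have := radius_ge0 p; have := radius_ge0 q; have := radius_ge0 r.
rewrite /star_dist => r0 q0 p0.
have [pr|pr] := eqVneq (arc p) (arc r).
  rewrite -pr [arc q == _]eq_sym; case: ifP => _.
    by have := ler_distD (radius q) (radius p) (radius r).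
  by rewrite ler_norml; apply/andP; split; lra.
have [pq|pq] := eqVneq (arc p) (arc q).
  by rewrite -pq (negbTE pr); have := ler_norm (radius p - radius q); lra.
case: ifP => _; last lra.
by have := ler_norm (radius r - radius q); rewrite distrC; lra.
Qed.

HB.instance Definition _ := @isMetric.Build R star star_dist
  star_distxx star_dist0_eq star_dist_sym star_dist_triangle.

End StarNetwork.

(* The star with the Borel sigma-algebra of the path-length metric. *)
Notation borel_star lam := (g_sigma_algebraType (@open (star lam))).

Section Hiding.
Context {R : realType} {n : nat} {lam : 'I_n -> R}.

(* The set of points of arc j at distance at most x from O, O included. *)
Definition arc_upto (j : 'I_n) (x : R) : set (star lam) :=
  [set pt lam j y | y in `[0, x]].

Definition open_arc (j : 'I_n) : set (star lam) :=
  arc_upto j (lam j) `\ root lam.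

Definition star_length (A : set (star lam)) : \bar R :=
  (\sum_(j < n) lebesgue_measure
     [set x : R | (0 <= x <= lam j)%R /\ A (pt lam j x)])%E.

Variable h : probability (borel_star lam) R.

Definition search_density (A : set (star lam)) : R :=
  fine (h A) / fine (star_length A).

(* O is the only branch node whose branches need comparing: the other nodes
   of a star are leaves. *)
Definition balanced : Prop :=
  forall i j, search_density (open_arc i) = search_density (open_arc j).

Definition arc_cdf (j : 'I_n) (x : R) : R := fine (h (arc_upto j x)).

Definition arc_prob (j : 'I_n) : R := arc_cdf j (lam j).

Definition bias_bound (j : 'I_n) (x : R) : R :=
  (x + Num.max (arc_prob j * total_length lam - lam j) 0)
    / (x + total_length lam - lam j).

Definition forward_biased : Prop :=
  forall j x, 0 <= x <= lam j -> arc_cdf j x <= bias_bound j x.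

Definition strictly_forward_biased : Prop :=
  forward_biased /\
  forall j x, 0 < x < lam j -> arc_cdf j x < bias_bound j x.

End Hiding.

Section Searching.
Context {R : realType} {n : nat} {lam : 'I_n -> R}.

Local Notation Q := (star lam).

(* In a tree, the path from x to y consists of the points z with
   d(x,z) + d(z,y) = d(x,y). *)
Definition path_between (x y : Q) : set Q :=
  [set z | mdist x z + mdist z y = mdist x y].

Implicit Type S : R -> Q.

(* Times up to and including the first time at which S has visited all of Q;
   what S does later is disregarded. *)
Definition relevant S (t : R) : Prop :=
  0 <= t /\ ~ (setT `<=` S @` `[0, t[).

Definition normal_search S : Prop :=
  forall t1 t2, 0 <= t1 -> t1 < t2 -> relevant S t2 ->
    S @` `[t1, t2] = path_between (S t1) (S t2) ->
    forall s, 0 <= s <= t2 - t1 ->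
      path_between (S t1) (S t2) (S (t1 + s)) /\ mdist (S t1) (S (t1 + s)) = s.

(* Only the restriction of S to nonnegative times is meaningful. *)
Definition is_search S : Prop :=
  [/\ S 0 = root lam,
      forall t1 t2, 0 <= t1 -> t1 < t2 -> mdist (S t1) (S t2) <= t2 - t1
    & normal_search S].

(* The infimum is a minimum when the set is nonempty, and +oo otherwise. *)
Definition hit_time S (x : Q) : \bar R :=
  ereal_inf [set t%:E | t in [set t : R | 0 <= t /\ S t = x]].

Definition search_time S (h : probability (borel_star lam) R) : \bar R :=
  (\int[h]_(x in setT) hit_time S x)%E.

Definition optimal_search (h : probability (borel_star lam) R) S : Prop :=
  is_search S /\
  forall S', is_search S' -> (search_time S h <= search_time S' h)%E.

Definition tour_start (s : 'S_n) (k : 'I_n) : R :=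
  \sum_(i < n | (i < k)%N) 2 * lam (s i).

(* The arcs are toured at unit speed in the order s 0, s 1, ..., s (n-1). *)
Definition df_tour (s : 'S_n) S : Prop :=
  forall (k : 'I_n) (x : R), 0 <= x <= lam (s k) ->
    S (tour_start s k + x) = pt lam (s k) x /\
    S (tour_start s k + 2 * lam (s k) - x) = pt lam (s k) x.

Definition depth_first S : Prop :=
  is_search S /\
  exists (s : 'S_n) (D : R -> Q),
    df_tour s D /\ forall t, relevant S t -> S t = D t.

Definition simply_searchable (h : probability (borel_star lam) R) : Prop :=
  exists2 S, depth_first S & optimal_search h S.

Definition strongly_simply_searchable
    (h : probability (borel_star lam) R) : Prop :=
  forall S, optimal_search h S -> depth_first S.

End Searching.

(* Main.v *)
Require Import Defs.
From mathcomp Require Import measurable_realfun lra ring.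

Set Implicit Arguments.
Unset Strict Implicit.
Unset Printing Implicit Defensive.

Import Order.TTheory GRing.Theory Num.Theory.
Import numFieldNormedType.Exports.
Local Open Scope classical_set_scope.
Local Open Scope ring_scope.

(** Balance gives all arcs the same density [kap], the [mean_density]. The time at which a
    point is found is its distance from the root, which no search can save, plus a [delay];
    so search times are compared through mean delays. In these terms forward bias says
    that the mass within distance [x] of the root on arc [j], times [x + (mu - lam j)], is
    at most [kap * mu * x] ([bias_le]).

    Forward bias makes tours optimal by a potential argument. A number, the [potential], is
    attached to the masses found so far on the arcs: it is the mean delay of a tour when
    nothing has been found, and vanishes when at most one arc is incomplete. Between
    consecutive visits of the root a search explores one arc only, and all mass not found by
    then has been waiting in the meantime ([capped_delayD]). An excursion to depth [x] takes
    at least [2 * x], and forward bias at [x] is what keeps the fall of the potential below this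
    waiting cost ([potential_step]). Summing over all excursions ([slack_ge0]) bounds the
    mean delay of every search below by the initial potential ([search_time_lower_bound]).
    Infinitely many excursions may accumulate, but the tiny ones can be neglected
    ([coarse_mass]).

    Forward bias is necessary because of the [probe], a search that explores the first [x] of
    some arc before it tours the star with that arc last. It beats the tours by at
    least twice the amount by which the bias condition fails at [x] ([probe_search_time]). If
    forward bias holds with equality at an inner point, the probe is optimal and not
    depth-first.

    If the bias is strict, the potential falls by as much as the waiting cost only during
    complete tours of new arcs, so a search attaining the bound is a tour ([tight_tour]).

    Strong simple searchability speaks of optimal searches only, and to draw conclusions from
    it one of them must exist ([exists_optimal_search]). Nonexpanding paths form a compact
    space on which the search time is lower semicontinuous, hence it has a minimiser; and a
    minimiser that moreover reaches the leaves as early as possible is normal, as otherwise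
    a shortcut would improve it. *)

(** * Points and distances of a star *)

Section StarGeometry.
Context {R : realType} {n : nat} {lam : 'I_n -> R}.
Local Notation Q := (star lam).
Implicit Types (p q : Q) (i j k : 'I_n) (x y : R).

Lemma mdistE p q : mdist p q = star_dist p q. Proof. by []. Qed.

Lemma pt0 j : pt lam j 0 = root lam.
Proof. by rewrite /pt insubF //= ltxx. Qed.

Lemma pt_Some j x : 0 < x <= lam j ->
  exists u : {p : 'I_n * R | (0 < p.2) && (p.2 <= lam p.1)},
    pt lam j x = Some u /\ val u = (j, x).
Proof. by move=> jx; rewrite /pt; case: insubP => [u _ vu|]; [exists u|rewrite /= jx]. Qed.

Lemma arc_pt j x : 0 < x <= lam j -> arc (pt lam j x) = Some j.
Proof. by move=> /pt_Some[u [-> /= ->]]. Qed.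

Lemma radius_pt j x : 0 <= x <= lam j -> radius (pt lam j x) = x.
Proof.
move=> /andP[x0 xl]; have [->|xn0] := eqVneq x 0; first by rewrite pt0.
have /pt_Some[u [-> /= ->//]] : 0 < x <= lam j by rewrite lt0r xn0 x0.
Qed.

Lemma radius_arc p j : arc p = Some j -> 0 < radius p <= lam j.
Proof. by case: p => [u|//] [<-]; exact: (valP u). Qed.

Lemma pt_arc p j : arc p = Some j -> pt lam j (radius p) = p.
Proof.
move=> pj; have rp := radius_arc pj; apply: star_ext; first by rewrite arc_pt.
by rewrite radius_pt //; case/andP: rp => /ltW -> ->.
Qed.

Lemma arc_root p : (arc p == None) = (p == root lam).
Proof. by case: p. Qed.

Lemma radius_eq0 p : (radius p == 0) = (p == root lam).
Proof. by apply/eqP/eqP => [/radius0_root|->]. Qed.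

Lemma radius_gt0 p : (0 < radius p) = (p != root lam).
Proof. by rewrite lt0r radius_ge0 andbT radius_eq0. Qed.

Lemma dist_root p : mdist (root lam) p = radius p.
Proof.
rewrite mdistE /star_dist /=; case: eqP => [e|_]; rewrite ?sub0r ?add0r//.
have /eqP -> : p == root lam by rewrite -arc_root -e.
by rewrite /= oppr0 normr0.
Qed.

Lemma mdist_sym p q : mdist p q = mdist q p.
Proof. exact: star_dist_sym. Qed.

Lemma mdist_triangle q p r : mdist p r <= mdist p q + mdist q r.
Proof. exact: star_dist_triangle. Qed.

Lemma mdist0 p : mdist p p = 0.
Proof. exact: star_distxx. Qed.

Lemma dist_le_radiusD p q : mdist p q <= radius p + radius q.
Proof.
by rewrite -[radius p]dist_root (mdist_sym (root lam)) -[radius q]dist_root mdist_triangle.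
Qed.

Lemma radius_lip p q : `|radius p - radius q| <= mdist p q.
Proof.
rewrite mdistE /star_dist; case: ifP => // _.
by have := radius_ge0 p; have := radius_ge0 q; rewrite ler_norml => *; apply/andP; split; lra.
Qed.

Lemma dist_arcN p q j : arc p = Some j -> arc q != Some j ->
  mdist p q = radius p + radius q.
Proof. by move=> pj qj; rewrite mdistE /star_dist pj eq_sym (negbTE qj). Qed.

Lemma dist_pt j x y : 0 <= x <= lam j -> 0 <= y <= lam j ->
  mdist (pt lam j x) (pt lam j y) = `|x - y|.
Proof.
move=> hx hy; have [/andP[x0 xl] /andP[y0 yl]] := (hx, hy).
have [->|xn0] := eqVneq x 0.
  by rewrite pt0 dist_root radius_pt // sub0r normrN ger0_norm.
have [->|yn0] := eqVneq y 0.
  by rewrite pt0 mdist_sym dist_root radius_pt // subr0 ger0_norm.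
rewrite mdistE /star_dist !arc_pt ?lt0r ?xn0 ?yn0 ?x0 ?y0 //.
by rewrite eqxx !radius_pt.
Qed.

Lemma dist_pt2 i j x y : i != j -> 0 <= x <= lam i -> 0 <= y <= lam j ->
  mdist (pt lam i x) (pt lam j y) = x + y.
Proof.
move=> ij hx hy; have [/andP[x0 xl] /andP[y0 yl]] := (hx, hy).
have [->|xn0] := eqVneq x 0; first by rewrite pt0 dist_root radius_pt // add0r.
rewrite (@dist_arcN _ _ i) ?radius_pt //.
  by rewrite arc_pt ?lt0r ?xn0 ?x0.
have [yz|yn0] := eqVneq y 0; first by rewrite yz pt0.
by rewrite arc_pt ?lt0r ?yn0 ?y0//; apply: contra ij => /eqP[->].
Qed.

(** Reading arc j as the positive half-line and everything else as the negative one
    turns intermediate values of real functions into crossings of given points. *)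
Definition signed_radius j p : R := if arc p == Some j then radius p else - radius p.

Lemma signed_radius_lip j p q : `|signed_radius j p - signed_radius j q| <= mdist p q.
Proof.
have := radius_lip p q; rewrite /signed_radius.
case: (eqVneq (arc p)) => pj; case: (eqVneq (arc q)) => qj //.
- by move=> _; rewrite (dist_arcN pj qj) opprK ger0_norm ?addr_ge0 ?radius_ge0.
- move=> _; rewrite mdist_sym (dist_arcN qj pj) -opprD normrN.
  by rewrite addrC ger0_norm ?addr_ge0 ?radius_ge0.
- by rewrite -opprD normrN.
Qed.

Lemma signed_radius_gt0 j p : (0 < signed_radius j p) = (arc p == Some j).
Proof.
rewrite /signed_radius; case: eqP => [/radius_arc/andP[]//|_].
by rewrite oppr_gt0 ltNge radius_ge0.
Qed.

Lemma signed_radius_eq0 j p : signed_radius j p = 0 -> p = root lam.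
Proof.
rewrite /signed_radius; case: eqP => _; first exact: radius0_root.
by move/eqP; rewrite oppr_eq0 => /eqP; exact: radius0_root.
Qed.

End StarGeometry.

(** * Searches as nonexpanding paths *)

Section Paths.
Context {R : realType} {n : nat} {lam : 'I_n -> R}.
Local Notation Q := (star lam).
Implicit Types (S : R -> Q) (p q : Q) (i j k : 'I_n) (t x y : R).

Definition nonexpanding S :=
  forall t1 t2, 0 <= t1 -> t1 < t2 -> mdist (S t1) (S t2) <= t2 - t1.

Definition found S t : set Q := S @` `[0, t].

(** The relaxation of searches in which normality is dropped: it is closed under
    limits, under shortcuts and under concatenation. *)
Definition lip_search S := S 0 = root lam /\ nonexpanding S.

Lemma is_search_lip S : is_search S -> lip_search S. Proof. by case. Qed.

Lemma nonexpanding_le S t1 t2 : nonexpanding S -> 0 <= t1 -> t1 <= t2 ->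
  mdist (S t1) (S t2) <= t2 - t1.
Proof.
move=> SL t10; rewrite le_eqVlt => /predU1P[->|]; last exact: SL.
by rewrite mdist0 subrr.
Qed.

Lemma radius_lip_path S t1 t2 : nonexpanding S -> 0 <= t1 -> t1 <= t2 ->
  `|radius (S t1) - radius (S t2)| <= t2 - t1.
Proof.
by move=> SL t10 t12; apply: le_trans (radius_lip _ _) (nonexpanding_le SL t10 t12).
Qed.

Lemma radius_le_time S a t : nonexpanding S -> 0 <= a -> a <= t -> S a = root lam ->
  radius (S t) <= t - a.
Proof.
move=> SL a0 at_ Sa; rewrite -dist_root -Sa; exact: nonexpanding_le.
Qed.

Lemma radius_le_time_to S t b : nonexpanding S -> 0 <= t -> t <= b -> S b = root lam ->
  radius (S t) <= b - t.
Proof.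
move=> SL t0 tb Sb; rewrite -dist_root mdist_sym -Sb; exact: nonexpanding_le.
Qed.

(** Paths are controlled at nonnegative times only, hence the extension of [f] to negative
    arguments by its value at 0 in the proof. *)
Lemma lip_ivt (f : R -> R) (a b v : R) :
  (forall u w : R, 0 <= u -> u <= w -> `|f u - f w| <= w - u) ->
  0 <= a -> a <= b -> Num.min (f a) (f b) <= v <= Num.max (f a) (f b) ->
  exists2 c, a <= c <= b & f c = v.
Proof.
move=> fL a0 ab fv; pose g (u : R) := f (Num.max 0 u).
have gL u w : `|g u - g w| <= `|u - w|.
  wlog uw : u w / u <= w.
    by move=> H; case: (leP u w) => [/H//|/ltW/H]; rewrite distrC [X in _ <= X]distrC.
  apply: (le_trans (fL _ _ _ _)); rewrite ?le_max ?lexx //.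
    by case: (lerP 0 u) => hu; case: (lerP 0 w) => hw; lra.
  rewrite distrC ger0_norm ?subr_ge0 //.
  by case: (lerP 0 u) => hu; case: (lerP 0 w) => hw; lra.
have gc : continuous g.
  move=> u; apply/cvgrPdist_lt => e e0; near=> w.
  by rewrite (le_lt_trans (gL _ _)).
have gE u : 0 <= u -> g u = f u by move=> u0; rewrite /g max_r.
have [||c] := @IVT R g a b v ab; first exact: continuous_subspaceT.
  by rewrite !gE // (le_trans a0).
rewrite in_itv /= => /andP[ac cb] <-; exists c; rewrite ?ac// gE // (le_trans a0).
Unshelve. all: by end_near. Qed.

Lemma signed_radius_path S j u w : nonexpanding S -> 0 <= u -> u <= w ->
  `|signed_radius j (S u) - signed_radius j (S w)| <= w - u.
Proof.
by move=> SL u0 uw; apply: le_trans (signed_radius_lip _ _ _) (nonexpanding_le SL u0 uw).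
Qed.

Lemma found_le S t1 t2 : t1 <= t2 -> found S t1 `<=` found S t2.
Proof.
move=> t12 q [u /=]; rewrite in_itv /= => /andP[u0 ut] <-.
by exists u => //=; rewrite in_itv /= u0 (le_trans ut).
Qed.

Lemma foundP S t q : found S t q <-> exists u, [/\ 0 <= u, u <= t & S u = q].
Proof.
split=> [[u /=]|[u [u0 ut <-]]]; first by rewrite in_itv /= => /andP[u0 ut] <-; exists u.
by exists u => //=; rewrite in_itv /= u0.
Qed.

Lemma found_root S t : lip_search S -> 0 <= t -> found S t (root lam).
Proof. by move=> [S0 _] t0; apply/foundP; exists 0; split. Qed.

(** A search reaches a point of an arc only through all points below it, by the intermediate
    value theorem. *)
Lemma found_below S t j x y : lip_search S -> 0 <= y <= x -> x <= lam j ->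
  found S t (pt lam j x) -> found S t (pt lam j y).
Proof.
move=> SS /andP[y0 yx] xl /foundP[u [u0 ut Su]]; have [S0 SL] := SS.
have [->|yn0] := eqVneq y 0.
  by rewrite pt0; apply: found_root => //; exact: le_trans ut.
have {yn0}y_gt0 : 0 < y by rewrite lt0r yn0.
have [||c /andP[c0 cu] Sc] := @lip_ivt (fun u => signed_radius j (S u)) 0 u y _ (lexx 0) u0.
- by move=> *; exact: signed_radius_path.
- rewrite S0 Su /signed_radius /= arc_pt ?(lt_le_trans y_gt0 yx)// eqxx.
  rewrite radius_pt ?(le_trans y0 yx)// oppr0 min_l ?max_r ?(le_trans y0 yx)//.
  by rewrite y0.
apply/foundP; exists c; split; rewrite ?(le_trans cu)//.
have aSc : arc (S c) = Some j by apply/eqP; rewrite -signed_radius_gt0 Sc.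
by rewrite -(pt_arc aSc); congr pt; move: Sc; rewrite /signed_radius aSc eqxx.
Qed.

Lemma no_root_same_arc S a b : nonexpanding S -> 0 <= a -> a <= b ->
  (forall t, a <= t <= b -> S t != root lam) -> arc (S a) = arc (S b).
Proof.
move=> SL a0 ab Sn0.
case aSa : (arc (S a)) => [j|]; last first.
  by move/eqP: aSa; rewrite arc_root (negbTE (Sn0 _ _)) ?lexx.
apply/esym/eqP; rewrite -signed_radius_gt0 ltNge; apply/negP => Sb.
have [||c cab /signed_radius_eq0 Sc] :=
    @lip_ivt (fun u => signed_radius j (S u)) a b 0 _ a0 ab.
- by move=> *; exact: signed_radius_path.
- by rewrite ge_min Sb orbT le_max; have := signed_radius_gt0 j (S a);
    rewrite aSa eqxx => /ltW ->.
by have := Sn0 c cab; rewrite Sc eqxx.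
Qed.

Lemma last_root_time S t : lip_search S -> 0 <= t ->
  exists a, [/\ 0 <= a, a <= t, S a = root lam &
    forall u, a < u <= t -> S u != root lam].
Proof.
move=> [S0 SL] t0; pose E := [set u | 0 <= u <= t /\ S u = root lam].
have E0 : E 0 by split; rewrite ?lexx.
have Eub : has_ubound E by exists t => u [/andP[]].
have Es : has_sup E by split => //; exists 0.
have a0 : 0 <= sup E by exact: ub_le_sup.
have at_ : sup E <= t by apply: ge_sup; [exists 0|move=> u [/andP[]]].
exists (sup E); split => //.
  apply: radius0_root; apply/eqP; rewrite eq_le radius_ge0 andbT.
  apply/ler_addgt0Pl => e e0; rewrite addr0.
  have [u [/andP[u0 ut] Su] /ltW ue] := sup_adherent e0 Es.
  have ua : u <= sup E by apply: ub_le_sup => //; split; rewrite ?u0.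
  by apply: (le_trans (radius_le_time SL u0 ua Su)); lra.
move=> u /andP[au ut]; apply/eqP => Su.
suff : u <= sup E by rewrite leNgt au.
by apply: ub_le_sup => //; split=> //; rewrite ut (le_trans a0)// ltW.
Qed.

Lemma next_root_time S t e : nonexpanding S -> 0 <= t -> t <= e -> S e = root lam ->
  exists b, [/\ t <= b, b <= e, S b = root lam &
    forall u, t <= u < b -> S u != root lam].
Proof.
move=> SL t0 te Se; pose E := [set u | t <= u <= e /\ S u = root lam].
have E0 : E e by split; rewrite ?lexx ?te.
have Elb : has_lbound E by exists t => u [/andP[]].
have Es : has_inf E by split => //; exists e.
have a0 : t <= inf E by apply: lb_le_inf; [exists e|move=> u [/andP[]]].
have at_ : inf E <= e by exact: ge_inf.
exists (inf E); split => //.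
  apply: radius0_root; apply/eqP; rewrite eq_le radius_ge0 andbT.
  apply/ler_addgt0Pl => d d0; rewrite addr0.
  have [u [/andP[tu ue] Su] /ltW ud] := inf_adherent d0 Es.
  have ua : inf E <= u by apply: ge_inf => //; split; rewrite ?tu.
  by apply: (le_trans (radius_le_time_to SL (le_trans t0 a0) ua Su)); lra.
move=> u /andP[tu ua]; apply/eqP => Su.
suff : inf E <= u by rewrite leNgt ua.
by apply: ge_inf => //; split=> //; rewrite tu (le_trans (ltW ua)).
Qed.

(** Because a search moves at bounded speed, a point not met up to time t is met only
    after a positive delay, so that the infimum defining the hitting time is attained. *)
Lemma hit_time_le S t q : nonexpanding S -> 0 <= t ->
  (hit_time S q <= t%:E)%E <-> found S t q.
Proof.
move=> SL t0; split; last first.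
  move=> /foundP[u [u0 ut Su]]; apply: (@le_trans _ _ u%:E); last by rewrite lee_fin.
  by apply: ereal_inf_lbound; exists u.
move=> ht; apply: contrapT => nf.
pose d := mdist (S t) q.
have d0 : 0 < d.
  rewrite mdist_gt0; apply/eqP => Stq; apply: nf; apply/foundP; exists t.
  by split.
have : ((t + d)%:E <= hit_time S q)%E.
  apply: le_ereal_inf_tmp => _ [u [u0 Su] <-]; rewrite lee_fin.
  have [ut|tu] := leP u t; first by exfalso; apply: nf; apply/foundP; exists u.
  by have := SL _ _ t0 tu; rewrite Su -/d; lra.
by move=> /le_trans/(_ ht); rewrite lee_fin; lra.
Qed.

Lemma hit_time_ge0 S q : (0 <= hit_time S q)%E.
Proof. by apply: le_ereal_inf_tmp => _ [u [u0 _] <-]; rewrite lee_fin. Qed.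

Lemma hit_time_lb S u q : 0 <= u -> S u = q -> (hit_time S q <= u%:E)%E.
Proof. by move=> u0 Su; apply: ereal_inf_lbound; exists u. Qed.

Lemma found_before S q t : (hit_time S q < t%:E)%E -> exists u, [/\ 0 <= u, u < t & S u = q].
Proof. by move=> /ereal_inf_lt[_ [u [u0 Su] <-]]; rewrite lte_fin => ut; exists u. Qed.

(** On a straight leg from the root that takes no longer than its length, every
    intermediate position is forced. *)
Lemma straight_out S a j x y : nonexpanding S -> 0 <= a -> S a = root lam ->
  0 <= y <= x -> x <= lam j -> S (a + x) = pt lam j x -> S (a + y) = pt lam j y.
Proof.
move=> SL a0 Sa /andP[y0 yx] xl Sx.
have x0 : 0 <= x := le_trans y0 yx.
have h1 : radius (S (a + y)) <= y.
  by have := radius_le_time SL a0 (_ : a <= a + y) Sa; rewrite lerDl => /(_ y0); lra.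
have h2 : mdist (S (a + y)) (pt lam j x) <= x - y.
  rewrite -Sx; have := nonexpanding_le SL (_ : 0 <= a + y) (_ : a + y <= a + x).
  by rewrite addr_ge0 // lerD2l => /(_ isT yx); lra.
case aS : (arc (S (a + y)) == Some j); last first.
  have xr : 0 < x -> radius (S (a + y)) <= - y.
    move=> x_gt0; move: h2; rewrite mdist_sym (@dist_arcN _ _ _ _ _ j) ?aS ?arc_pt ?x_gt0//.
    by rewrite radius_pt ?x0//; lra.
  have y00 : y = 0.
    have [//|yn0] := eqVneq y 0; have yg : 0 < y by rewrite lt0r yn0.
    have := xr (lt_le_trans yg yx); have := radius_ge0 (S (a + y)); lra.
  by rewrite y00 addr0 Sa pt0.
move/eqP in aS; rewrite -(pt_arc aS); congr pt; apply/eqP; rewrite eq_le h1 /=.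
have := radius_lip (pt lam j x) (S (a + y)); rewrite mdist_sym radius_pt ?x0//.
by move=> /le_trans/(_ h2); rewrite ler_norml => /andP[]; lra.
Qed.

Lemma straight_back S b j x y : nonexpanding S -> 0 <= b - x -> S b = root lam ->
  0 <= y <= x -> x <= lam j -> S (b - x) = pt lam j x -> S (b - y) = pt lam j y.
Proof.
move=> SL bx0 Sb /andP[y0 yx] xl Sx.
have x0 : 0 <= x := le_trans y0 yx.
have by0 : 0 <= b - y by lra.
have h1 : radius (S (b - y)) <= y.
  by have := radius_le_time_to SL by0 (_ : b - y <= b) Sb; rewrite lerBlDr lerDl => /(_ y0); lra.
have h2 : mdist (pt lam j x) (S (b - y)) <= x - y.
  rewrite -Sx; have := nonexpanding_le SL bx0 (_ : b - x <= b - y).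
  by rewrite lerB // => /(_ isT); lra.
case aS : (arc (S (b - y)) == Some j); last first.
  have xr : 0 < x -> radius (S (b - y)) <= - y.
    move=> x_gt0; move: h2; rewrite (@dist_arcN _ _ _ _ _ j) ?aS ?arc_pt ?x_gt0//.
    by rewrite radius_pt ?x0//; lra.
  have y00 : y = 0.
    have [//|yn0] := eqVneq y 0; have yg : 0 < y by rewrite lt0r yn0.
    have := xr (lt_le_trans yg yx); have := radius_ge0 (S (b - y)); lra.
  by rewrite y00 subr0 Sb pt0.
move/eqP in aS; rewrite -(pt_arc aS); congr pt; apply/eqP; rewrite eq_le h1 /=.
have := radius_lip (pt lam j x) (S (b - y)); rewrite radius_pt ?x0//.
by move=> /le_trans/(_ h2); rewrite ler_norml => /andP[]; lra.
Qed.

End Paths.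

(** * A potential for partially searched stars *)

Section Potential.
Context {R : realType} {n : nat} (lam : 'I_n -> R) (kap : R).
Context (lam_gt0 : forall j, 0 < lam j).
Implicit Types (g : 'I_n -> R) (i j k : 'I_n).

Local Notation mu := (total_length lam).

Let lam_ge0 j : 0 <= lam j. Proof. exact: ltW. Qed.

(** In a tour, whichever of two arcs comes later has its mass delayed by twice the length of
    the other one. A pair of arcs accounts for this delay in proportion to the density that
    is still missing on the more thoroughly searched arc; both orders of the pair occur in
    the sum, whence no factor 2. *)
Definition potential g : R :=
  \sum_i \sum_(k | k != i) lam i * lam k * (kap - Num.max (g i / lam i) (g k / lam k)).

Definition unfound g : R := \sum_i (kap * lam i - g i).

Lemma total_length_others j : mu - lam j = \sum_(k | k != j) lam k.
Proof. by rewrite /total_length (bigD1 j)//= addrAC subrr add0r. Qed.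

Lemma pair_sum_sym (D : 'I_n -> 'I_n -> R) j :
  (forall i k, D i k = D k i) -> (forall i k, i != j -> k != j -> D i k = 0) ->
  \sum_i \sum_(k | k != i) D i k = 2 * \sum_(k | k != j) D j k.
Proof.
move=> Dsym D0; rewrite (bigD1 j)//= mulr_natl mulr2n; congr (_ + _).
apply: eq_bigr => i ij; rewrite (bigD1 j) ?[j == i]eq_sym//= Dsym big1 ?addr0//.
by move=> k /andP[_ kj]; exact: D0.
Qed.

Lemma pair_sum_le (D : 'I_n -> 'I_n -> R) (eta : R) : 0 <= eta ->
  (forall i k, i != k -> D i k <= lam i * lam k * (eta / lam i + eta / lam k)) ->
  \sum_i \sum_(k | k != i) D i k <= 2 * n%:R * mu * eta.
Proof.
move=> eta0 DP.
have -> : 2 * n%:R * mu * eta = \sum_i \sum_k (lam i + lam k) * eta.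
  under eq_bigr do rewrite -mulr_suml big_split /= sumr_const card_ord.
  by rewrite -mulr_suml big_split /= sumr_const card_ord sumrMnl -/mu -mulr_natr; ring.
apply: ler_sum => i _; rewrite [X in _ <= X](bigID (fun k => k != i))/=.
rewrite -[X in X <= _]addr0; apply: lerD.
  apply: ler_sum => k ki; apply: (le_trans (DP _ _ _)); first by rewrite eq_sym.
  by rewrite le_eqVlt; apply/orP; left; apply/eqP; field; rewrite !gt_eqF.
by apply: sumr_ge0 => k _; rewrite mulr_ge0// addr_ge0// ltW.
Qed.

(** Only the pairs with [j] lose potential. Against an arc with found density [fk] the loss
    is, up to the factor [lam k], at most the positive part of [lam j * (f' - fk)], where [f']
    is the new density on [j]. This falls faster in [fk] than [x * (kap - fk)] does, so the
    two need only be compared at [fk = 0], which accounts for the correction term. *)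
Lemma potential_step_aux j g g' (x : R) :
  (forall i, i != j -> g' i = g i) -> (forall i, 0 <= g i <= kap * lam i) ->
  0 <= x <= lam j ->
  potential g - potential g' <=
    2 * ((mu - lam j) * Num.max (g' j - x * kap) 0
         + x * (unfound g' - (kap * lam j - g' j))).
Proof.
move=> gg' gP /andP[x0 xl].
pose D i k := lam i * lam k * (Num.max (g' i / lam i) (g' k / lam k)
                               - Num.max (g i / lam i) (g k / lam k)).
have -> : potential g - potential g' = \sum_i \sum_(k | k != i) D i k.
  rewrite /potential -sumrB; apply: eq_bigr => i _; rewrite -sumrB.
  by apply: eq_bigr => k _; rewrite /D; ring.
rewrite (@pair_sum_sym D j); first last.
- by move=> i k ij kj; rewrite /D !gg'// subrr mulr0.
- by move=> i k; rewrite /D (mulrC (lam i)) (maxC (g' i / _)) (maxC (g i / _)).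
rewrite ler_pM2l//.
have -> : unfound g' - (kap * lam j - g' j) = \sum_(k | k != j) (kap * lam k - g k).
  rewrite /unfound (bigD1 j)//= addrAC subrr add0r.
  by apply: eq_bigr => k kj; rewrite gg'.
rewrite total_length_others mulr_suml mulr_sumr -big_split /=.
apply: ler_sum => k kj.
have [lj lk] := (lam_gt0 j, lam_gt0 k).
have /andP[gk0 gk1] := gP k.
rewrite /D (gg' k kj); set M := Num.max (g' j - _) _.
have Ej : g' j = (g' j / lam j) * lam j by rewrite divfK// gt_eqF.
have Ek : g k = (g k / lam k) * lam k by rewrite divfK// gt_eqF.
set f' := g' j / lam j in Ej *; set fk := g k / lam k in Ek *.
have fk0 : 0 <= fk by rewrite divr_ge0// ltW.
have fkk : fk <= kap by rewrite ler_pdivrMr.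
suff H : lam j * (Num.max f' fk - Num.max (g j / lam j) fk) <= M + x * (kap - fk).
  rewrite Ek; have := ler_wpM2l (ltW lk) H; lra.
have M0 : 0 <= M by rewrite le_max lexx orbT.
have M1 : g' j - x * kap <= M by rewrite le_max lexx.
have h1 : Num.max f' fk - Num.max (g j / lam j) fk <= Num.max f' fk - fk.
  by rewrite lerB// le_max lexx orbT.
apply: (le_trans (ler_wpM2l (ltW lj) h1)).
have [ff|ff] := leP f' fk.
  by rewrite subrr mulr0 addr_ge0// mulr_ge0// subr_ge0.
have : 0 <= (lam j - x) * fk by rewrite mulr_ge0// subr_ge0.
move: M1; rewrite Ej; lra.
Qed.

(** An excursion to depth [x] keeps all mass that it leaves unfound waiting for [2 * x]. The
    untouched arcs contribute the correction term of [potential_step_aux], and comparing it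
    with what is left on arc [j] itself is precisely the bias condition at [x]. *)
Lemma potential_step j g g' (x : R) : 0 <= kap ->
  (forall i, i != j -> g' i = g i) -> (forall i, 0 <= g i <= kap * lam i) ->
  g' j <= kap * lam j -> 0 <= x <= lam j ->
  g' j * (x + (mu - lam j)) <= kap * mu * x ->
  potential g - potential g' <= 2 * (x * unfound g').
Proof.
move=> kap0 gg' gP g'l xl fb.
apply: (le_trans (potential_step_aux gg' gP xl)).
have {xl}/andP[x0 xl] := xl.
rewrite ler_pM2l//; set U := unfound g'.
have m0 : 0 <= mu - lam j.
  by rewrite total_length_others sumr_ge0// => k _; rewrite ltW.
suff : (mu - lam j) * Num.max (g' j - x * kap) 0 <= x * (kap * lam j - g' j) by lra.
have [h|h] := leP (g' j - x * kap) 0.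
  by rewrite mulr0 mulr_ge0// subr_ge0.
lra.
Qed.

Lemma potential_step_strict j g g' (x : R) : 0 < kap ->
  (forall i, i != j -> g' i = g i) -> (forall i, 0 <= g i <= kap * lam i) ->
  0 < x <= lam j ->
  g' j * (x + (mu - lam j)) < kap * mu * x ->
  potential g - potential g' < 2 * (x * unfound g').
Proof.
move=> kap0 gg' gP /andP[x0 xl] fb.
have hx : 0 <= x <= lam j by rewrite ltW.
apply: (le_lt_trans (potential_step_aux gg' gP hx)).
rewrite ltr_pM2l//; set U := unfound g'.
have m0 : 0 <= mu - lam j.
  by rewrite total_length_others sumr_ge0// => k _; rewrite ltW.
suff : (mu - lam j) * Num.max (g' j - x * kap) 0 < x * (kap * lam j - g' j) by lra.
have [h|h] := leP (g' j - x * kap) 0; last lra.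
rewrite mulr0 mulr_gt0// subr_gt0.
have xm : 0 < x + (mu - lam j) by rewrite ltr_pwDl.
rewrite -(ltr_pM2r xm); apply: (lt_le_trans fb).
suff : 0 <= kap * ((mu - lam j) * (lam j - x)) by lra.
by rewrite mulr_ge0 ?(ltW kap0)// mulr_ge0// subr_ge0.
Qed.

Lemma potential_antitone g g' : (forall i, g i <= g' i) -> potential g' <= potential g.
Proof.
move=> gg'; apply: ler_sum => i _; apply: ler_sum => k _.
rewrite ler_wpM2l ?mulr_ge0// lerB// ge_max !le_max.
by rewrite !ler_pM2r ?invr_gt0// !gg' /= orbT.
Qed.

Lemma potential_ge0 g : (forall i, g i <= kap * lam i) -> 0 <= potential g.
Proof.
move=> gP; apply: sumr_ge0 => i _; apply: sumr_ge0 => k _.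
by rewrite mulr_ge0 ?mulr_ge0// subr_ge0 ge_max !ler_pdivrMr// !gP.
Qed.

Lemma potential_perturb g g' (eta : R) : 0 <= eta -> (forall i, g i <= g' i + eta) ->
  potential g' <= potential g + 2 * n%:R * mu * eta.
Proof.
move=> eta0 gg'; rewrite -lerBlDl /potential -sumrB.
under eq_bigr do rewrite -sumrB; apply: pair_sum_le => // i k ik.
rewrite -mulrBr ler_wpM2l ?mulr_ge0//.
have h l : g l / lam l <= g' l / lam l + eta / lam l.
  by rewrite -mulrDl ler_pM2r ?invr_gt0.
have e0 l : 0 <= eta / lam l by rewrite divr_ge0// ltW.
have [hi hk ei ek] := And4 (h i) (h k) (e0 i) (e0 k).
have m1 : g' i / lam i <= Num.max (g' i / lam i) (g' k / lam k) by rewrite le_max lexx.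
have m2 : g' k / lam k <= Num.max (g' i / lam i) (g' k / lam k) by rewrite le_max lexx orbT.
suff : Num.max (g i / lam i) (g k / lam k)
    <= Num.max (g' i / lam i) (g' k / lam k) + (eta / lam i + eta / lam k) by lra.
by rewrite ge_max; apply/andP; split; lra.
Qed.

(** Every pair of arcs contains one different from [j], which is nearly complete. *)
Lemma potential_small g j (eta : R) : 0 <= eta ->
  (forall i, i != j -> kap * lam i - eta <= g i) ->
  potential g <= 2 * n%:R * mu * eta.
Proof.
move=> eta0 gP; apply: pair_sum_le => // i k ik.
rewrite ler_wpM2l ?mulr_ge0//.
have h l : l != j -> kap - eta / lam l <= g l / lam l.
  by move=> lj; rewrite ler_pdivlMr// mulrBl divfK ?gt_eqF// gP.
have e0 l : 0 <= eta / lam l by rewrite divr_ge0// ltW.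
have := e0 i; have := e0 k.
have [ij|ij] := eqVneq i j.
  have /h : k != j by rewrite -ij eq_sym.
  by case: (leP (g i / lam i)); lra.
by have /h := ij; case: (leP (g i / lam i)); lra.
Qed.

Lemma potential0 : potential (fun=> 0) = kap * (mu ^+ 2 - \sum_i lam i ^+ 2).
Proof.
rewrite /potential mulrBr expr2 {1}/total_length mulr_suml !mulr_sumr -sumrB.
apply: eq_bigr => i _.
have -> : lam i * mu = lam i ^+ 2 + \sum_(k | k != i) lam i * lam k.
  by rewrite /total_length (bigD1 i)//= mulrDr -expr2 mulr_sumr.
rewrite mulrDr addrAC subrr add0r mulr_sumr; apply: eq_bigr => k _.
by rewrite !mul0r maxxx subr0 mulrC.
Qed.

End Potential.

(** * Masses of parts of a star *)

Section StarMeasure.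
Context {R : realType} {n : nat} {lam : 'I_n -> R}.
Context (lam_gt0 : forall j, 0 < lam j).
Local Notation Q := (star lam).
Local Notation BQ := (borel_star lam).
Local Notation mu := (total_length lam).
Implicit Types (p q : Q) (i j k : 'I_n) (t x : R).

Lemma open_measurable_star (A : set Q) : open A -> measurable (A : set BQ).
Proof. exact: sub_sigma_algebra. Qed.

Lemma closed_measurable_star (A : set Q) : closed A -> measurable (A : set BQ).
Proof.
move=> /closed_openC/open_measurable_star/measurableC; rewrite setCK; exact.
Qed.

Lemma open_starP (A : set Q) :
  (forall p, A p -> exists2 e, 0 < e & forall q, mdist p q < e -> A q) -> open A.
Proof.
move=> H; rewrite openE => p /H[e e0 He]; rewrite /interior -nbhs_ballE.
by exists e => //= q; rewrite ballEmdist; exact: He.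
Qed.

Lemma open_arcE j : open_arc j = [set q | arc q = Some j] :> set Q.
Proof.
apply/seteqP; split => [q [[y /=]]|q /= qj].
  rewrite in_itv /= => /andP[y0 yl] <- /eqP; rewrite -radius_gt0 radius_pt ?y0// => y_gt0.
  by rewrite arc_pt ?y_gt0.
have /andP[r0 rl] := radius_arc qj; split; last first.
  by apply/eqP; rewrite -radius_gt0.
exists (radius q); last exact: pt_arc.
by rewrite /= in_itv /= rl ltW.
Qed.

Lemma open_open_arc j : open (open_arc j : set Q).
Proof.
rewrite open_arcE; apply: open_starP => p pj; exists (radius p).
  by have /andP[] := radius_arc pj.
move=> q; apply: contraPP => /eqP qj; rewrite (dist_arcN pj qj).
by have := radius_ge0 q => ? ?; lra.
Qed.

Lemma measurable_arc j : measurable (open_arc j : set BQ).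
Proof. by apply: open_measurable_star; exact: open_open_arc. Qed.

Lemma measurable_root : measurable ([set root lam] : set BQ).
Proof.
apply: closed_measurable_star; rewrite -openC; apply: open_starP => p /eqP.
rewrite -radius_gt0 => p0; exists (radius p) => // q + /= qr.
by rewrite qr mdist_sym dist_root ltxx.
Qed.

Lemma closed_radius_le x : closed [set q : Q | radius q <= x].
Proof.
rewrite -openC; apply: open_starP => p /= /negP; rewrite -ltNge => xp.
exists (radius p - x); first by rewrite subr_gt0.
move=> q pq /= qx; have := radius_lip p q; rewrite ler_norml => /andP[_ ?]; lra.
Qed.

Lemma measurable_radius_le x : measurable ([set q : Q | radius q <= x] : set BQ).
Proof. by apply: closed_measurable_star; exact: closed_radius_le. Qed.

Lemma measurable_fun_radius : measurable_fun setT (@radius R n lam : BQ -> R).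
Proof.
move=> mT; apply: (measurability _ (RGenOInfty.measurableE R)) => //.
move=> _ [_ [x ->] <-]; rewrite setTI.
have -> : (@radius R n lam : BQ -> R) @^-1` `]x, +oo[%classic = ~` [set q : Q | radius q <= x].
  by apply/seteqP; split=> q /=; rewrite in_itv /= andbT ltNge => /negP.
by apply: measurableC; exact: measurable_radius_le.
Qed.

Lemma continuous_path (S : R -> Q) : nonexpanding S ->
  continuous (fun t => S (Num.max 0 t)).
Proof.
move=> SL u.
have gL v w : mdist (S (Num.max 0 v)) (S (Num.max 0 w)) <= `|v - w|.
  wlog vw : v w / v <= w.
    by move=> H; case: (leP v w) => [/H//|/ltW/H]; rewrite mdist_sym distrC.
  apply: (le_trans (nonexpanding_le SL _ _)).
  - by rewrite le_max lexx.
  - by case: (lerP 0 v) => hv; case: (lerP 0 w) => hw; lra.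
  rewrite distrC ger0_norm ?subr_ge0 //.
  by case: (lerP 0 v) => hv; case: (lerP 0 w) => hw; lra.
apply/cvg_ballP => e e0; near=> w.
rewrite ballEmdist /=; apply: (le_lt_trans (gL _ _)).
by near: w; exact: cvgr_dist_lt.
Unshelve. all: by end_near. Qed.

Lemma closed_found (S : R -> Q) t : nonexpanding S -> closed (found S t).
Proof.
move=> SL.
have -> : found S t = (fun t => S (Num.max 0 t)) @` `[0, t].
  apply/seteqP; split => q [u /= +  <-]; rewrite in_itv /= => /andP[u0 ut];
    by exists u; rewrite /= ?in_itv /= ?u0 ?ut//= max_r.
apply: compact_closed; first exact: metric_hausdorff.
apply: continuous_compact; last exact: segment_compact.
exact/continuous_subspaceT/continuous_path.
Qed.

Lemma measurable_found (S : R -> Q) t : nonexpanding S -> measurable (found S t : set BQ).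
Proof. by move=> SL; apply: closed_measurable_star; exact: closed_found. Qed.

Lemma measurable_hit_time (S : R -> Q) : nonexpanding S ->
  measurable_fun [set: BQ] (hit_time S : BQ -> \bar R).
Proof.
move=> SL mT; apply: (measurability _ (ErealGenOInfty.measurableE R)) => //.
move=> _ [_ [t ->] <-]; rewrite setTI.
have [t0|t0] := leP 0 t.
  have -> : (hit_time S : BQ -> \bar R) @^-1` `]t%:E, +oo[%classic = ~` (found S t).
    apply/seteqP; split=> q /=; rewrite in_itv /= andbT.
      by move=> tq /(hit_time_le _ SL t0); rewrite leNgt tq.
    by move=> nf; rewrite ltNge; apply/negP => /(hit_time_le _ SL t0).
  by apply: measurableC; exact: measurable_found.
have -> : (hit_time S : BQ -> \bar R) @^-1` `]t%:E, +oo[%classic = setT; last exact: measurableT.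
apply/seteqP; split=> q //= _; rewrite in_itv /= andbT.
by rewrite (lt_le_trans _ (hit_time_ge0 S q))// lte_fin.
Qed.

Section Masses.
Context (h : probability BQ R).

Definition prob (A : set BQ) : R := fine (h A).

Lemma probE (A : set BQ) : measurable A -> h A = (prob A)%:E.
Proof. by move=> mA; rewrite fineK// fin_num_measure. Qed.

Lemma prob_ge0 (A : set BQ) : 0 <= prob A. Proof. exact: fine_ge0. Qed.

Lemma le_prob (A B : set BQ) : measurable A -> measurable B -> A `<=` B ->
  prob A <= prob B.
Proof.
by move=> mA mB AB; rewrite -lee_fin -!probE//; apply: le_measure; rewrite ?inE.
Qed.

Lemma prob_setT : prob setT = 1.
Proof. by rewrite /prob probability_setT. Qed.

Lemma probU (A B : set BQ) : measurable A -> measurable B -> A `&` B = set0 ->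
  prob (A `|` B) = prob A + prob B.
Proof.
move=> mA mB AB; apply: EFin_inj; rewrite EFinD -!probE//; last exact: measurableU.
exact: measureU.
Qed.

Lemma prob_decomp (A : set BQ) : measurable A ->
  prob A = prob (A `&` [set root lam]) + \sum_j prob (A `&` open_arc j).
Proof.
move=> mA.
have mAj j : measurable (A `&` open_arc j : set BQ).
  by apply: measurableI => //; exact: measurable_arc.
have tAj : trivIset setT (fun j => A `&` (open_arc j : set BQ)).
  move=> i j _ _ [q [[_ + ] [_ +]]]; rewrite !open_arcE /= => qi qj.
  by move: qi; rewrite qj => -[].
have E : A = (A `&` [set root lam]) `|` \big[setU/set0]_(j < n) (A `&` open_arc j).
  apply/seteqP; split=> [q Aq|q]; last first.
    by case=> [[]//|]; elim/big_ind: _ => // [X Y HX HY [/HX|/HY]//|j _ []].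
  case aq : (arc q) => [j|]; last by left; split=> //; apply/eqP; rewrite -arc_root aq.
  right; rewrite (bigD1 j)//=; left; split=> //; by rewrite open_arcE.
have mb : measurable (\big[setU/set0]_(j < n) (A `&` (open_arc j : set BQ))).
  exact: bigsetU_measurable.
rewrite {1}E probU//; last 2 first.
- by apply: measurableI => //; exact: measurable_root.
- apply/seteqP; split=> // q [[_ /= ->]]; elim/big_ind: _ => //.
    by move=> X Y HX HY [/HX|/HY].
  by move=> j _ [_]; rewrite open_arcE.
congr (_ + _); apply: EFin_inj.
rewrite -probE// -sumEFin.
rewrite measure_bigsetU_ord//; apply: eq_bigr => j _; exact: probE.
Qed.

Definition arc_mass j x : R := prob [set q | arc q = Some j /\ radius q <= x].

Definition found_mass (S : R -> Q) t j : R := prob (found S t `&` open_arc j).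

(** By balance, the search density of every single arc ([balanced_arc]). *)
Definition mean_density : R := (1 - prob [set root lam]) / mu.

Lemma arc_upto_setE j x : 0 <= x <= lam j ->
  arc_upto j x = [set root lam] `|` [set q | arc q = Some j /\ radius q <= x] :> set Q.
Proof.
move=> /andP[x0 xl]; apply/seteqP; split=> q /=.
  move=> [y]; rewrite /= in_itv /= => /andP[y0 yx] <-.
  have [->|yn0] := eqVneq y 0; first by left; rewrite pt0.
  have y_gt0 : 0 < y by rewrite lt0r yn0.
  by right; rewrite arc_pt ?radius_pt ?y0 ?y_gt0 ?(le_trans yx).
move=> [->|[qj qx]].
  by exists 0; rewrite ?pt0//= in_itv /= lexx.
exists (radius q); last exact: pt_arc.
by rewrite /= in_itv /= radius_ge0.
Qed.

Lemma measurable_arc_radius j x :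
  measurable ([set q : Q | arc q = Some j /\ radius q <= x] : set BQ).
Proof.
rewrite (_ : [set _ | _] = open_arc j `&` [set q : Q | radius q <= x]); last by rewrite open_arcE.
by apply: measurableI; [exact: measurable_arc|exact: measurable_radius_le].
Qed.

Lemma arc_cdfE j x : 0 <= x <= lam j ->
  arc_cdf h j x = prob [set root lam] + arc_mass j x.
Proof.
move=> jx; rewrite /arc_cdf arc_upto_setE// -probU//.
- exact: measurable_root.
- exact: measurable_arc_radius.
- by apply/seteqP; split=> // q [/= ->] [].
Qed.

Lemma arc_mass_lam j : arc_mass j (lam j) = prob (open_arc j).
Proof.
rewrite /arc_mass open_arcE; congr prob; apply/seteqP; split=> [q []//|q /= qj].
by split=> //; have /andP[] := radius_arc qj.
Qed.

Lemma arc_mass_le j x y : x <= y -> arc_mass j x <= arc_mass j y.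
Proof.
move=> xy; apply: le_prob; [exact: measurable_arc_radius..|].
by move=> q [/= qj qx]; split=> //; exact: le_trans xy.
Qed.

Lemma star_length_open_arc j : star_length (open_arc j : set Q) = (lam j)%:E.
Proof.
rewrite /star_length (bigD1 j)//= big1 ?adde0 => [|i ij].
  rewrite (_ : [set x | _] = `]0, lam j]%classic).
    by rewrite lebesgue_measure_itv /= lte_fin lam_gt0 sube0.
  apply/seteqP; split=> x /=; rewrite in_itv /= open_arcE /=.
    move=> [/andP[x0 xl] a]; rewrite xl andbT lt0r x0 andbT; apply/eqP => xz.
    by move: a; rewrite xz pt0.
  by move=> xl; rewrite arc_pt//; split=> //; case/andP: xl => /ltW -> ->.
rewrite (_ : [set x | _] = set0) ?measure0//.
apply/seteqP; split=> // x /= [/andP[x0 xl]]; rewrite open_arcE /= => a.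
have [xz|xn0] := eqVneq x 0; first by move: a; rewrite xz pt0.
by move: a; rewrite arc_pt ?lt0r ?xn0 ?x0// => -[] /eqP; rewrite (negbTE ij).
Qed.

Lemma total_length_gt0 : (0 < n)%N -> 0 < mu.
Proof.
case: n lam lam_gt0 => // m l l0 _; rewrite /total_length big_ord_recl ltr_pwDl//.
by apply: sumr_ge0 => i _; exact: ltW.
Qed.

Lemma balanced_arc j : balanced h -> prob (open_arc j) = mean_density * lam j.
Proof.
move=> hb.
have E i : prob (open_arc i) = prob (open_arc j) / lam j * lam i.
  have := hb i j; rewrite /search_density !star_length_open_arc /= -/(prob _) => <-.
  by rewrite divfK// gt_eqF.
rewrite E; congr (_ * _); have := prob_decomp measurableT; rewrite prob_setT setTI.
under eq_bigr do rewrite setTI E; rewrite -mulr_sumr -/mu => e.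
have mu0 : mu != 0 by rewrite gt_eqF// total_length_gt0// (leq_ltn_trans _ (ltn_ord j)).
apply: (mulIf mu0); rewrite /mean_density divfK//; lra.
Qed.

Section Balanced.
Context (hb : balanced h).
Context (n1 : (1 < n)%N).

Lemma mean_density_ge0 : 0 <= mean_density.
Proof.
rewrite divr_ge0 ?(ltW (total_length_gt0 _)) ?(ltnW n1)// subr_ge0 -prob_setT.
by apply: le_prob => //; exact: measurable_root.
Qed.

Lemma others_gt0 j : 0 < mu - lam j.
Proof.
have [k kj] : exists k, k != j.
  have [j0|j0] := eqVneq (val j) 0%N.
    by exists (Ordinal n1); rewrite -val_eqE /= j0.
  by exists (Ordinal (ltnW n1)); rewrite -val_eqE /= eq_sym.
rewrite total_length_others (bigD1 k)//= ltr_pwDl//.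
by apply: sumr_ge0 => i _; exact: ltW.
Qed.

Lemma mean_density_mu : mean_density * mu = 1 - prob [set root lam].
Proof. by rewrite /mean_density divfK// gt_eqF// total_length_gt0// ltnW. Qed.

(** By balance, [arc_prob h j * mu - lam j] is the mass of the root times [mu - lam j]. It is
    nonnegative, so the positive part in the bound disappears. *)
Lemma bias_boundE j x : 0 <= x <= lam j ->
  bias_bound h j x - arc_cdf h j x =
  (mean_density * mu * x - arc_mass j x * (x + (mu - lam j))) / (x + (mu - lam j)).
Proof.
move=> xl; have /andP[x0 _] := xl.
have m0 := others_gt0 j; have xm : x + (mu - lam j) != 0 by rewrite gt_eqF// ltr_wpDl.
rewrite /bias_bound /arc_prob !arc_cdfE ?lexx ?(ltW (lam_gt0 _))//.
rewrite arc_mass_lam balanced_arc//.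
have E : (prob [set root lam] + mean_density * lam j) * mu - lam j =
         prob [set root lam] * (mu - lam j).
  by rewrite mulrDl mulrAC mean_density_mu; ring.
rewrite E max_l ?mulr_ge0 ?prob_ge0 ?ltW// mean_density_mu -addrA.
by field.
Qed.

Lemma bias_le j x : 0 <= x <= lam j ->
  (arc_cdf h j x <= bias_bound h j x) =
  (arc_mass j x * (x + (mu - lam j)) <= mean_density * mu * x).
Proof.
move=> xl; have /andP[x0 _] := xl.
rewrite -subr_ge0 bias_boundE// pmulr_lge0 ?subr_ge0//.
by rewrite invr_gt0 ltr_wpDl// others_gt0.
Qed.

Lemma bias_lt j x : 0 <= x <= lam j ->
  (arc_cdf h j x < bias_bound h j x) =
  (arc_mass j x * (x + (mu - lam j)) < mean_density * mu * x).
Proof.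
move=> xl; have /andP[x0 _] := xl.
rewrite -subr_gt0 bias_boundE// pmulr_lgt0; last first.
  by rewrite invr_gt0 ltr_wpDl// others_gt0.
by rewrite subr_gt0.
Qed.

End Balanced.
End Masses.
End StarMeasure.

(** * Delays *)

Section Delays.
Context {R : realType} {n : nat} {lam : 'I_n -> R}.
Local Notation Q := (star lam).
Local Notation BQ := (borel_star lam).
Implicit Types (S : R -> Q) (q : Q) (j : 'I_n) (t s e : R).

(** The walk from the root to a point is spent in every search; only the remaining part of
    the hitting time depends on the search. *)
Definition delay S q : \bar R := (hit_time S q - (radius q)%:E)%E.

Lemma hit_time_after S q e : lip_search S -> 0 <= e -> S e = root lam -> ~ found S e q ->
  ((e + radius q)%:E <= hit_time S q)%E.
Proof.
move=> [S0 SL] e0 Se nf; apply: le_ereal_inf_tmp => _ [u [u0 Su] <-]; rewrite lee_fin.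
have [ue|eu] := leP u e; first by exfalso; apply: nf; apply/foundP; exists u.
by have := radius_le_time SL e0 (ltW eu) Se; rewrite Su; lra.
Qed.

Lemma hit_time_ge_radius S q : lip_search S -> ((radius q)%:E <= hit_time S q)%E.
Proof.
move=> [S0 SL]; apply: le_ereal_inf_tmp => _ [u [u0 Su] <-]; rewrite lee_fin.
by have := radius_le_time SL (lexx 0) u0 S0; rewrite Su subr0.
Qed.

Lemma delay_ge0 S q : lip_search S -> (0 <= delay S q)%E.
Proof. by move=> SS; rewrite /delay sube_ge0// hit_time_ge_radius. Qed.

Lemma delay_after S q e : lip_search S -> 0 <= e -> S e = root lam -> ~ found S e q ->
  (e%:E <= delay S q)%E.
Proof.
by move=> SS e0 Se nf; rewrite /delay leeBrDr// -EFinD hit_time_after.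
Qed.

Lemma delayK S q : (delay S q + (radius q)%:E)%E = hit_time S q.
Proof. by rewrite /delay subeK. Qed.

Lemma measurable_delay S : nonexpanding S -> measurable_fun setT (delay S : BQ -> \bar R).
Proof.
move=> SL; apply: emeasurable_funB; first exact: measurable_hit_time.
apply/measurable_EFinP; exact: measurable_fun_radius.
Qed.

Context (h : probability BQ R).

Definition mean_radius : R := fine (\int[h]_q (radius q)%:E).

(** The part of the mean delay that has accumulated up to time [t]; unlike the delay, it can be
    compared with the state of the search at time [t]. *)
Definition capped_delay S t : R := fine (\int[h]_q mine (delay S q) t%:E).

Lemma integral_cst_prob (a : R) : (\int[h]_q a%:E)%E = a%:E.
Proof.
rewrite (integral_cst h measurableT a%:E) -[RHS]mule1; congr (_ * _)%E.
exact: probability_setT.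
Qed.

Lemma radius_le_total q : (forall j, 0 < lam j) -> radius q <= total_length lam.
Proof.
move=> lam_gt0; case aq : (arc q) => [j|].
  have /andP[_ ql] := radius_arc aq; apply: (le_trans ql).
  rewrite /total_length (bigD1 j)//= lerDl; apply: sumr_ge0 => i _; exact: ltW.
move/eqP: aq; rewrite arc_root => /eqP -> /=.
by apply: sumr_ge0 => i _; exact: ltW.
Qed.

Lemma mean_radiusE : (forall j, 0 < lam j) ->
  (\int[h]_q (radius q)%:E)%E = mean_radius%:E.
Proof.
move=> lam_gt0; rewrite /mean_radius fineK//.
have mr : measurable_fun setT (fun q : BQ => (radius q)%:E).
  by apply/measurable_EFinP; exact: measurable_fun_radius.
rewrite ge0_fin_numE; last by apply: integral_ge0 => q _; rewrite lee_fin radius_ge0.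
apply: (@le_lt_trans _ _ (\int[h]_q (total_length lam)%:E)%E).
  apply: ge0_le_integral => //.
  - by move=> q _; rewrite lee_fin radius_ge0.
  - by move=> q _; rewrite lee_fin radius_le_total.
by rewrite integral_cst_prob ltry.
Qed.

Lemma search_timeE S : (forall j, 0 < lam j) -> lip_search S ->
  search_time S h = (\int[h]_q delay S q + mean_radius%:E)%E.
Proof.
move=> lam_gt0 SS; have [S0 SL] := SS; rewrite -mean_radiusE// -ge0_integralD//.
- by apply: eq_integral => q _; rewrite delayK.
- by move=> q _; exact: delay_ge0.
- exact: measurable_delay.
- by move=> q _; rewrite lee_fin radius_ge0.
- by apply/measurable_EFinP; exact: measurable_fun_radius.
Qed.

Lemma measurable_capped S t : nonexpanding S ->
  measurable_fun setT (fun q : BQ => mine (delay S q) t%:E).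
Proof. by move=> SL; apply: measurable_mine => //; exact: measurable_delay. Qed.

Lemma capped_ge0 S t q : lip_search S -> 0 <= t -> (0 <= mine (delay S q) t%:E)%E.
Proof. by move=> SS t0; rewrite le_min delay_ge0// lee_fin. Qed.

Lemma capped_delayE S t : lip_search S -> 0 <= t ->
  (\int[h]_q mine (delay S q) t%:E)%E = (capped_delay S t)%:E.
Proof.
move=> SS t0; have [S0 SL] := SS; rewrite /capped_delay fineK//.
rewrite ge0_fin_numE; last by apply: integral_ge0 => q _; exact: capped_ge0.
apply: (@le_lt_trans _ _ (\int[h]_q t%:E)%E).
  apply: ge0_le_integral => //.
  - by move=> q _; exact: capped_ge0.
  - exact: measurable_capped.
  - by move=> q _; rewrite ge_min lexx orbT.
by rewrite integral_cst_prob ltry.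
Qed.

Lemma capped_delay0 S : lip_search S -> capped_delay S 0 = 0.
Proof.
move=> SS; rewrite /capped_delay; under eq_integral do rewrite min_r ?delay_ge0//.
by rewrite integral0.
Qed.

Lemma capped_delay_le S t : lip_search S -> 0 <= t ->
  ((capped_delay S t)%:E <= \int[h]_q delay S q)%E.
Proof.
move=> SS t0; have [S0 SL] := SS; rewrite -capped_delayE//; apply: ge0_le_integral => //.
- by move=> q _; exact: capped_ge0.
- exact: measurable_capped.
- exact: measurable_delay.
- by move=> q _; rewrite ge_min lexx.
Qed.

Lemma integral_indicM (A : set BQ) (a : R) : 0 <= a -> measurable A ->
  (\int[h]_q (a%:E * (\1_A q)%:E))%E = (a * prob h A)%:E.
Proof.
move=> a0 mA; rewrite ge0_integralZl_EFin//.
  by rewrite EFinM; congr (_ * _)%E; rewrite integral_indic// setIT; exact: probE.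
by apply/measurable_EFinP; exact: measurable_indic.
Qed.

Lemma measurable_indicM (A : set BQ) (a : R) : measurable A ->
  measurable_fun setT (fun q : BQ => (a%:E * (\1_A q)%:E)%E).
Proof.
by move=> mA; apply: measurable_funeM; apply/measurable_EFinP; exact: measurable_indic.
Qed.

(** Between two visits of the root, whatever is still unfound at the second one is
    delayed by the time that passes. *)
Lemma capped_delayD S s e : lip_search S -> 0 <= s -> s <= e -> S e = root lam ->
  (e - s) * prob h (~` found S e) <= capped_delay S e - capped_delay S s.
Proof.
move=> SS s0 se Se; have [S0 SL] := SS; have e0 := le_trans s0 se.
have mf : measurable (~` found S e : set BQ) by apply: measurableC; exact: measurable_found.
rewrite lerBrDl -lee_fin EFinD -!capped_delayE// -integral_indicM ?subr_ge0//.
rewrite -ge0_integralD//.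
- apply: ge0_le_integral => //.
  + move=> q _; rewrite adde_ge0 ?capped_ge0// -EFinM lee_fin mulr_ge0// subr_ge0//.
  + by apply: emeasurable_funD; [exact: measurable_capped|exact: measurable_indicM].
  + exact: measurable_capped.
  move=> q _; rewrite indicE; case: (asboolP ((~` found S e) q)) => [nf|f].
    rewrite mem_set// mule1.
    have eW := delay_after SS e0 Se nf.
    have sW : (s%:E <= delay S q)%E by apply: le_trans eW; rewrite lee_fin.
    by rewrite !min_r// -EFinD lee_fin; lra.
  rewrite memNset// mule0 adde0 le_min ge_min lexx /= ge_min lee_fin se orbT.
  by [].
- by move=> q _; exact: capped_ge0.
- exact: measurable_capped.
- by move=> q _; rewrite -EFinM lee_fin mulr_ge0// subr_ge0.
- exact: measurable_indicM.
Qed.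

Lemma capped_delay_homo S s e : lip_search S -> 0 <= s -> s <= e -> S e = root lam ->
  capped_delay S s <= capped_delay S e.
Proof.
move=> SS s0 se Se; have := capped_delayD SS s0 se Se.
have := prob_ge0 h (~` found S e) => p0 H; rewrite -subr_ge0; apply: le_trans H.
by rewrite mulr_ge0// subr_ge0.
Qed.

Lemma markov_unfound S t : lip_search S -> 0 <= t ->
  ((t * prob h (~` found S t))%:E <= search_time S h)%E.
Proof.
move=> SS t0; have [S0 SL] := SS.
have mf : measurable (~` found S t : set BQ) by apply: measurableC; exact: measurable_found.
rewrite -integral_indicM//; apply: ge0_le_integral => //.
- by move=> q _; rewrite -EFinM lee_fin mulr_ge0.
- exact: measurable_indicM.
- exact: measurable_hit_time.
move=> q _; rewrite indicE; case: (asboolP ((~` found S t) q)) => [nf|f].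
  by rewrite mem_set// mule1 leNgt; apply/negP => /ltW/(hit_time_le _ SL t0).
by rewrite memNset// mule0 hit_time_ge0.
Qed.

End Delays.

(** * The lower bound under forward bias *)

Section Excursions.
Context {R : realType} {n : nat} {lam : 'I_n -> R}.
Local Notation Q := (star lam).
Implicit Types (S : R -> Q) (q : Q) (i j : 'I_n) (t s e : R).

Definition excursion S a b :=
  [/\ a < b, S a = root lam, S b = root lam & forall t, a < t < b -> S t != root lam].

Lemma excursion_radius S a b t : nonexpanding S -> 0 <= a -> excursion S a b ->
  a <= t <= b -> radius (S t) <= (b - a) / 2.
Proof.
move=> SL a0 [ab Sa Sb _] /andP[at_ tb].
have := radius_le_time SL a0 at_ Sa; have := radius_le_time_to SL (le_trans a0 at_) tb Sb.
lra.
Qed.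

Lemma excursion_arc S a b : lip_search S -> 0 <= a -> excursion S a b ->
  exists j, forall t, a < t < b -> arc (S t) = Some j.
Proof.
move=> [S0 SL] a0 [ab Sa Sb Sn0]; pose m := (a + b) / 2.
have mab : a < m < b by apply/andP; split; rewrite /m; lra.
case aSm : (arc (S m)) => [j|]; last first.
  by move/eqP: aSm; rewrite arc_root (negbTE (Sn0 _ mab)).
exists j => t /andP[at_ tb]; case/andP: mab => am mb.
rewrite -aSm; have [tm|/ltW mt] := leP t m.
- apply: no_root_same_arc => //; first lra.
  by move=> u /andP[tu um]; apply: Sn0; rewrite (lt_le_trans at_)// (le_lt_trans um).
- apply/esym/no_root_same_arc => //; first lra.
  by move=> u /andP[tu um]; apply: Sn0; rewrite (lt_le_trans am)// (le_lt_trans um).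
Qed.

Lemma found_excursion S a b q : nonexpanding S -> 0 <= a -> excursion S a b ->
  found S b q -> found S a q \/ exists2 t, a < t < b & S t = q.
Proof.
move=> SL a0 [ab Sa Sb _] /foundP[u [u0 ub Su]].
have [ua|au] := leP u a; first by left; apply/foundP; exists u.
have [ueb|uneb] := eqVneq u b.
  by left; apply/foundP; exists a; split=> //; rewrite Sa -Su ueb Sb.
by right; exists u => //; rewrite au lt_neqAle uneb ub.
Qed.

Lemma found_excursion_other S a b j q : nonexpanding S -> 0 <= a -> excursion S a b ->
  (forall t, a < t < b -> arc (S t) = Some j) -> arc q != Some j ->
  found S b q -> found S a q.
Proof.
move=> SL a0 ex exj qj /(found_excursion SL a0 ex)[//|[t tab Stq]].
by move: qj; rewrite -Stq exj// eqxx.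
Qed.

(** The explored part of an arc is an initial segment, so an excursion that finds anything
    new has gone beyond everything found before on its arc. *)
Lemma found_excursion_same S a b j (x : R) : lip_search S -> 0 <= a -> excursion S a b ->
  (forall t, a < t < b -> arc (S t) = Some j) ->
  (forall t, a < t < b -> radius (S t) <= x) ->
  (forall q, arc q = Some j -> found S b q -> found S a q) \/
  (forall q, arc q = Some j -> found S b q -> radius q <= x).
Proof.
move=> SS a0 ex exj exx; have [S0 SL] := SS.
have [|] := pselect (forall q, arc q = Some j -> found S b q -> found S a q); first by left.
move=> /existsNP[p /not_implyP[pj /not_implyP[pb pa]]]; right=> q qj.
have px : radius p <= x.
  by have [//|[t tab <-]] := found_excursion SL a0 ex pb; exact: exx.
have [/foundP[u [u0 ua Su]] _|na] := pselect (found S a q); last first.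
  by move=> /(found_excursion SL a0 ex)[//|[t tab <-]]; exact: exx.
rewrite leNgt; apply/negP => xq; apply: pa; rewrite -(pt_arc pj).
apply: (@found_below _ _ _ _ _ _ (radius q)) => //.
- by rewrite radius_ge0 (le_trans px)// ltW.
- by have /andP[] := radius_arc qj.
- by rewrite pt_arc//; apply/foundP; exists u.
Qed.

End Excursions.

Section LowerBound.
Context {R : realType} {n : nat} {lam : 'I_n -> R}.
Context (lam_gt0 : forall j, 0 < lam j).
Local Notation Q := (star lam).
Local Notation BQ := (borel_star lam).
Local Notation mu := (total_length lam).
Context (h : probability BQ R) (hb : balanced h) (n1 : (1 < n)%N).
Local Notation kap := (mean_density h).
Implicit Types (S : R -> Q) (q : Q) (i j : 'I_n) (t s e : R).

Let lam_ge0 j : 0 <= lam j. Proof. exact: ltW. Qed.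
Let mu_gt0 : 0 < mu. Proof. by apply: total_length_gt0 => //; exact: ltnW. Qed.
Let kap_ge0 : 0 <= kap. Proof. exact: mean_density_ge0. Qed.

Definition stage_potential S t : R := potential lam kap (found_mass h S t).

Lemma measurable_found_arc S t j : nonexpanding S ->
  measurable (found S t `&` open_arc j : set BQ).
Proof. by move=> SL; apply: measurableI; [exact: measurable_found|exact: measurable_arc]. Qed.

Lemma found_mass_ge0 S t j : 0 <= found_mass h S t j. Proof. exact: prob_ge0. Qed.

Lemma found_mass_le S t j : nonexpanding S -> found_mass h S t j <= kap * lam j.
Proof.
move=> SL; rewrite -balanced_arc//; apply: le_prob.
- exact: measurable_found_arc.
- exact: measurable_arc.
- by move=> q [].
Qed.

Lemma found_mass_sub S t s j : nonexpanding S ->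
  (forall q, arc q = Some j -> found S t q -> found S s q) ->
  found_mass h S t j <= found_mass h S s j.
Proof.
move=> SL H; apply: le_prob; [exact: measurable_found_arc..|].
by move=> q [fq]; rewrite open_arcE /= => qj; split=> //; exact: H.
Qed.

Lemma found_mass_homo S t s j : nonexpanding S -> t <= s ->
  found_mass h S t j <= found_mass h S s j.
Proof. by move=> SL ts; apply: found_mass_sub => // q _; exact: found_le. Qed.

Lemma found_mass_le_arc_mass S t j (x : R) : nonexpanding S ->
  (forall q, arc q = Some j -> found S t q -> radius q <= x) ->
  found_mass h S t j <= arc_mass h j x.
Proof.
move=> SL H; apply: le_prob.
- exact: measurable_found_arc.
- exact: measurable_arc_radius.
- by move=> q [fq]; rewrite open_arcE /= => qj; split=> //; exact: H.
Qed.

Lemma unfound_found_mass S t : lip_search S -> 0 <= t ->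
  unfound lam kap (found_mass h S t) = prob h (~` found S t).
Proof.
move=> SS t0; have [S0 SL] := SS.
have mf := measurable_found t SL.
rewrite (prob_decomp h (measurableC mf)) (_ : _ `&` [set root lam] = set0); last first.
  apply/seteqP; split=> // q [/= nf qr]; apply: nf; rewrite qr; exact: found_root.
rewrite /prob measure0 /= add0r; apply: eq_bigr => j _.
rewrite -balanced_arc// -!/(prob _ _) /found_mass.
have E : (open_arc j : set BQ) = (found S t `&` open_arc j) `|` (~` found S t `&` open_arc j).
  by rewrite -setIUl setUv setTI.
rewrite [in X in X - _]E probU.
- by rewrite addrAC subrr add0r.
- exact: measurable_found_arc.
- by apply: measurableI; [exact: measurableC|exact: measurable_arc].
- by apply/seteqP; split=> // q [[? _] [? _]].
Qed.

Lemma stage_potential_ge0 S t : nonexpanding S -> 0 <= stage_potential S t.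
Proof. by move=> SL; apply: potential_ge0 => // i; exact: found_mass_le. Qed.

Lemma stage_potential0 S : lip_search S ->
  stage_potential S 0 = kap * (mu ^+ 2 - \sum_i lam i ^+ 2).
Proof.
move=> [S0 SL]; rewrite -potential0 /stage_potential; congr potential.
apply/funext => j; rewrite /found_mass (_ : _ `&` _ = set0) ?/prob ?measure0//.
apply/seteqP; split=> // q [/foundP[u [u0 ule Su]]]; rewrite open_arcE /= => qj.
by move: qj; rewrite -Su (_ : u = 0) ?S0//; apply/eqP; rewrite eq_le ule.
Qed.

Context (fb : forall j (x : R), 0 <= x <= lam j ->
  arc_mass h j x * (x + (mu - lam j)) <= kap * mu * x).

(** Infinitely many ever smaller excursions may accumulate at a time. They only matter
    within distance [eps] of the root; counting that part of an arc as found only once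
    its far end is reached makes them invisible, at the price of a mass that vanishes
    with [eps] by forward bias. *)
Definition coarse_mass (eps : R) S t j : R :=
  if `[< found S t (pt lam j eps) >] then found_mass h S t j else 0.

Lemma coarse_mass_bounds eps S t j : nonexpanding S ->
  0 <= coarse_mass eps S t j <= kap * lam j.
Proof.
move=> SL; rewrite /coarse_mass; case: asboolP => _.
  by rewrite found_mass_ge0 found_mass_le.
by rewrite lexx mulr_ge0.
Qed.

Lemma coarse_mass_le eps S t j : coarse_mass eps S t j <= found_mass h S t j.
Proof. by rewrite /coarse_mass; case: asboolP => _; rewrite ?lexx// found_mass_ge0. Qed.

Lemma coarse_mass_ge eps S t j : lip_search S -> 0 < eps <= lam j ->
  found_mass h S t j <= coarse_mass eps S t j + arc_mass h j eps.
Proof.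
move=> SS /andP[e0 el]; have [S0 SL] := SS.
rewrite /coarse_mass; case: asboolP => [_|nf]; first by rewrite lerDl prob_ge0.
rewrite add0r; apply: found_mass_le_arc_mass => // q qj fq.
rewrite leNgt; apply/negP => eq; apply: nf.
apply: (@found_below _ _ _ _ _ _ (radius q)); rewrite ?(ltW e0) ?(ltW eq) ?pt_arc//.
by have /andP[] := radius_arc qj.
Qed.

Lemma coarse_mass_eq eps S s t j : lip_search S -> 0 < eps <= lam j -> s <= t ->
  (forall q, arc q = Some j -> found S t q -> found S s q) ->
  coarse_mass eps S t j = coarse_mass eps S s j.
Proof.
move=> [S0 SL] el st H; rewrite /coarse_mass.
have -> : `[< found S t (pt lam j eps) >] = `[< found S s (pt lam j eps) >].
  by apply: asbool_equiv_eq; split; [apply: H; exact: arc_pt|exact: found_le].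
case: ifP => // _; apply/eqP; rewrite eq_le found_mass_sub//=.
exact: found_mass_homo.
Qed.

Lemma exists_min_length : exists2 l : R, 0 < l & forall j, l <= lam j.
Proof.
exists (\big[Num.min/1]_j lam j); last by move=> j; exact: bigmin_le.
by apply: lt_bigmin.
Qed.

Section Coarse.
Context (eps : R) (eps_gt0 : 0 < eps) (eps_le : forall j, eps <= lam j).
Local Notation eta := (\sum_j arc_mass h j eps).

Let eps_lam j : 0 < eps <= lam j. Proof. by rewrite eps_gt0 eps_le. Qed.

Let coarse_potential S t := potential lam kap (coarse_mass eps S t).

Lemma unfound_coarse S t : lip_search S ->
  unfound lam kap (coarse_mass eps S t) <= unfound lam kap (found_mass h S t) + eta.
Proof.
move=> SS; rewrite /unfound -big_split /=; apply: ler_sum => j _.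
by have := coarse_mass_ge t SS (eps_lam j); lra.
Qed.

(** The search is at depth at most half the duration of the excursion, so [potential_step]
    applies at that depth, or at the full length of the arc if the excursion is longer. *)
Lemma coarse_excursion S a b : lip_search S -> 0 <= a -> excursion S a b ->
  coarse_potential S a - coarse_potential S b
    <= capped_delay h S b - capped_delay h S a + (b - a) * eta.
Proof.
move=> SS a0 ex; have [S0 SL] := SS; have [ab Sa Sb _] := ex.
have b0 : 0 <= b by lra.
have [j exj] := excursion_arc SS a0 ex.
pose x := Num.min ((b - a) / 2) (lam j).
have x0 : 0 <= x by rewrite le_min lam_ge0 andbT divr_ge0// subr_ge0 ltW.
have xl : x <= lam j by rewrite ge_min lexx orbT.
have xb : x <= (b - a) / 2 by rewrite ge_min lexx.
have exx t : a < t < b -> radius (S t) <= x.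
  move=> tab; rewrite le_min (excursion_radius SL a0 ex)/=.
    by have /andP[] := radius_arc (exj _ tab).
  by case/andP: tab => /ltW -> /ltW ->.
have other i : i != j -> coarse_mass eps S b i = coarse_mass eps S a i.
  move=> ij; apply: coarse_mass_eq => //; first exact: ltW.
  move=> q qi; apply: (found_excursion_other SL a0 ex exj).
  by rewrite qi; apply: contra ij => /eqP[->].
have step : coarse_potential S a - coarse_potential S b
    <= 2 * (x * unfound lam kap (coarse_mass eps S b)).
  have [same|newx] := found_excursion_same SS a0 ex exj exx.
    have -> : coarse_potential S b = coarse_potential S a.
      congr potential; apply/funext => i; have [->|/other//] := eqVneq i j.
      by apply: coarse_mass_eq => //; exact: ltW.
    rewrite subrr mulr_ge0// mulr_ge0//; apply: sumr_ge0 => i _.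
    by rewrite subr_ge0; have /andP[] := coarse_mass_bounds eps b i SL.
  apply: (@potential_step _ _ _ _ lam_gt0 j) => //.
  - by move=> i; exact: coarse_mass_bounds.
  - by have /andP[] := coarse_mass_bounds eps b j SL.
  - by rewrite x0.
  apply: le_trans (fb (_ : 0 <= x <= lam j)); last by rewrite x0.
  have m0 := others_gt0 lam_gt0 n1 j; rewrite ler_wpM2r//; first lra.
  by apply: le_trans (coarse_mass_le _ _ _ _) (_ : _ <= _); exact: found_mass_le_arc_mass.
apply: (le_trans step).
have U0 : 0 <= unfound lam kap (coarse_mass eps S b).
  apply: sumr_ge0 => i _.
  by rewrite subr_ge0; have /andP[] := coarse_mass_bounds eps b i SL.
have h1 := ler_wpM2r U0 xb.
have ba : 0 <= b - a by rewrite subr_ge0 ltW.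
have h2 := ler_wpM2l ba (unfound_coarse b SS).
have h3 := capped_delayD h SS a0 (ltW ab) Sb.
rewrite -unfound_found_mass// in h3; lra.
Qed.

(** Between two visits of the root at most [eps] apart, the far end of the coarse part is out of
    reach, and everything in reach below a far end that was reached before is known. *)
Lemma coarse_short S s e : lip_search S -> 0 <= s -> s <= e -> e - s <= eps ->
  S s = root lam -> S e = root lam -> coarse_potential S e = coarse_potential S s.
Proof.
move=> SS s0 se ees Ss Se; have [S0 SL] := SS.
congr potential; apply/funext => j.
have late u : s <= u -> u <= e -> radius (S u) <= eps / 2.
  move=> su ue; have := radius_le_time SL s0 su Ss.
  have := radius_le_time_to SL (le_trans s0 su) ue Se; lra.
have fpt : found S e (pt lam j eps) -> found S s (pt lam j eps).
  move=> /foundP[u [u0 ue Su]]; have [us|/ltW su] := leP u s.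
    by apply/foundP; exists u.
  by exfalso; have := eps_gt0; have := late u su ue; rewrite Su radius_pt ?(ltW eps_gt0) ?eps_le//; lra.
rewrite /coarse_mass; case: asboolP => [/fpt fs|nf]; last first.
  by case: asboolP => // /(found_le se).
rewrite (asboolT fs) /=; apply/eqP; rewrite eq_le; apply/andP; split; last exact: found_mass_homo.
apply: found_mass_sub => // q qj /foundP[u [u0 ue Su]].
have [us|/ltW su] := leP u s; first by apply/foundP; exists u.
rewrite -(pt_arc qj); apply: (found_below SS _ _ fs) => //.
by rewrite radius_ge0 -Su; have := late u su ue; lra.
Qed.

(** Induction on the number of steps of length [eps]: the excursion that is under way at the
    end of the first step is completed, and what precedes it is too short to matter. *)
Lemma coarse_slack S N : lip_search S -> forall s e, 0 <= s -> s <= e ->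
  e - s <= N%:R * eps -> S s = root lam -> S e = root lam ->
  coarse_potential S s - coarse_potential S e
    <= capped_delay h S e - capped_delay h S s + (e - s) * eta.
Proof.
move=> SS; have [S0 SL] := SS.
have eta0 : 0 <= eta by apply: sumr_ge0 => j _; exact: prob_ge0.
have short s e : 0 <= s -> s <= e -> e - s <= eps -> S s = root lam -> S e = root lam ->
    coarse_potential S s - coarse_potential S e
      <= capped_delay h S e - capped_delay h S s + (e - s) * eta.
  move=> s0 se ees Ss Se; rewrite (coarse_short SS s0 se ees Ss Se) subrr.
  have := capped_delay_homo h SS s0 se Se.
  have : 0 <= (e - s) * eta by rewrite mulr_ge0// subr_ge0.
  lra.
elim: N => [|N IH] s e s0 se.
  by rewrite mul0r => es Ss Se; apply: short => //; apply: le_trans es (ltW eps_gt0).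
move=> esN Ss Se; have [es|es] := leP (e - s) eps; first exact: short.
have e_gt0 := eps_gt0.
have m0 : 0 <= s + eps by rewrite addr_ge0// ltW.
have me : s + eps <= e by lra.
have [a [a0 am Sa aroot]] := last_root_time SS m0.
have [b [mb be Sb broot]] := next_root_time SL m0 me Se.
have sa : s <= a.
  rewrite leNgt; apply/negP => as_; have := aroot s; rewrite as_ lerDl (ltW eps_gt0) Ss.
  by move=> /(_ isT); rewrite eqxx.
have h1 : _ := short s a s0 sa ltac:(lra) Ss Sa.
have h3 : _ := IH b e (le_trans m0 mb) be ltac:(move: esN; rewrite -natr1; lra) Sb Se.
have [ab|ba] := ltP a b; last first.
  have ab : a = b by apply/eqP; rewrite eq_le ba (le_trans am).
  by move: h1; rewrite ab; lra.
have ex : excursion S a b.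
  split=> // t /andP[at_ tb]; have [tm|/ltW mt] := leP t (s + eps).
    by apply: aroot; rewrite at_.
  by apply: broot; rewrite mt.
have := coarse_excursion SS a0 ex; lra.
Qed.

End Coarse.

Lemma arc_mass_small j (x : R) : 0 <= x <= lam j ->
  arc_mass h j x <= x * (kap * mu / (mu - lam j)).
Proof.
move=> xl; have /andP[x0 _] := xl; have m0 := others_gt0 lam_gt0 n1 j.
have A0 : 0 <= arc_mass h j x by exact: prob_ge0.
rewrite mulrA ler_pdivlMr// mulrC.
have := fb xl; have : 0 <= arc_mass h j x * x by rewrite mulr_ge0.
lra.
Qed.

(** The limit of [coarse_slack] as [eps] tends to 0. *)
Lemma slack_ge0 S s e : lip_search S -> 0 <= s -> s <= e -> S s = root lam ->
  S e = root lam ->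
  stage_potential S s - stage_potential S e <= capped_delay h S e - capped_delay h S s.
Proof.
move=> SS s0 se Ss Se; have [S0 SL] := SS.
have [l l0 ll] := exists_min_length.
pose C := \sum_j kap * mu / (mu - lam j).
have C0 : 0 <= C.
  apply: sumr_ge0 => j _; apply: divr_ge0; first by rewrite mulr_ge0// ltW.
  by rewrite ltW// others_gt0.
pose D := (e - s + 2 * n%:R * mu) * C.
have D0 : 0 <= D.
  rewrite mulr_ge0// addr_ge0 ?subr_ge0// mulr_ge0 ?mulr_ge0 ?ler0n//; exact: ltW.
apply/ler_addgt0Pl => d d0.
pose eps := Num.min l (d / (D + 1)).
have D1 : 0 < D + 1 by rewrite ltr_wpDl.
have eps0 : 0 < eps by rewrite lt_min l0 divr_gt0.
have epsl j : eps <= lam j by rewrite ge_min ll.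
have epsD : eps * D <= d.
  have : eps <= d / (D + 1) by rewrite ge_min lexx orbT.
  by rewrite ler_pdivlMr// mulrDr mulr1; have := eps0; lra.
pose eta := \sum_j arc_mass h j eps.
have etaC : eta <= eps * C.
  rewrite /eta /C mulr_sumr; apply: ler_sum => j _; apply: arc_mass_small.
  by rewrite ltW//= epsl.
have eta0 : 0 <= eta by apply: sumr_ge0 => j _; exact: prob_ge0.
have eta1 j : arc_mass h j eps <= eta.
  by rewrite /eta (bigD1 j)//= lerDl; apply: sumr_ge0 => i _; exact: prob_ge0.
have eN : e - s <= (Num.truncn ((e - s) / eps)).+1%:R * eps.
  by rewrite -ler_pdivrMr// ltW// truncnS_gt.
have main := coarse_slack eps0 epsl SS s0 se eN Ss Se.
have h1 : stage_potential S s <= potential lam kap (coarse_mass eps S s).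
  by apply: potential_antitone => // i; exact: coarse_mass_le.
have h2 : potential lam kap (coarse_mass eps S e)
    <= stage_potential S e + 2 * n%:R * mu * eta.
  apply: potential_perturb => // i.
  apply: le_trans (coarse_mass_ge e SS (_ : 0 < eps <= lam i)) _; first by rewrite eps0/=.
  by rewrite lerD2l.
have h3 : (e - s + 2 * n%:R * mu) * eta <= d.
  apply: le_trans epsD; rewrite /D mulrCA ler_wpM2l//.
  rewrite addr_ge0 ?subr_ge0// mulr_ge0 ?mulr_ge0 ?ler0n//; exact: ltW.
rewrite -/eta in main; lra.
Qed.

End LowerBound.

(** * The least possible search time *)

Section OptimalityBound.
Context {R : realType} {n : nat} {lam : 'I_n -> R}.
Context (lam_gt0 : forall j, 0 < lam j).
Local Notation Q := (star lam).
Local Notation BQ := (borel_star lam).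
Local Notation mu := (total_length lam).
Context (h : probability BQ R) (hb : balanced h) (n1 : (1 < n)%N).
Local Notation kap := (mean_density h).
Implicit Types (S : R -> Q) (q : Q) (i j : 'I_n) (t s e : R).

Let mu_gt0 : 0 < mu. Proof. by apply: total_length_gt0 => //; exact: ltnW. Qed.

(** The initial potential, and the mean delay of every tour. *)
Definition optimal_delay : R := kap * (mu ^+ 2 - \sum_i lam i ^+ 2).

(** When almost everything is found, it is at a visit of the root, up to the arc that is
    being visited; and one partly searched arc alone has no potential. *)
Lemma late_root_time S e (eta : R) : lip_search S -> (search_time S h < +oo)%E ->
  0 <= e -> S e = root lam -> 0 < eta ->
  exists a, [/\ e <= a, S a = root lam &
    stage_potential h S a <= 2 * n%:R * mu * eta].
Proof.
move=> SS Tfin e0 Se eta0; have [S0 SL] := SS.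
have T0 : (0 <= search_time S h)%E by apply: integral_ge0 => q _; exact: hit_time_ge0.
have Tn : search_time S h \is a fin_num by rewrite ge0_fin_numE.
pose t := Num.max e (fine (search_time S h) / eta + 1).
have et : e <= t by rewrite le_max lexx.
have t0 : 0 <= t := le_trans e0 et.
have tT : fine (search_time S h) < t * eta.
  rewrite -ltr_pdivrMr//; apply: (lt_le_trans (_ : _ < fine (search_time S h) / eta + 1)).
    by rewrite ltrDl.
  by rewrite le_max lexx orbT.
have U : unfound lam kap (found_mass h S t) <= eta.
  rewrite (unfound_found_mass lam_gt0 hb)//.
  have := markov_unfound h SS t0; rewrite -(fineK Tn) lee_fin => H.
  have tp : 0 < t.
    have : 0 < t * eta by apply: le_lt_trans tT; exact: fine_ge0.
    by rewrite pmulr_lgt0.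
  by rewrite -(ler_pM2l tp) (le_trans H)// ltW.
have [a [a0 at_ Sa aroot]] := last_root_time SS t0.
exists a; split=> //.
  rewrite leNgt; apply/negP => ae; have := aroot e; rewrite ae et Se => /(_ isT).
  by rewrite eqxx.
have other i j : (S t = root lam \/ arc (S t) = Some j) -> i != j ->
    found_mass h S t i <= found_mass h S a i.
  move=> Stj ij; apply: found_mass_sub => // q qi /foundP[u [u0 ut Su]].
  have [ua|au] := leP u a; first by apply/foundP; exists u.
  case: Stj => Stj.
    by have := aroot t; rewrite lexx andbT (lt_le_trans au ut) Stj => /(_ isT); rewrite eqxx.
  suff E : arc (S u) = arc (S t).
    by exfalso; move: ij; apply/negP; rewrite negbK; move: E; rewrite Su qi Stj => -[->].
  apply: no_root_same_arc => //.
  by move=> w /andP[uw wt]; apply: aroot; rewrite wt andbT (lt_le_trans au).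
have close i : kap * lam i - eta <= found_mass h S t i.
  rewrite lerBlDr -lerBlDl; apply: le_trans U; rewrite /unfound (bigD1 i)//= lerDl.
  by apply: sumr_ge0 => k _; rewrite subr_ge0 found_mass_le.
have [j Stj] : exists j, S t = root lam \/ arc (S t) = Some j.
  case aSt : (arc (S t)) => [j|]; first by exists j; right.
  exists (Ordinal n1); left; by apply/eqP; rewrite -arc_root aSt.
apply: (@potential_small _ _ _ _ lam_gt0 _ j); first exact: ltW.
by move=> i ij; apply: le_trans (close i) _; exact: (other i j).
Qed.

Context (fb : forall j (x : R), 0 <= x <= lam j ->
  arc_mass h j x * (x + (mu - lam j)) <= kap * mu * x).

(** Hardly any potential is left at a late visit of the root, so all of it has been paid for
    by delay. *)
Lemma remaining_delay S e : lip_search S -> (search_time S h < +oo)%E ->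
  0 <= e -> S e = root lam ->
  ((capped_delay h S e + stage_potential h S e)%:E <= \int[h]_q delay S q)%E.
Proof.
move=> SS Tfin e0 Se; have [S0 SL] := SS.
apply/lee_addgt0Pr => d d0.
pose C := 2 * n%:R * mu.
have C0 : 0 < C by rewrite /C mulr_gt0// mulr_gt0// ltr0n ltnW.
have [a [ea Sa aP]] := late_root_time SS Tfin e0 Se (divr_gt0 d0 C0).
have a0 := le_trans e0 ea.
have h1 := slack_ge0 lam_gt0 hb n1 fb SS e0 ea Se Sa.
apply: (@le_trans _ _ ((capped_delay h S a)%:E + d%:E)%E).
  rewrite -EFinD lee_fin.
  have {}aP : stage_potential h S a <= d.
    by apply: le_trans aP _; rewrite -/C mulrC divfK// gt_eqF.
  lra.
by apply: leeD => //; exact: capped_delay_le.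
Qed.

Lemma delay_lower_bound S : lip_search S -> (search_time S h < +oo)%E ->
  (optimal_delay%:E <= \int[h]_q delay S q)%E.
Proof.
move=> SS Tfin; have [S0 SL] := SS.
have := remaining_delay SS Tfin (lexx 0) S0.
by rewrite capped_delay0// add0r stage_potential0.
Qed.

Theorem search_time_lower_bound S : lip_search S ->
  ((optimal_delay + mean_radius h)%:E <= search_time S h)%E.
Proof.
move=> SS; have [Tfin|] := ltP (search_time S h) +oo%E; last first.
  by rewrite leye_eq => /eqP ->; rewrite leey.
by rewrite search_timeE// EFinD leeD2r// delay_lower_bound.
Qed.

(** The slack before [s], between [s] and [e], and after [e] is nonnegative each time, and
    adds up to the excess of the search time over the bound. *)
Lemma tight_slack S s e : lip_search S ->
  (search_time S h <= (optimal_delay + mean_radius h)%:E)%E ->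
  0 <= s -> s <= e -> S s = root lam -> S e = root lam ->
  stage_potential h S s - stage_potential h S e = capped_delay h S e - capped_delay h S s.
Proof.
move=> SS Tle s0 se Ss Se; have [S0 SL] := SS.
have Tfin : (search_time S h < +oo)%E by apply: le_lt_trans Tle _; rewrite ltry.
have e0 := le_trans s0 se.
have h1 := slack_ge0 lam_gt0 hb n1 fb SS s0 se Ss Se.
have h0 := slack_ge0 lam_gt0 hb n1 fb SS (lexx 0) s0 S0 Ss.
have := remaining_delay SS Tfin e0 Se.
have {}Tle : (\int[h]_q delay S q <= optimal_delay%:E)%E.
  by move: Tle; rewrite search_timeE// EFinD leeD2rE.
move=> /le_trans/(_ Tle); rewrite lee_fin.
move: h0; rewrite capped_delay0// stage_potential0// -/optimal_delay.
lra.
Qed.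

End OptimalityBound.

(** * Tours of the star *)

Section PathLeaf.
Context {R : realType} {n : nat} {lam : 'I_n -> R}.
Implicit Types (p q r : star lam) (j : 'I_n).

(** Seen from arc [j], a path reaches no further than one of its ends. *)
Lemma path_between_arc p q r j : path_between p q r -> arc r = Some j ->
  (arc p = Some j /\ radius r <= radius p) \/ (arc q = Some j /\ radius r <= radius q).
Proof.
rewrite /path_between /= => e rj.
have /andP[r0 _] := radius_arc rj.
have key w : ~ (arc w = Some j /\ radius r <= radius w) ->
    mdist r w = radius r - signed_radius j w /\ signed_radius j w < radius r.
  rewrite /signed_radius; case: eqVneq => [wj|wj] H.
    have rw : radius w < radius r by rewrite ltNge; apply/negP => ?; apply: H.
    by rewrite mdistE /star_dist rj wj eqxx gtr0_norm ?subr_gt0.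
  rewrite (dist_arcN rj wj) opprK; split=> //.
  by rewrite (le_lt_trans _ r0)// oppr_le0 radius_ge0.
apply: contrapT => /not_orP[/key[dp sp] /key[dq sq]].
move: e; rewrite (mdist_sym p r) dp dq => e.
have : mdist p q <= Num.max `|signed_radius j p - signed_radius j q|
                            (- signed_radius j p - signed_radius j q).
  rewrite /signed_radius le_max; case: eqVneq => pj; case: eqVneq => qj.
  - by rewrite mdistE /star_dist pj qj eqxx lexx.
  - by rewrite (dist_arcN pj qj) opprK ger0_norm ?lexx// addr_ge0 ?radius_ge0.
  - rewrite mdist_sym (dist_arcN qj pj) -opprD normrN addrC ger0_norm ?lexx//.
    by rewrite addr_ge0 ?radius_ge0.
  - by rewrite !opprK dist_le_radiusD orbT.
rewrite le_max -e => /orP[|]; last lra.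
by case: (ger0P (signed_radius j p - signed_radius j q)) => ?; lra.
Qed.

(** At full speed between the ends of a time interval, the triangle inequality leaves no choice
    for the positions in between. *)
Lemma full_speed_normal (S : R -> star lam) (t1 t2 : R) : nonexpanding S -> 0 <= t1 -> t1 < t2 ->
  mdist (S t1) (S t2) = t2 - t1 ->
  forall s, 0 <= s <= t2 - t1 ->
    path_between (S t1) (S t2) (S (t1 + s)) /\ mdist (S t1) (S (t1 + s)) = s.
Proof.
move=> SL t10 t12 d12 s /andP[s0 s12].
have h1 : mdist (S t1) (S (t1 + s)) <= s.
  by have := nonexpanding_le SL t10 (_ : t1 <= t1 + s); rewrite lerDl => /(_ s0); lra.
have h2 : mdist (S (t1 + s)) (S t2) <= t2 - (t1 + s).
  by apply: nonexpanding_le => //; [exact: addr_ge0|lra].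
have h3 := mdist_triangle (S (t1 + s)) (S t1) (S t2).
rewrite /path_between /=; split; [apply/eqP; rewrite eq_le h3 andbT; lra|].
by apply/eqP; rewrite eq_le h1 /=; lra.
Qed.

End PathLeaf.

Section Tours.
Context {R : realType} {n : nat} {lam : 'I_n -> R}.
Context (lam_gt0 : forall j, 0 < lam j).
Local Notation Q := (star lam).
Implicit Types (s : 'S_n) (i j k : 'I_n) (t x y : R).

Let lam_ge0 j : 0 <= lam j. Proof. exact: ltW. Qed.

Lemma tour_start_ge0 s k : 0 <= tour_start (lam := lam) s k.
Proof. by apply: sumr_ge0 => i _; rewrite mulr_ge0. Qed.

Lemma tour_start_lt s i k : (i < k)%N ->
  tour_start (lam := lam) s i + 2 * lam (s i) <= tour_start (lam := lam) s k.
Proof.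
move=> ik; rewrite /tour_start [leRHS](bigID (fun l : 'I_n => (l < i)%N))/=.
apply: lerD.
  rewrite le_eqVlt; apply/orP; left; apply/eqP/eq_bigl => l; case: (ltnP l i) => li; rewrite ?andbF//.
  by rewrite (ltn_trans li ik).
rewrite (bigD1 i) /=; last by rewrite ik ltnn.
by rewrite lerDl; apply: sumr_ge0 => l _; rewrite mulr_ge0.
Qed.

Local Notation start := (@tour_start R n lam).

Definition on_leg s t : pred 'I_n := fun k => start s k <= t < start s k + 2 * lam (s k).

Definition tour s t : Q :=
  if [pick k | on_leg s t k] is Some k
  then pt lam (s k) (lam (s k) - `|t - start s k - lam (s k)|) else root lam.

Lemma on_leg_inj s t i k : on_leg s t i -> on_leg s t k -> i = k.
Proof.
wlog ik : i k / (i <= k)%N.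
  by move=> H hi hk; case: (leqP i k) => [/H->//|/ltnW/H->].
move=> /andP[_ ti] /andP[tk _]; apply: val_inj; apply/eqP; rewrite eqn_leq ik leqNgt.
by apply/negP => /(tour_start_lt s) h; lra.
Qed.

Lemma tour_on_leg s t k : on_leg s t k ->
  tour s t = pt lam (s k) (lam (s k) - `|t - start s k - lam (s k)|).
Proof.
move=> tk; rewrite /tour; case: pickP => [l tl|/(_ k)]; last by rewrite tk.
by rewrite (on_leg_inj tl tk).
Qed.

Lemma tent_bounds (l y : R) : 0 <= y <= 2 * l ->
  [/\ 0 <= l - `|y - l|, l - `|y - l| <= l, l - `|y - l| <= y & l - `|y - l| <= 2 * l - y].
Proof. by move=> /andP[y0 yl]; case: (ger0P (y - l)) => h; split; lra. Qed.

Lemma tourE s k y : 0 <= y <= 2 * lam (s k) ->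
  tour s (start s k + y) = pt lam (s k) (lam (s k) - `|y - lam (s k)|).
Proof.
move=> /andP[y0 yl]; have [yl2|] := ltP y (2 * lam (s k)).
  rewrite (@tour_on_leg _ _ k); last by rewrite /on_leg lerDl y0 ltrD2l.
  by rewrite [start s k + y]addrC addrK.
move=> ly; have -> : y = 2 * lam (s k) by apply/eqP; rewrite eq_le yl.
have -> : 2 * lam (s k) - lam (s k) = lam (s k) by lra.
rewrite ger0_norm// subrr pt0 /tour; case: pickP => // l /andP[l1 l2].
have [lk|kl] := leqP l k.
  have [lk'|kl'] := ltnP l k; first by exfalso; have := tour_start_lt s lk'; have := lam_gt0 (s k); lra.
  have E : l = k by apply: val_inj; apply/eqP; rewrite eqn_leq lk.
  by move: l2; rewrite E ltxx.
have := tour_start_lt s kl => h; have -> : start s k + 2 * lam (s k) = start s l by lra.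
by rewrite subrr sub0r normrN ger0_norm// subrr pt0.
Qed.

Lemma tour_start_tour s k : tour s (start s k) = root lam.
Proof.
have := @tourE s k 0; rewrite addr0 => ->; last by rewrite lexx mulr_ge0.
by rewrite sub0r normrN ger0_norm// subrr pt0.
Qed.

Lemma df_tour_tour s : df_tour s (tour s).
Proof.
move=> k x /andP[x0 xl].
have l0 := lam_ge0 (s k); split.
  rewrite tourE; last by apply/andP; split; lra.
  by congr pt; rewrite ler0_norm; lra.
rewrite -addrA tourE; last by apply/andP; split; lra.
by congr pt; rewrite ger0_norm; lra.
Qed.

Lemma tour_radius s t k : on_leg s t k ->
  radius (tour s t) <= t - start s k /\ radius (tour s t) <= start s k + 2 * lam (s k) - t.
Proof.
move=> tk; rewrite (tour_on_leg tk); move: tk => /andP[t1 t2].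
have [|h1 h2 h3 h4] := @tent_bounds (lam (s k)) (t - start s k).
  by apply/andP; split; lra.
rewrite radius_pt ?h1//; split; lra.
Qed.

Lemma tour_nonexpanding s : nonexpanding (tour s).
Proof.
move=> t1 t2 _ t12.
have [k1 tk1|n1] := pickP (on_leg s t1); have [k2 tk2|n2] := pickP (on_leg s t2); last first.
- have E t : on_leg s t =1 xpred0 -> tour s t = root lam.
    by rewrite /tour; case: pickP => // k tk /(_ k); rewrite tk.
  by rewrite !E// mdist0 subr_ge0 ltW.
- have [h _] := tour_radius tk2.
  rewrite {1}/tour; case: pickP => [k tk|_]; first by have := n1 k; rewrite tk.
  rewrite dist_root; apply: (le_trans h); rewrite lerB//.
  have := n1 k2; rewrite /on_leg; move: tk2 => /andP[a1 a2].
  by rewrite (lt_trans t12 a2) andbT leNgt => /negbFE/ltW.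
- have [_ h] := tour_radius tk1.
  rewrite {2}/tour; case: pickP => [k tk|_]; first by have := n2 k; rewrite tk.
  rewrite mdist_sym dist_root; apply: (le_trans h); rewrite lerB//.
  have := n2 k1; rewrite /on_leg; move: tk1 => /andP[a1 a2].
  by rewrite (ltW (le_lt_trans a1 t12))/= ltNge => /negbFE.
have [kk|kk] := eqVneq k1 k2.
  rewrite -kk in tk2 *; rewrite (tour_on_leg tk1) (tour_on_leg tk2).
  move: tk1 tk2 => /andP[a1 a2] /andP[b1 b2].
  have [|c1 c2 c3 c4] := @tent_bounds (lam (s k1)) (t1 - start s k1).
    by apply/andP; split; lra.
  have [|d1 d2 d3 d4] := @tent_bounds (lam (s k1)) (t2 - start s k1).
    by apply/andP; split; lra.
  rewrite dist_pt ?c1 ?d1//.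
  case: (ger0P (t1 - start s k1 - lam (s k1))) => ?;
    case: (ger0P (t2 - start s k1 - lam (s k1))) => ?;
    by rewrite ler_norml; apply/andP; split; lra.
have [_ r1] := tour_radius tk1; have [r2 _] := tour_radius tk2.
apply: (le_trans (dist_le_radiusD _ _)).
move: tk1 tk2 => /andP[a1 a2] /andP[b1 b2].
have [k12|k21] := ltnP k1 k2; first by have := tour_start_lt s k12; lra.
have k21' : (k2 < k1)%N by rewrite ltn_neqAle k21 andbT eq_sym.
by have := tour_start_lt s k21'; lra.
Qed.

Lemma tour_arc s t k : arc (tour s t) = Some (s k) -> on_leg s t k.
Proof.
rewrite /tour; case: pickP => // l tl /eqP.
rewrite -signed_radius_gt0 /signed_radius; case: eqP => [/[dup] E + _|_]; last first.
  by rewrite oppr_gt0 ltNge radius_ge0.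
have [e|ne] := eqVneq (lam (s l) - `|t - start s l - lam (s l)|) 0; first by rewrite e pt0.
rewrite arc_pt => [[]/perm_inj <-//|].
move: (tl) => /andP[a1 a2].
have [|c1 c2 c3 c4] := @tent_bounds (lam (s l)) (t - start s l).
  by apply/andP; split; lra.
by rewrite c2 andbT lt0r ne.
Qed.

End Tours.

(** * Touring after a preliminary excursion *)

Section Concat.
Context {R : realType} {n : nat} {lam : 'I_n -> R}.
Implicit Types (S : R -> star lam) (u t : R).

Definition concat S u S' t := if t < u then S t else S' (t - u).

Lemma concat_nonexpanding S u S' : 0 <= u ->
  (forall t1 t2, 0 <= t1 -> t1 < t2 -> t2 <= u -> mdist (S t1) (S t2) <= t2 - t1) ->
  nonexpanding S' -> S u = S' 0 -> nonexpanding (concat S u S').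
Proof.
move=> u0 SL SL' Su t1 t2 t10 t12; rewrite /concat.
have [t1u|ut1] := ltP t1 u; have [t2u|ut2] := ltP t2 u.
- by apply: SL => //; exact: ltW.
- have h1 := SL t1 u t10 t1u (lexx u).
  have h2 := nonexpanding_le SL' (lexx 0) (_ : 0 <= t2 - u).
  have {}h2 := h2 (_ : 0 <= t2 - u); have {}h2 : _ := h2 ltac:(lra).
  apply: (le_trans (mdist_triangle (S u) _ _)); rewrite {2}Su; lra.
- lra.
- have -> : t2 - t1 = (t2 - u) - (t1 - u) by lra.
  apply: SL'; lra.
Unshelve. all: lra.
Qed.

Lemma concat_lt S u S' t : t < u -> concat S u S' t = S t.
Proof. by rewrite /concat => ->. Qed.

Lemma concat_ge S u S' t : u <= t -> concat S u S' t = S' (t - u).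
Proof. by rewrite /concat ltNge => ->. Qed.

Lemma concat0 S u S' : 0 <= u -> S u = S' 0 -> concat S u S' 0 = S 0.
Proof.
rewrite le_eqVlt => /predU1P[<- S0|u0 _]; last by rewrite concat_lt.
by rewrite concat_ge// subrr.
Qed.

Lemma found_concat_r S u S' t q : 0 <= u -> found S' t q -> found (concat S u S') (u + t) q.
Proof.
move=> u0 /foundP[w [w0 wt Sw]]; apply/foundP; exists (u + w); split.
- exact: addr_ge0.
- by rewrite lerD2l.
- by rewrite concat_ge ?lerDl// [u + w]addrC addrK.
Qed.

End Concat.

Section Probe.
Context {R : realType} {n : nat} {lam : 'I_n -> R}.
Context (lam_gt0 : forall j, 0 < lam j) (n1 : (1 < n)%N).
Local Notation Q := (star lam).
Local Notation start := (@tour_start R n lam).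
Local Notation on_leg := (@on_leg R n lam).
Implicit Types (s : 'S_n) (i j k : 'I_n) (t x y : R) (q : Q).

Let lam_ge0 j : 0 <= lam j. Proof. exact: ltW. Qed.

Lemma pred_ltn : (n.-1 < n)%N. Proof. by rewrite prednK// ltnW. Qed.

Definition first_leg : 'I_n := Ordinal (ltnW n1).
Definition last_leg : 'I_n := Ordinal pred_ltn.

Lemma le_last_leg k : (k <= last_leg)%N.
Proof. by rewrite -ltnS /= prednK ?ltn_ord// ltnW. Qed.

Lemma first_lt_last : (first_leg < last_leg)%N.
Proof. by rewrite /= -ltnS prednK// ltnW. Qed.

Lemma tour_start_pred s k : (0 < k)%N ->
  exists2 k' : 'I_n, (k' < k)%N & start s k = start s k' + 2 * lam (s k').
Proof.
move=> k0; have k'n : (k.-1 < n)%N by apply: leq_ltn_trans (leq_pred _) (ltn_ord k).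
exists (Ordinal k'n); first by rewrite /= prednK.
rewrite /tour_start (bigD1 (Ordinal k'n)) /=; last by rewrite prednK.
rewrite addrC; congr (_ + _); apply: eq_bigl => l.
by rewrite -val_eqE /= -[X in (_ < X)%N](prednK k0) ltnS [in RHS]ltn_neqAle andbC.
Qed.

(** The competitor of the tours that decides the comparison: the arc toured last is first
    explored to depth [x]. For [x = 0] it is the tour itself. *)
Definition probe s x : R -> Q :=
  concat (fun t => pt lam (s last_leg) (x - `|t - x|)) (2 * x) (tour s).

Section ProbeFacts.
Context (s : 'S_n) (x : R) (x_ge0 : 0 <= x) (x_lt : x < lam (s last_leg)).
Local Notation j := (s last_leg).
Local Notation A := (probe s x).
Local Notation turn k := (2 * x + start s k + lam (s k)).

Let x20 : 0 <= 2 * x. Proof. by rewrite mulr_ge0. Qed.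

Lemma start_first : start s first_leg = 0.
Proof. by rewrite /tour_start big_pred0. Qed.

Lemma tour0 : tour s 0 = root lam.
Proof. by rewrite -{1}start_first; exact: tour_start_tour. Qed.

Lemma probe_out t : 0 <= t <= x -> A t = pt lam j t.
Proof.
move=> /andP[t0 tx]; have [xt|xt] := ltP t (2 * x).
  by rewrite /probe concat_lt//; congr pt; rewrite ler0_norm; lra.
have -> : t = 0 by have := x_ge0; lra.
rewrite /probe concat_ge; last by have := x_ge0; lra.
have -> : 0 - 2 * x = 0 by have := x_ge0; lra.
by rewrite tour0 pt0.
Qed.

Lemma probe_back t : x <= t <= 2 * x -> A t = pt lam j (2 * x - t).
Proof.
move=> /andP[xt tx]; have [xt2|xt2] := ltP t (2 * x).
  by rewrite /probe concat_lt//; congr pt; rewrite ger0_norm; lra.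
have -> : t = 2 * x by lra.
by rewrite /probe concat_ge// !subrr tour0 pt0.
Qed.

Lemma probe_tour t : 2 * x <= t -> A t = tour s (t - 2 * x).
Proof. exact: concat_ge. Qed.

Lemma probe_leg k y : 0 <= y <= 2 * lam (s k) ->
  A (2 * x + start s k + y) = pt lam (s k) (lam (s k) - `|y - lam (s k)|).
Proof.
move=> yl; have /andP[y0 _] := yl; have s0 := tour_start_ge0 lam_gt0 s k.
rewrite probe_tour; last lra.
have -> : 2 * x + start s k + y - 2 * x = start s k + y by lra.
exact: (tourE lam_gt0).
Qed.

Lemma probe_leg_out k y : 0 <= y <= lam (s k) -> A (2 * x + start s k + y) = pt lam (s k) y.
Proof.
move=> /andP[y0 yl]; rewrite probe_leg; last by apply/andP; split; lra.
by congr pt; rewrite ler0_norm; lra.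
Qed.

Lemma probe_leg_back k y : 0 <= y <= lam (s k) ->
  A (2 * x + start s k + 2 * lam (s k) - y) = pt lam (s k) y.
Proof.
move=> /andP[y0 yl]; have l0 := lam_ge0 (s k).
have -> : 2 * x + start s k + 2 * lam (s k) - y = 2 * x + start s k + (2 * lam (s k) - y) by lra.
rewrite probe_leg; last by apply/andP; split; lra.
by congr pt; rewrite ger0_norm; lra.
Qed.

Lemma probe_lip : lip_search A.
Proof.
have x0 := x_ge0; have xl := x_lt.
split; first by rewrite probe_out ?lexx ?pt0.
apply: concat_nonexpanding => //; last 2 first.
- exact: tour_nonexpanding.
- have -> : x - `|2 * x - x| = 0 by rewrite ger0_norm; lra.
  by rewrite pt0 tour0.
move=> t1 t2 t10 t12 t2x.
have [|a1 a2 _ _] := @tent_bounds _ x t1; first by apply/andP; split; lra.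
have [|b1 b2 _ _] := @tent_bounds _ x t2; first by apply/andP; split; lra.
rewrite dist_pt.
- by case: (ger0P (t1 - x)) => ?; case: (ger0P (t2 - x)) => ?;
    rewrite ler_norml; apply/andP; split; lra.
- by rewrite a1 (le_trans a2)// ltW.
- by rewrite b1 (le_trans b2)// ltW.
Qed.

Lemma probe_leaf k u : 0 <= u -> A u = pt lam (s k) (lam (s k)) -> u = turn k.
Proof.
have x0 := x_ge0; have xl := x_lt; have lk := lam_gt0 (s k) => u0.
have aleaf : arc (pt lam (s k) (lam (s k))) = Some (s k) by rewrite arc_pt ?lk/=.
have [ux|xu] := ltP u (2 * x).
  have [|a1 a2 _ _] := @tent_bounds _ x u; first by apply/andP; split; lra.
  rewrite /probe concat_lt// => E; exfalso.
  have := congr1 (@arc R n lam) E; have := congr1 (@radius R n lam) E; rewrite aleaf.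
  rewrite (radius_pt (x := lam _)) ?lexx ?lam_ge0// radius_pt ?a1 ?(le_trans a2) ?ltW//.
  move=> e; have h : 0 < x - `|u - x| by rewrite e.
  rewrite arc_pt ?h ?(le_trans a2) ?ltW// => -[jk]; rewrite -jk in e lk; lra.
rewrite probe_tour// => E.
have tk : on_leg s (u - 2 * x) k by apply: tour_arc; rewrite E.
move: E; rewrite (tour_on_leg lam_gt0 tk) => /(congr1 (@radius R n lam)).
move: tk => /andP[a1 a2].
have [|c1 c2 c3 c4] := @tent_bounds _ (lam (s k)) (u - 2 * x - start s k).
  by apply/andP; split; lra.
rewrite !radius_pt ?lexx ?lam_ge0 ?c1//.
by case: (ger0P (u - 2 * x - start s k - lam (s k))) => ?; lra.
Qed.

Lemma turn_le_last k : turn k <= turn last_leg.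
Proof.
have [kl|lk] := ltnP k last_leg; last first.
  have -> : k = last_leg by apply: val_inj; apply/eqP; rewrite eqn_leq lk le_last_leg.
  exact: lexx.
have := tour_start_lt lam_gt0 s kl; have := lam_ge0 (s k); have := lam_ge0 j; lra.
Qed.

Lemma probe_found q : found A (turn last_leg) q.
Proof.
have s0 k := tour_start_ge0 lam_gt0 s k.
have x0 := x_ge0.
case aq : (arc q) => [i|]; last first.
  move/eqP: aq; rewrite arc_root => /eqP ->; apply: found_root; first exact: probe_lip.
  by have := s0 last_leg; have := lam_ge0 j; lra.
have [k ki] : exists k, s k = i by exists ((s^-1)%g i); rewrite permKV.
have /andP[q0 ql] := radius_arc aq.
apply/foundP; exists (2 * x + start s k + radius q); split.
- by have := s0 k; lra.
- by have := turn_le_last k; rewrite ki in ql *; lra.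
- have H : 0 <= radius q <= lam (s k) by rewrite ki ltW.
  by rewrite probe_leg_out// ki; exact: pt_arc.
Qed.

Lemma probe_relevant t : relevant A t -> t <= turn last_leg.
Proof.
move=> [t0 nc]; rewrite leNgt; apply/negP => lt; apply: nc => q _.
have /foundP[u [u0 ul Au]] := probe_found q.
by exists u => //=; rewrite in_itv /= u0 (le_lt_trans ul).
Qed.

(** Between two consecutive turning points the probe moves straight from one arc through
    the root to another. *)
Lemma probe_straight t1 : x <= t1 -> t1 < turn last_leg ->
  exists k i, [/\ i != s k, t1 < turn k,
    forall t, t1 <= t -> t <= 2 * x + start s k ->
      A t = pt lam i (2 * x + start s k - t) /\ 0 <= 2 * x + start s k - t <= lam i &
    forall t, 2 * x + start s k <= t -> t <= turn k ->
      A t = pt lam (s k) (t - (2 * x + start s k))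
      /\ 0 <= t - (2 * x + start s k) <= lam (s k)].
Proof.
move=> xt1 t1l; have xl := x_lt; have x0 := x_ge0.
pose P := fun m : nat => [exists k : 'I_n, (val k == m) && (t1 < turn k)].
have exP : exists m, P m.
  by exists (val last_leg); apply/existsP; exists last_leg; rewrite eqxx.
have [m /existsP[k /andP[/eqP km t1k]] kmin] := ex_minnP exP.
have after t : 2 * x + start s k <= t -> t <= turn k ->
    A t = pt lam (s k) (t - (2 * x + start s k))
    /\ 0 <= t - (2 * x + start s k) <= lam (s k).
  move=> vt tk; have yl : 0 <= t - (2 * x + start s k) <= lam (s k).
    by apply/andP; split; lra.
  by split=> //; rewrite -(probe_leg_out yl); congr (A _); lra.
have [k0|k0] := posnP (val k).
  have kE : k = first_leg by apply: val_inj.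
  exists k, j; split=> //.
    by rewrite (inj_eq perm_inj) kE eq_sym -val_eqE /= ltn_eqF// first_lt_last.
  move=> t t1t; rewrite kE start_first addr0 => t2x; split; last first.
    by apply/andP; split; lra.
  by apply: probe_back; rewrite t2x andbT; lra.
have [k' k'k startk] := tour_start_pred s k0.
have t1k' : turn k' <= t1.
  rewrite leNgt; apply/negP => h; have : P (val k') by apply/existsP; exists k'; rewrite eqxx.
  by move=> /kmin; rewrite -km leqNgt k'k.
exists k, (s k'); split=> //.
  by rewrite (inj_eq perm_inj) -val_eqE /= ltn_eqF.
move=> t t1t tk; have yl : 0 <= 2 * x + start s k - t <= lam (s k').
  by apply/andP; split; lra.
split=> //; rewrite -(probe_leg_back yl); congr (A _); lra.
Qed.

(** A time interval whose image is the path between its end positions contains no turning point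
    in its interior: the turning points of the tour are leaves, which are inner to no path and
    visited only once, and that of the first excursion is passed again only on the last leg,
    after another leaf has been visited. So the search moves straight in this interval. *)
Lemma probe_normal : normal_search A.
Proof.
have SS := probe_lip; have [S0 SL] := SS; have xl := x_lt; have x0 := x_ge0.
move=> t1 t2 t10 t12 /probe_relevant t2l img.
apply: full_speed_normal => //.
have path t : t1 <= t <= t2 -> path_between (A t1) (A t2) (A t).
  by move=> tt; rewrite -img; exists t.
have noleaf k : ~ (t1 < turn k < t2).
  move=> /andP[h1 h2].
  have Ak : A (turn k) = pt lam (s k) (lam (s k)) by rewrite probe_leg_out// lexx lam_ge0.
  have lk := lam_gt0 (s k).
  have := path (turn k); rewrite Ak (ltW h1) (ltW h2) => /(_ isT) pk.
  have atleaf u : arc (A u) = Some (s k) -> radius (pt lam (s k) (lam (s k))) <= radius (A u) ->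
      0 <= u -> u = turn k.
    move=> au; rewrite radius_pt ?lexx ?lam_ge0// => ru u0; apply: probe_leaf => //.
    rewrite -(pt_arc au); congr pt; apply/eqP; rewrite eq_le ru andbT.
    by have /andP[] := radius_arc au.
  have [|[a1 a2]|[a1 a2]] := path_between_arc pk (j := s k).
  - by rewrite arc_pt ?lk/=.
  - by have := atleaf t1 a1 a2 t10; lra.
  - by have := atleaf t2 a1 a2 ltac:(lra); lra.
have [t1x|xt1] := ltP t1 x.
  have [t2x|xt2] := leP t2 x.
    rewrite !probe_out; [|by apply/andP; split; lra..].
    rewrite dist_pt; [|by apply/andP; split; lra..].
    by rewrite ltr0_norm; lra.
  exfalso.
  have xx : 0 < x by lra.
  have Ax : A x = pt lam j x by rewrite probe_out// x0 lexx.
  have := path x; rewrite Ax (ltW t1x) (ltW xt2) => /(_ isT) px.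
  have [|[a1 a2]|[a1 a2]] := path_between_arc px (j := j).
  - by rewrite arc_pt ?xx ?ltW.
  - have xb : 0 <= t1 <= x by rewrite t10 ltW.
    by move: a2; rewrite probe_out// !radius_pt; try (apply/andP; split); lra.
  have [t2x|t2x] := leP t2 (2 * x).
    have xb : x <= t2 <= 2 * x by rewrite (ltW xt2).
    by move: a2; rewrite probe_back// !radius_pt; try (apply/andP; split); lra.
  have tl : on_leg s (t2 - 2 * x) last_leg.
    by apply: tour_arc; rewrite -probe_tour// ltW.
  move: tl => /andP[tl _].
  have := tour_start_lt lam_gt0 s first_lt_last; have := lam_gt0 (s first_leg).
  have := noleaf first_leg; rewrite start_first; move=> nl l0 h; apply: nl.
  by apply/andP; split; lra.
have t1l : t1 < turn last_leg by lra.
have [k [i [ik t1k before after]]] := probe_straight xt1 t1l.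
have t2k : t2 <= turn k.
  by rewrite leNgt; apply/negP => h; apply: (noleaf k); rewrite t1k.
have [t1v|vt1] := leP t1 (2 * x + start s k); last first.
  have [-> h1] := after t1 (ltW vt1) (ltW t1k).
  have [|-> h2] := after t2 _ t2k; first lra.
  by rewrite dist_pt// ltr0_norm; lra.
have [-> h1] := before t1 (lexx _) t1v.
have [t2v|vt2] := leP t2 (2 * x + start s k).
  have [-> h2] := before t2 (ltW t12) t2v.
  by rewrite dist_pt// gtr0_norm; lra.
have [-> h2] := after t2 (ltW vt2) t2k.
by rewrite dist_pt2//; lra.
Qed.

Lemma probe_search : is_search A.
Proof. by have [S0 SL] := probe_lip; split=> //; exact: probe_normal. Qed.

Lemma probe_hit k q : arc q = Some (s k) ->
  (hit_time A q <= (2 * x + start s k + radius q)%:E)%E.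
Proof.
move=> qk; have /andP[q0 ql] := radius_arc qk; have [S0 SL] := probe_lip.
have s0 := tour_start_ge0 lam_gt0 s k.
apply/hit_time_le => //; first by have := x_ge0; lra.
apply/foundP; exists (2 * x + start s k + radius q); split=> //.
  by have := x_ge0; lra.
by rewrite probe_leg_out ?(ltW q0)//; exact: pt_arc.
Qed.

Lemma probe_hit_early q : arc q = Some j -> radius q <= x ->
  (hit_time A q <= (radius q)%:E)%E.
Proof.
move=> qk qx; have /andP[q0 ql] := radius_arc qk; have [S0 SL] := probe_lip.
apply/hit_time_le => //; first exact: ltW.
apply/foundP; exists (radius q); split=> //; first exact: ltW.
by rewrite probe_out ?(ltW q0)//; exact: pt_arc.
Qed.

End ProbeFacts.
End Probe.

(** * Search times of tours and of probes *)

Section SearchTimes.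
Context {R : realType} {n : nat} {lam : 'I_n -> R}.
Context (lam_gt0 : forall j, 0 < lam j) (n1 : (1 < n)%N).
Local Notation Q := (star lam).
Local Notation BQ := (borel_star lam).
Local Notation mu := (total_length lam).
Local Notation start := (@tour_start R n lam).
Local Notation on_leg := (@on_leg R n lam).
Local Notation last_leg := (last_leg n1).
Local Notation first_leg := (first_leg n1).
Local Notation probe := (@probe R n lam n1).
Implicit Types (s : 'S_n) (i j k : 'I_n) (t x y : R) (q : Q) (S : R -> Q).

Let lam_ge0 j : 0 <= lam j. Proof. exact: ltW. Qed.

Lemma sum_perm s (f : 'I_n -> R) : \sum_k f (s k) = \sum_j f j.
Proof. by rewrite [RHS](reindex_inj (@perm_inj _ s)). Qed.

Lemma sum_tour_start s :
  \sum_k start s k * lam (s k) = mu ^+ 2 - \sum_j lam j ^+ 2.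
Proof.
pose a k := lam (s k).
have E : mu ^+ 2 = \sum_k \sum_i a i * a k.
  rewrite expr2 {1}/total_length -(sum_perm s lam) mulr_suml exchange_big /=.
  apply: eq_bigr => k _; rewrite /total_length -(sum_perm s lam) mulr_sumr.
  by apply: eq_bigr.
have E' : \sum_(k < n) \sum_(i < n | (k < i)%N) a i * a k
        = \sum_(k < n) \sum_(i < n | (i < k)%N) a i * a k.
  rewrite (exchange_big_dep xpredT)//=; apply: eq_bigr => i _.
  by apply: eq_bigr => k _; rewrite mulrC.
have -> : \sum_j lam j ^+ 2 = \sum_k a k * a k.
  by rewrite -(sum_perm s (fun j => lam j ^+ 2)); apply: eq_bigr => k _; rewrite expr2.
have -> : \sum_k start s k * lam (s k) = 2 * \sum_(k < n) \sum_(i < n | (i < k)%N) a i * a k.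
  rewrite mulr_sumr; apply: eq_bigr => k _; rewrite /tour_start mulr_suml mulr_sumr.
  by apply: eq_bigr => i _; rewrite mulrA.
apply/eqP; rewrite eq_sym subr_eq E; apply/eqP.
rewrite mulr_natl mulr2n -{2}E' -!big_split /=; apply: eq_bigr => k _.
rewrite (bigID (fun i : 'I_n => (i < k)%N))/= -addrA; congr (_ + _).
rewrite (bigD1 k) ?ltnn//= addrC; congr (_ + _); apply: eq_bigl => i.
by rewrite -leqNgt ltn_neqAle andbC eq_sym.
Qed.

Lemma start_last s : start s last_leg = 2 * (mu - lam (s last_leg)).
Proof.
have -> : mu - lam (s last_leg) = \sum_(i | i != last_leg) lam (s i).
  by rewrite /total_length -(sum_perm s lam) (bigD1 last_leg)//= addrAC subrr add0r.
rewrite mulr_sumr; apply: eq_bigl => i.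
by rewrite ltn_neqAle le_last_leg andbT.
Qed.

Context (h : probability BQ R) (hb : balanced h).
Local Notation kap := (mean_density h).

Lemma integral_steps (a : 'I_n -> R) (A : 'I_n -> set BQ) :
  (forall k, 0 <= a k) -> (forall k, measurable (A k)) ->
  (\int[h]_q \sum_k ((a k)%:E * (\1_(A k) q)%:E))%E = (\sum_k a k * prob h (A k))%:E.
Proof.
move=> a0 mA; rewrite ge0_integral_sum//.
- by rewrite -sumEFin; apply: eq_bigr => k _; exact: integral_indicM.
- by move=> k; exact: measurable_indicM.
- by move=> k q _; rewrite -EFinM lee_fin mulr_ge0.
Qed.

Lemma steps_ge (a : 'I_n -> R) (A : 'I_n -> set BQ) k q : (forall k, 0 <= a k) -> A k q ->
  ((a k)%:E <= \sum_k ((a k)%:E * (\1_(A k) q)%:E))%E.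
Proof.
move=> a0 Aq; rewrite (bigD1 k)//= indicE mem_set// mule1 leeDl//.
by apply: sume_ge0 => i _; rewrite -EFinM lee_fin mulr_ge0.
Qed.

Lemma measurable_steps (a : 'I_n -> R) (A : 'I_n -> set BQ) :
  (forall k, measurable (A k)) ->
  measurable_fun setT (fun q : BQ => \sum_k ((a k)%:E * (\1_(A k) q)%:E))%E.
Proof.
by move=> mA; apply: emeasurable_sum => k; exact: measurable_indicM.
Qed.

Section ProbeTime.
Context (s : 'S_n) (x : R) (x_ge0 : 0 <= x) (x_lt : x < lam (s last_leg)).
Local Notation j := (s last_leg).

(** Compared with the tour, everything but the first [x] of the last arc is reached [2 * x]
    later, and this part is reached earlier by the duration of all other legs, which is
    [2 * (mu - lam j)]. *)
Lemma probe_search_time :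
  (search_time (probe s x) h <= (optimal_delay h + mean_radius h
     + 2 * (kap * mu * x - arc_mass h j x * (x + (mu - lam j))))%:E)%E.
Proof.
have PL := probe_lip lam_gt0 x_ge0 x_lt; have [S0 SL] := PL.
pose a k := 2 * x + start s k.
have a0 k : 0 <= a k by rewrite addr_ge0 ?mulr_ge0 ?tour_start_ge0.
pose early := [set q : Q | arc q = Some j /\ radius q <= x].
have mearly : measurable (early : set BQ) by exact: measurable_arc_radius.
pose A k : set BQ := if k == last_leg then open_arc j `\` early else open_arc (s k).
have mA k : measurable (A k).
  by rewrite /A; case: ifP => _; [apply: measurableD => //|]; exact: measurable_arc.
have probA k : prob h (A k) = kap * lam (s k) - (k == last_leg)%:R * arc_mass h j x.
  rewrite /A; case: eqP => [->|_]; last by rewrite mul0r subr0 balanced_arc.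
  rewrite mul1r -balanced_arc//.
  have -> : prob h (open_arc j) = prob h (open_arc j `\` early) + arc_mass h j x.
    rewrite -probU//; first last.
    - by apply/seteqP; split=> // q [[_ ne]].
    - by apply: measurableD => //; exact: measurable_arc.
    congr prob; rewrite open_arcE; apply/seteqP; split=> q /=; last by move=> [[]|[]].
    by move=> qj; have [qx|qx] := pselect (early q); [right|left].
  by rewrite addrK.
have sumA : \sum_k a k * prob h (A k) = optimal_delay h
     + 2 * (kap * mu * x - arc_mass h j x * (x + (mu - lam j))).
  under eq_bigr do rewrite probA mulrBr.
  rewrite sumrB [X in _ - X](bigD1 last_leg)//= eqxx mul1r.
  rewrite [X in _ - (_ + X)]big1 ?addr0; last first.
    by move=> k /negbTE ->; rewrite mul0r mulr0.
  have -> : \sum_k a k * (kap * lam (s k)) = 2 * x * kap * mu + optimal_delay h.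
    rewrite /optimal_delay -(sum_tour_start s) mulr_sumr /total_length -(sum_perm s lam).
    by rewrite mulr_sumr -big_split /=; apply: eq_bigr => k _; rewrite /a; ring.
  by rewrite /a start_last; ring.
have -> : optimal_delay h + mean_radius h + 2 * (kap * mu * x - arc_mass h j x * (x + (mu - lam j)))
    = \sum_k a k * prob h (A k) + mean_radius h by rewrite sumA; ring.
rewrite search_timeE// EFinD leeD2r// -integral_steps//.
apply: ge0_le_integral => //.
- by move=> q _; exact: delay_ge0.
- exact: measurable_delay.
- exact: measurable_steps.
move=> q _.
have sum0 : (0 <= \sum_k ((a k)%:E * (\1_(A k) q)%:E))%E.
  by apply: sume_ge0 => k _; rewrite -EFinM lee_fin mulr_ge0.
case aq : (arc q) => [i|]; last first.
  refine (le_trans _ sum0); move/eqP: aq; rewrite arc_root => /eqP ->.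
  rewrite /delay leeBlDr// add0e; apply/hit_time_le => //.
  by apply/foundP; exists 0; split.
have [k ki] : exists k, s k = i by exists ((s^-1)%g i); rewrite permKV.
rewrite -ki in aq.
have [/andP[/eqP kl qx]|nearly] := boolP ((k == last_leg) && (radius q <= x)).
  refine (le_trans _ sum0); rewrite /delay leeBlDr// add0e; apply: probe_hit_early => //.
  by rewrite -kl.
apply: (@le_trans _ _ (a k)%:E).
  by rewrite /delay leeBlDr// -EFinD; exact: probe_hit.
apply: steps_ge => //; rewrite /A; case: eqP => [kl|_]; last by rewrite open_arcE.
rewrite kl in aq nearly; rewrite open_arcE; split=> // -[_ qx].
by move: nearly; rewrite eqxx qx.
Qed.

(** A probe turns back inside an arc when nothing but a part of that arc has been visited. *)
Lemma probe_not_depth_first : 0 < x -> ~ depth_first (lam := lam) (probe s x).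
Proof.
move=> x0 [AS [s' [D [Ddf DA]]]].
have early u : 0 <= u -> u <= lam j -> relevant (probe s x) u.
  move=> u0 ul; split=> // cov.
  have [w /=] := cov (pt lam j (lam j)) Logic.I; rewrite in_itv /= => /andP[w0 wu].
  move=> /(probe_leaf lam_gt0 x_ge0 x_lt w0).
  by have := tour_start_ge0 lam_gt0 s last_leg; lra.
have D1 y : 0 <= y <= lam (s' first_leg) -> D y = pt lam (s' first_leg) y.
  by move=> yl; have [+ _] := Ddf first_leg y yl; rewrite start_first add0r.
have ss : s' first_leg = j.
  pose y := Num.min x (lam (s' first_leg)).
  have y0 : 0 < y by rewrite lt_min x0 lam_gt0.
  have yx : y <= x by rewrite ge_min lexx.
  have yl : y <= lam (s' first_leg) by rewrite ge_min lexx orbT.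
  have yj : y <= lam j by apply: (le_trans yx); exact: ltW.
  have := DA y (early _ (ltW y0) yj).
  rewrite D1 ?(ltW y0)// probe_out ?(ltW y0)// => /(congr1 (@arc R n lam)).
  by rewrite !arc_pt ?y0 ?yj// => -[].
pose d := Num.min x (lam j - x).
have xl := x_lt.
have d0 : 0 < d by rewrite lt_min x0 subr_gt0.
have dx : d <= x by rewrite ge_min lexx.
have dl : d <= lam j - x by rewrite ge_min lexx orbT.
have xd0 : 0 <= x + d by lra.
have xdl : x + d <= lam j by lra.
have := DA (x + d) (early _ xd0 xdl).
rewrite D1; last by rewrite ss; apply/andP; split; lra.
rewrite probe_back//; last by apply/andP; split; lra.
move=> /(congr1 (@radius R n lam)); rewrite ss !radius_pt; [lra|..];
  by apply/andP; split; lra.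
Qed.

End ProbeTime.

Lemma probe0_depth_first s : depth_first (lam := lam) (probe s 0).
Proof.
split; first by apply: probe_search => //; rewrite lexx.
exists s, (tour s); split; first exact: df_tour_tour.
by move=> t [t0 _]; rewrite probe_tour ?mulr0// subr0.
Qed.

Lemma first_hit S t q : nonexpanding S -> found S t q ->
  exists r, [/\ 0 <= r, r <= t, S r = q & forall u, 0 <= u -> S u = q -> r <= u].
Proof.
move=> SL ft; have /foundP[w [w0 wt _]] := ft.
have t0 : 0 <= t := le_trans w0 wt.
have ht : (hit_time S q <= t%:E)%E by apply/hit_time_le.
have fh : hit_time S q \is a fin_num.
  by rewrite ge0_fin_numE ?hit_time_ge0// (le_lt_trans ht)// ltry.
pose r := fine (hit_time S q); have rE : hit_time S q = r%:E by rewrite fineK.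
have r0 : 0 <= r by rewrite fine_ge0// hit_time_ge0.
have /foundP[v [v0 vr Sv]] : found S r q by apply/hit_time_le => //; rewrite rE.
have least u : 0 <= u -> S u = q -> r <= u.
  by move=> u0 Su; rewrite -lee_fin -rE; apply: ereal_inf_lbound; exists u.
exists r; split=> //; first by rewrite -lee_fin -rE.
by have -> : r = v by apply/eqP; rewrite eq_le vr least.
Qed.

Lemma leg_cover s t : 0 <= t -> t < start s last_leg + 2 * lam (s last_leg) ->
  exists k, on_leg s t k.
Proof.
move=> t0 tl.
pose P := fun m : nat => [exists k : 'I_n, (val k == m) && (t < start s k + 2 * lam (s k))].
have exP : exists m, P m.
  by exists (val last_leg); apply/existsP; exists last_leg; rewrite eqxx.
have [m /existsP[k /andP[/eqP km tk]] kmin] := ex_minnP exP.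
exists k; rewrite /on_leg tk andbT.
have [k0|k0] := posnP (val k).
  by have -> : k = first_leg; [apply: val_inj|rewrite start_first].
have [k' k'k ->] := tour_start_pred (lam := lam) s k0.
rewrite leNgt; apply/negP => tk'; have : P (val k') by apply/existsP; exists k'; rewrite eqxx.
by move=> /kmin; rewrite -km leqNgt k'k.
Qed.

Lemma df_tour_unique s (D : R -> Q) t : df_tour s D -> 0 <= t ->
  t < start s last_leg + 2 * lam (s last_leg) -> D t = tour s t.
Proof.
move=> Ddf t0 /(leg_cover t0)[k /andP[kt tk]].
have Tdf : df_tour (lam := lam) s (tour s) by exact: df_tour_tour.
have [yl|ly] := leP (t - start s k) (lam (s k)).
  have hy : 0 <= t - start s k <= lam (s k) by apply/andP; split; lra.
  have [+ _] := Ddf k _ hy; have [+ _] := Tdf k _ hy.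
  by rewrite addrC subrK => -> ->.
have hy : 0 <= start s k + 2 * lam (s k) - t <= lam (s k) by apply/andP; split; lra.
have [_ +] := Ddf k _ hy; have [_ +] := Tdf k _ hy.
by rewrite opprB addrC subrK => -> ->.
Qed.

(** A depth-first search is free once everything has been seen. But the last leaf of its tour
    is missing until the way out on the last leg is completed, and up to then it follows the
    tour, which is never farther from the root than the time since the start of the leg. *)
Lemma depth_first_delay S : depth_first S ->
  exists s, forall k q, arc q = Some (s k) -> ((start s k)%:E <= delay S q)%E.
Proof.
move=> [SS [s [D [Ddf DS]]]]; exists s => k q qk.
have [S0 SL] := is_search_lip SS.
have Dt t : 0 <= t -> t < start s last_leg + lam (s last_leg) -> D t = tour s t.
  by move=> t0 tl; apply: df_tour_unique => //; have := lam_gt0 (s last_leg); lra.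
have rel u : 0 <= u -> u <= start s last_leg + lam (s last_leg) -> relevant S u.
  move=> u0 ul; split=> // cov.
  pose leaf := pt lam (s last_leg) (lam (s last_leg)).
  have leafr : radius leaf = lam (s last_leg) by rewrite radius_pt// lexx lam_ge0.
  have [v /=] := cov leaf Logic.I; rewrite in_itv /= => /andP[v0 vu] Sv.
  have fl : found S v leaf by apply/foundP; exists v.
  have [r [r0 rv Sr least]] := first_hit SL fl.
  have relr : relevant S r.
    split=> // cov'; have [w /=] := cov' leaf Logic.I.
    by rewrite in_itv /= => /andP[w0 wr] /(least _ w0); rewrite leNgt wr.
  have rl : r < start s last_leg + lam (s last_leg) by lra.
  have Tr : tour s r = leaf by rewrite -Dt// -DS.
  have tl : on_leg s r last_leg.
    by apply: tour_arc; rewrite Tr arc_pt// lexx lam_gt0.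
  have [h1 _] := tour_radius lam_gt0 tl; move: h1; rewrite Tr leafr; lra.
rewrite /delay leeBrDr//; apply: le_ereal_inf_tmp => _ [u [u0 Su] <-].
rewrite -EFinD lee_fin leNgt; apply/negP => ul.
have /andP[_ ql] := radius_arc qk.
have kl : start s k + lam (s k) <= start s last_leg + lam (s last_leg).
  by have := turn_le_last lam_gt0 n1 s 0 k; lra.
have ul' : u < start s last_leg + lam (s last_leg) by lra.
have Tu : tour s u = q by rewrite -Dt// -DS//; apply: rel => //; exact: ltW.
have tk : on_leg s u k by apply: tour_arc; rewrite Tu.
by have [h1 _] := tour_radius lam_gt0 tk; move: h1; rewrite Tu; lra.
Qed.

Lemma depth_first_search_time S : depth_first S ->
  ((optimal_delay h + mean_radius h)%:E <= search_time S h)%E.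
Proof.
move=> Sdf; have [SS _] := Sdf; have SP := is_search_lip SS; have [S0 SL] := SP.
have [s sP] := depth_first_delay Sdf.
rewrite search_timeE// EFinD leeD2r//.
have -> : optimal_delay h = \sum_k start s k * prob h (open_arc (s k)).
  rewrite /optimal_delay -(sum_tour_start s) mulr_sumr; apply: eq_bigr => k _.
  by rewrite balanced_arc//; ring.
have s0 k : 0 <= start s k by exact: tour_start_ge0.
rewrite -(@integral_steps _ (fun k => open_arc (s k) : set BQ))//; last first.
  by move=> k; exact: measurable_arc.
apply: ge0_le_integral => //.
- by move=> q _; apply: sume_ge0 => k _; rewrite -EFinM lee_fin mulr_ge0.
- by apply: measurable_steps => k; exact: measurable_arc.
- exact: measurable_delay.
move=> q _; case aq : (arc q) => [i|]; last first.
  rewrite big1 ?delay_ge0// => k _; rewrite indicE memNset ?mule0//.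
  by rewrite open_arcE /= aq.
have [k ki] : exists k, s k = i by exists ((s^-1)%g i); rewrite permKV.
rewrite -ki in aq; rewrite (bigD1 k)//= big1 ?adde0.
  by rewrite indicE mem_set ?mule1 ?sP// open_arcE.
move=> l lk; rewrite indicE memNset ?mule0// open_arcE /= aq => -[/perm_inj kl].
by move: lk; rewrite kl eqxx.
Qed.

End SearchTimes.

(** * Rigidity under strict forward bias *)

Section Rigidity.
Context {R : realType} {n : nat} {lam : 'I_n -> R}.
Context (lam_gt0 : forall j, 0 < lam j) (n1 : (1 < n)%N).
Local Notation Q := (star lam).
Local Notation BQ := (borel_star lam).
Local Notation mu := (total_length lam).
Local Notation start := (@tour_start R n lam).
Local Notation on_leg := (@on_leg R n lam).
Local Notation last_leg := (last_leg n1).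
Local Notation first_leg := (first_leg n1).
Context (h : probability BQ R) (hb : balanced h).
Local Notation kap := (mean_density h).
Implicit Types (i j k : 'I_n) (t x y : R) (q : Q) (S : R -> Q).

Let lam_ge0 j : 0 <= lam j. Proof. exact: ltW. Qed.
Let kap_ge0 : 0 <= kap. Proof. exact: mean_density_ge0. Qed.

Context (fb : forall j x, 0 <= x <= lam j ->
  arc_mass h j x * (x + (mu - lam j)) <= kap * mu * x).
Context (sfb : forall j x, 0 < x < lam j ->
  arc_mass h j x * (x + (mu - lam j)) < kap * mu * x).

Lemma arc_tail_gt0 j x : x < lam j -> arc_mass h j x < kap * lam j.
Proof.
move=> xl; wlog x0 : x xl / 0 < x.
  move=> H; have [x0|x0] := ltP 0 x; first exact: H.
  have l2 : lam j / 2 < lam j by have := lam_gt0 j; lra.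
  have xl2 : x <= lam j / 2 by apply: (le_trans x0); rewrite divr_ge0.
  have h1 : arc_mass h j x <= arc_mass h j (lam j / 2) by exact: arc_mass_le.
  by apply: (le_lt_trans h1); apply: H => //; rewrite divr_gt0.
have m0 := others_gt0 lam_gt0 n1 j.
have xm : 0 < x + (mu - lam j) by rewrite addr_gt0.
have := sfb (_ : 0 < x < lam j); rewrite x0 => /(_ xl) H.
rewrite -(ltr_pM2r xm); apply: (lt_le_trans H).
have : 0 <= kap * ((lam j - x) * (mu - lam j)).
  by apply: mulr_ge0 => //; apply: mulr_ge0; apply: ltW => //; rewrite subr_gt0.
lra.
Qed.

Lemma mean_density_gt0 : 0 < kap.
Proof.
have l0 := lam_gt0 first_leg; rewrite -(pmulr_lgt0 _ l0).
apply: (le_lt_trans _ (arc_tail_gt0 l0)); exact: prob_ge0.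
Qed.

Lemma unfound_gt0 S t i x : lip_search S -> 0 <= t -> x < lam i ->
  (forall q, arc q = Some i -> found S t q -> radius q <= x) ->
  0 < prob h (~` found S t).
Proof.
move=> SS t0 xl H; have [S0 SL] := SS.
rewrite -(unfound_found_mass lam_gt0 hb SS t0) /unfound (bigD1 i)//= ltr_pwDl//.
  rewrite subr_gt0; apply: le_lt_trans (arc_tail_gt0 xl).
  exact: found_mass_le_arc_mass.
by apply: sumr_ge0 => k _; rewrite subr_ge0 found_mass_le.
Qed.

Section TightSearch.
Context (S : R -> Q) (SS : lip_search S).
Context (tight : (search_time S h <= (optimal_delay h + mean_radius h)%:E)%E).

Let SL : nonexpanding S. Proof. by case: SS. Qed.
Let S0 : S 0 = root lam. Proof. by case: SS. Qed.

Let slack s e : 0 <= s -> s <= e -> S s = root lam -> S e = root lam ->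
  (e - s) * prob h (~` found S e) <= stage_potential h S s - stage_potential h S e.
Proof.
move=> s0 se Ss Se; rewrite (tight_slack lam_gt0 hb n1 fb SS tight)//.
exact: capped_delayD.
Qed.

(** There is no slack to pay for an excursion that finds nothing new. By
    [potential_step_strict] there is none either for one that turns inside the arc or takes
    longer than its depth requires. *)
Lemma full_excursion a b : 0 <= a -> excursion S a b -> 0 < prob h (~` found S b) ->
  exists j, [/\ b = a + 2 * lam j, S (a + lam j) = pt lam j (lam j),
    ~ found S a (pt lam j (lam j)) &
    forall q, arc q != Some j -> found S b q -> found S a q].
Proof.
move=> a0 ex U0; have [ab Sa Sb _] := ex; have b0 : 0 <= b by lra.
have [j exj] := excursion_arc SS a0 ex.
have other q : arc q != Some j -> found S b q -> found S a q.
  exact: found_excursion_other.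
have sl := slack a0 (ltW ab) Sa Sb.
set U := prob h _ in U0 sl.
have UE : unfound lam kap (found_mass h S b) = U by exact: unfound_found_mass.
have same_mass i : i != j -> found_mass h S b i = found_mass h S a i.
  move=> ij; apply/eqP; rewrite eq_le; apply/andP; split; last first.
    by apply: found_mass_homo => //; exact: ltW.
  apply: found_mass_sub => // q qi; apply: other.
  by rewrite qi; apply: contra ij => /eqP[->].
have unchanged : (forall q, arc q = Some j -> found S b q -> found S a q) ->
    stage_potential h S a - stage_potential h S b = 0.
  move=> H; apply/eqP; rewrite subr_eq0; apply/eqP; congr potential.
  apply/funext => i; have [->|ij] := eqVneq i j; last by rewrite same_mass.
  apply/eqP; rewrite eq_le; apply/andP; split; last exact: found_mass_sub.
  by apply: found_mass_homo => //; exact: ltW.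
have gP i : 0 <= found_mass h S a i <= kap * lam i.
  by rewrite found_mass_ge0 found_mass_le.
have depth x : 0 < x -> x <= lam j -> (forall t, a < t < b -> radius (S t) <= x) ->
    (b - a) / 2 <= x /\ (x < lam j -> (b - a) / 2 < x).
  move=> x0 xl exx; have hx : 0 <= x <= lam j by rewrite ltW.
  have [/unchanged un|newx] := found_excursion_same SS a0 ex exj exx.
    exfalso; move: sl; rewrite un leNgt => /negP; apply.
    by rewrite mulr_gt0// subr_gt0.
  have fx : found_mass h S b j <= arc_mass h j x by exact: found_mass_le_arc_mass.
  have xm : 0 <= x + (mu - lam j) by have := others_gt0 lam_gt0 n1 j; lra.
  have fxm := ler_wpM2r xm fx.
  split=> [|xlt].
    have : stage_potential h S a - stage_potential h S b <= 2 * (x * U).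
      rewrite -UE; apply: (@potential_step _ _ _ _ lam_gt0 j) => //.
        exact: found_mass_le.
      by apply: (le_trans fxm); exact: fb.
    move=> /(le_trans sl); rewrite mulrA ler_pM2r//; lra.
  have : stage_potential h S a - stage_potential h S b < 2 * (x * U).
    rewrite -UE; apply: (@potential_step_strict _ _ _ _ lam_gt0 j) => //.
    - exact: mean_density_gt0.
    - by rewrite x0.
    - by apply: (le_lt_trans fxm); apply: sfb; rewrite x0.
  move=> /(le_lt_trans sl); rewrite mulrA ltr_pM2r//; lra.
have tau : (b - a) / 2 = lam j.
  have [|tl _] := depth (lam j) (lam_gt0 j) (lexx _).
    by move=> t /exj/radius_arc/andP[].
  apply/eqP; rewrite eq_le tl leNgt /=; apply/negP => tlt.
  have [|//||_ /(_ tlt)] := depth ((b - a) / 2).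
  - by rewrite divr_gt0// subr_gt0.
  - move=> t /andP[at_ tb]; apply: excursion_radius => //.
    by rewrite (ltW at_) ltW.
  - by rewrite ltxx.
have bE : b = a + 2 * lam j by lra.
have l0 := lam_gt0 j.
have mid : a < a + lam j < b by apply/andP; split; lra.
have amid := exj _ mid; have /andP[_ rl] := radius_arc amid.
have r1 : radius (S (a + lam j)) = lam j.
  apply/eqP; rewrite eq_le rl leNgt /=; apply/negP => rlt.
  set r := radius _ in rl rlt; pose d := (lam j - r) / 2.
  have r0 : 0 <= r by exact: radius_ge0.
  have [||t /andP[at_ tb]|] := depth (lam j - d); rewrite /d; [lra|lra| |lra].
  have h1 := radius_le_time SL a0 (ltW at_) Sa.
  have h2 : radius (S t) <= b - t.
    by apply: radius_le_time_to => //; [lra|exact: ltW].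
  have h3 : `|radius (S t) - r| <= `|t - (a + lam j)|.
    have [tm|mt] := leP t (a + lam j).
      have := radius_lip_path SL (_ : 0 <= t) tm.
      by rewrite (ler0_norm (_ : t - _ <= 0)) ?subr_le0// opprB; apply; lra.
    rewrite distrC (gtr0_norm (_ : 0 < t - _)) ?subr_gt0//.
    by apply: radius_lip_path => //; lra.
  have := ler_norm (radius (S t) - r).
  by case: (ger0P (t - (a + lam j))) h3 => ? ? ?; lra.
exists j; split=> //.
  by rewrite -{2}r1; apply/esym; exact: pt_arc.
move=> fl; have := unchanged _.
have un : forall q, arc q = Some j -> found S b q -> found S a q.
  move=> q qj _; rewrite -(pt_arc qj); have /andP[q0 ql] := radius_arc qj.
  by apply: (found_below SS _ _ fl) => //; rewrite (ltW q0).
move: sl; rewrite (unchanged un) leNgt => /negP sl _; apply: sl.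
by rewrite mulr_gt0// subr_gt0.
Qed.

(** Two untouched arcs ensure that mass is still missing after the next excursion, so that
    [full_excursion] applies to it. Waiting at the root first would be slack. An excursion
    takes twice the length of its arc, so the one under way at the time [t0] in the proof, half
    the least arc length after [s], is the first. *)
Lemma next_leg s i1 i2 : 0 <= s -> S s = root lam -> i1 != i2 ->
  (forall q, arc q = Some i1 -> ~ found S s q) ->
  (forall q, arc q = Some i2 -> ~ found S s q) ->
  exists j, [/\ S (s + lam j) = pt lam j (lam j), S (s + 2 * lam j) = root lam,
    ~ found S s (pt lam j (lam j)) &
    forall q, arc q != Some j -> found S (s + 2 * lam j) q -> found S s q].
Proof.
move=> s0 Ss i12 f1 f2.
have [l l0 ll] := exists_min_length lam_gt0.
pose t0 := s + l / 2.
have t00 : 0 <= t0 by rewrite /t0; lra.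
have st0 : s < t0 by rewrite /t0; lra.
have avoid j : exists i, i != j /\ (forall q, arc q = Some i -> ~ found S s q).
  have [e|e] := eqVneq i1 j; last by exists i1.
  by exists i2; split=> //; rewrite -e eq_sym.
have shallow u i q : s <= u -> u <= t0 -> S u = q -> radius q <= l / 2.
  move=> su ut <-; have := radius_le_time SL s0 su Ss; rewrite /t0 in ut; lra.
have l2 i : l / 2 < lam i by have := ll i; lra.
have [e te Se] : exists2 e, t0 <= e & S e = root lam.
  apply: contrapT => noroot.
  have nr e : t0 <= e -> S e != root lam.
    by move=> te; apply/eqP => Se; apply: noroot; exists e.
  case aj : (arc (S t0)) => [j|]; last first.
    by move/eqP: aj; rewrite arc_root (negbTE (nr _ _)).
  have [i [ij fi]] := avoid j.
  have fl t q : t0 <= t -> arc q = Some i -> found S t q -> radius q <= l / 2.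
    move=> tt qi /foundP[u [u0 ut Su]].
    have [us|/ltW su] := leP u s.
      by exfalso; apply: (fi q qi); apply/foundP; exists u.
    have [ut0|/ltW t0u] := leP u t0; first exact: shallow ut0 Su.
    have : arc (S t0) = arc (S u).
      by apply: no_root_same_arc => // w /andP[tw _]; exact: nr.
    by rewrite aj Su qi => -[ji]; move: ij; rewrite ji eqxx.
  have T0 : (0 <= search_time S h)%E by apply: integral_ge0 => q _; exact: hit_time_ge0.
  have Tn : search_time S h \is a fin_num.
    by rewrite ge0_fin_numE// (le_lt_trans tight)// ltry.
  have l2i := arc_tail_gt0 (l2 i); set d := kap * lam i - arc_mass h i (l / 2).
  have d0 : 0 < d by rewrite subr_gt0.
  have Ud t : t0 <= t -> d <= prob h (~` found S t).
    move=> tt; have tt0 := le_trans t00 tt.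
    rewrite -(unfound_found_mass lam_gt0 hb SS tt0) /unfound (bigD1 i)//=.
    have : found_mass h S t i <= arc_mass h i (l / 2).
      by apply: found_mass_le_arc_mass => // q qi; exact: fl.
    have : 0 <= \sum_(k | k != i) (kap * lam k - found_mass h S t k).
      by apply: sumr_ge0 => k _; rewrite subr_ge0 found_mass_le.
    rewrite /d; lra.
  pose t := Num.max t0 (fine (search_time S h) / d + 1).
  have tt : t0 <= t by rewrite le_max lexx.
  have := markov_unfound h SS (le_trans t00 tt).
  rewrite -(fineK Tn) lee_fin leNgt => /negP; apply.
  have tT : fine (search_time S h) < t * d.
    rewrite -ltr_pdivrMr//; apply: (lt_le_trans (_ : _ < fine (search_time S h) / d + 1)).
      by rewrite ltrDl.
    by rewrite le_max lexx orbT.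
  by apply: (lt_le_trans tT); rewrite ler_wpM2l ?Ud// (le_trans t00).
have [a [a0 at_ Sa aroot]] := last_root_time SS t00.
have [b [tb be Sb broot]] := next_root_time SL t00 te Se.
have sa : s <= a.
  rewrite leNgt; apply/negP => as_; have := aroot s; rewrite as_ (ltW st0) Ss => /(_ isT).
  by rewrite eqxx.
have b0 : 0 <= b := le_trans t00 tb.
have ab_ex : a < b -> excursion S a b.
  move=> ab; split=> // t /andP[at1 tb1]; have [tm|/ltW mt] := leP t t0.
    by apply: aroot; rewrite at1.
  by apply: broot; rewrite mt.
have U0 : 0 < prob h (~` found S b).
  have [j exj] : exists j, forall t, a < t < b -> arc (S t) = Some j.
    have [ab|ba] := ltP a b; first exact: (excursion_arc SS a0 (ab_ex ab)).
    by exists i1 => t /andP[h1 h2]; have := lt_trans h1 h2; rewrite ltNge ba.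
  have [i [ij fi]] := avoid j.
  apply: (unfound_gt0 SS b0 (l2 i)) => q qi /foundP[u [u0 ub Su]].
  have [us|/ltW su] := leP u s; first by exfalso; apply: (fi q qi); apply/foundP; exists u.
  have [ua|au] := leP u a; first exact: (shallow u i q su (le_trans ua at_) Su).
  have [ub'|bu] := ltP u b.
    have := exj u; rewrite au ub' Su qi => /(_ isT) -[ji].
    by move: ij; rewrite ji eqxx.
  have ub'' : u = b by apply/eqP; rewrite eq_le ub.
  by move: qi; rewrite -Su ub'' Sb.
have Umono t : t <= b -> 0 < prob h (~` found S t).
  move=> tb'; apply: (lt_le_trans U0); apply: le_prob.
  - by apply: measurableC; exact: measurable_found.
  - by apply: measurableC; exact: measurable_found.
  - by move=> q nf ft; apply: nf; apply: found_le ft.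
have ab0 : a <= b := le_trans at_ tb.
have as_ : a = s.
  apply/eqP; rewrite eq_le sa andbT leNgt; apply/negP => sa'.
  have [|/existsNP[u /not_implyP[/andP[su ua] /eqP Su]]] :=
      pselect (forall u, s <= u <= a -> S u = root lam).
    move=> dwell.
    have := slack s0 sa Ss Sa.
    have -> : stage_potential h S a = stage_potential h S s.
      congr potential; apply/funext => i; apply/eqP; rewrite eq_le.
      apply/andP; split; last exact: found_mass_homo.
      apply: found_mass_sub => //.
      move=> q qi /foundP[u [u0 ua Su]]; have [us|/ltW su] := leP u s.
        by apply/foundP; exists u.
      by move: qi; rewrite -Su dwell ?su.
    rewrite subrr leNgt => /negP; apply; rewrite mulr_gt0 ?Umono//.
    by rewrite subr_gt0.
  have u0 := le_trans s0 su.
  have [a' [a'0 a'u Sa' a'root]] := last_root_time SS u0.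
  have [b' [ub' b'a Sb' b'root]] := next_root_time SL u0 ua Sa.
  have sa'' : s <= a'.
    rewrite leNgt; apply/negP => a's; have := a'root s; rewrite a's su Ss => /(_ isT).
    by rewrite eqxx.
  have a'b' : a' < b'.
    rewrite lt_neqAle (le_trans a'u ub') andbT; apply/eqP => ab'.
    have : u = a' by apply/eqP; rewrite eq_le a'u ab' ub'.
    by move=> ua'; move: Su; rewrite ua' Sa' eqxx.
  have ex : excursion S a' b'.
    split=> // t /andP[at1 tb1]; have [tm|/ltW mt] := leP t u.
      by apply: a'root; rewrite at1.
    by apply: b'root; rewrite mt.
  have [j [bE _ _ _]] := full_excursion a'0 ex (Umono _ (le_trans b'a ab0)).
  have := ll j; rewrite /t0 in at_; lra.
have ab : a < b by rewrite as_; exact: lt_le_trans st0 tb.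
have [j [bE Sj nf oth]] := full_excursion a0 (ab_ex ab) U0.
by rewrite as_ in bE Sj nf oth; exists j; rewrite -bE.
Qed.

Definition legs_start (l : seq 'I_n) (m : nat) : R :=
  \sum_(i < m) 2 * lam (nth first_leg l i).

Definition toured (l : seq 'I_n) := [/\ uniq l,
  forall m, (m <= size l)%N -> S (legs_start l m) = root lam,
  forall m, (m < size l)%N ->
    S (legs_start l m + lam (nth first_leg l m))
      = pt lam (nth first_leg l m) (lam (nth first_leg l m)) &
  forall q i, arc q = Some i -> found S (legs_start l (size l)) q -> i \in l].

Lemma legs_start_ge0 l m : 0 <= legs_start l m.
Proof. by apply: sumr_ge0 => i _; rewrite mulr_ge0. Qed.

Lemma legs_startS l m : legs_start l m.+1 = legs_start l m + 2 * lam (nth first_leg l m).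
Proof. by rewrite /legs_start big_ord_recr. Qed.

Lemma legs_start_rcons l j m : (m <= size l)%N -> legs_start (rcons l j) m = legs_start l m.
Proof.
move=> ml; apply: eq_bigr => i _; congr (_ * lam _).
by rewrite nth_rcons (leq_trans (ltn_ord i) ml).
Qed.

Lemma legs_start_le l m m' : (m <= m')%N -> legs_start l m <= legs_start l m'.
Proof.
move=> /subnK <-; elim: (m' - m)%N => [|d IH]; first by rewrite add0n.
by rewrite addSn legs_startS; apply: (le_trans IH); rewrite lerDl mulr_ge0.
Qed.

Lemma toured_leaf l j : toured l -> j \in l ->
  found S (legs_start l (size l)) (pt lam j (lam j)).
Proof.
move=> [_ _ Tl _] jl; have ml : (index j l < size l)%N by rewrite index_mem.
have := Tl _ ml; rewrite nth_index// => Sj.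
apply/foundP; exists (legs_start l (index j l) + lam j); split=> //.
  by rewrite addr_ge0 ?legs_start_ge0.
apply: le_trans (legs_start_le l ml); rewrite legs_startS nth_index// lerD2l.
by have := lam_ge0 j; lra.
Qed.

Lemma toured_rcons l j : toured l -> j \notin l ->
  S (legs_start l (size l) + lam j) = pt lam j (lam j) ->
  S (legs_start l (size l) + 2 * lam j) = root lam ->
  (forall q, arc q != Some j -> found S (legs_start l (size l) + 2 * lam j) q ->
     found S (legs_start l (size l)) q) ->
  toured (rcons l j).
Proof.
move=> [ul Tr Tl Tf] jl Sj Sr oth.
have E : legs_start (rcons l j) (size l).+1 = legs_start l (size l) + 2 * lam j.
  by rewrite legs_startS legs_start_rcons// nth_rcons ltnn eqxx.
split.
- by rewrite rcons_uniq jl.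
- move=> m; rewrite size_rcons leq_eqVlt => /predU1P[->|]; first by rewrite E.
  by rewrite ltnS => ml; rewrite legs_start_rcons// Tr.
- move=> m; rewrite size_rcons ltnS leq_eqVlt => /predU1P[->|ml].
    by rewrite legs_start_rcons// nth_rcons ltnn eqxx.
  by rewrite legs_start_rcons ?(ltnW ml)// nth_rcons ml Tl.
- move=> q i qi; rewrite size_rcons E mem_rcons inE => fq.
  have [->|ij] := eqVneq i j; first by [].
  rewrite /=; apply: (Tf q i qi); apply: oth => //.
  by rewrite qi; apply: contra ij => /eqP[->].
Qed.

Lemma toured_exists m : (m < n)%N -> exists2 l, toured l & size l = m.
Proof.
elim: m => [_|m IH mn].
  exists [::] => //; split=> //.
    by move=> m; rewrite leqn0 => /eqP ->; rewrite /legs_start big_ord0.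
  move=> q i qi /=; rewrite /legs_start big_ord0 => /foundP[u [u0 ule Su]].
  by move: qi; rewrite -Su (_ : u = 0) ?S0//; apply/eqP; rewrite eq_le ule.
have [l Tl sl] := IH (ltnW mn); have [ul Tr Tlf Tf] := Tl.
have : (1 < #|[predC l]|)%N.
  have := cardC (mem l); rewrite card_ord (card_uniqP ul) sl => E.
  by rewrite -(ltn_add2l m) E addn1.
move=> /card_gt1P[i1 [i2 [i1l i2l i12]]].
have nof i : i \in [predC l] -> forall q, arc q = Some i -> ~ found S (legs_start l (size l)) q.
  by move=> il q qi /(Tf q i qi); move: il; rewrite inE /= => /negbTE ->.
have [j [Sj Sr nf oth]] := next_leg (legs_start_ge0 l (size l)) (Tr _ (leqnn _)) i12
  (nof _ i1l) (nof _ i2l).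
exists (rcons l j); last by rewrite size_rcons sl.
apply: toured_rcons => //; apply/negP => jl; apply: nf; exact: toured_leaf.
Qed.

(** The potential is exhausted when only one arc is left, so the delay accumulated so far is
    already all that the bound allows; the mass beyond any point of the last arc would be
    delayed further if that point were reached late. *)
Lemma last_leg_straight l j : toured l -> j \notin l -> (forall i, i != j -> i \in l) ->
  forall y, 0 <= y <= lam j -> S (legs_start l (size l) + y) = pt lam j y.
Proof.
move=> Tl jl all_l; have [ul Tr Tlf Tf] := Tl.
set s := legs_start l (size l); have s0 : 0 <= s by exact: legs_start_ge0.
have Ss : S s = root lam by exact: Tr.
have pot0 : stage_potential h S s = 0.
  apply/eqP; rewrite eq_le stage_potential_ge0// andbT.
  have := @potential_small _ _ _ kap lam_gt0 (found_mass h S s) j 0 (lexx _).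
  rewrite mulr0; apply=> i ij; rewrite subr0 -balanced_arc//.
  apply: le_prob; [exact: measurable_arc|exact: measurable_found_arc|].
  move=> q; rewrite open_arcE /= => qi; split=> //; rewrite -(pt_arc qi).
  have /andP[q0 ql] := radius_arc qi.
  by apply: (found_below SS _ _ (toured_leaf Tl (all_l i ij))) => //; rewrite (ltW q0).
have Bs : capped_delay h S s = optimal_delay h.
  have := tight_slack lam_gt0 hb n1 fb SS tight (lexx 0) s0 S0 Ss.
  by rewrite pot0 capped_delay0// stage_potential0// !subr0.
have nfj q : arc q = Some j -> ~ found S s q.
  by move=> qj /(Tf q j qj); rewrite (negbTE jl).
have inner x : 0 < x -> x < lam j -> S (s + x) = pt lam j x.
  move=> x0 xl; have sx0 : 0 <= s + x by lra.
  have ptx : arc (pt lam j x) = Some j by rewrite arc_pt// x0 ltW.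
  have [/foundP[v [v0 vs Sv]]|nf] := pselect (found S (s + x) (pt lam j x)).
    have [vs'|/ltW sv] := leP v s.
      by exfalso; apply: (nfj _ ptx); apply/foundP; exists v.
    have := radius_le_time SL s0 sv Ss; rewrite Sv radius_pt ?(ltW x0) ?(ltW xl)// => vx.
    by have -> : s + x = v by lra.
  exfalso; pose d := mdist (S (s + x)) (pt lam j x).
  have d0 : 0 < d.
    rewrite mdist_gt0; apply/eqP => Sx; apply: nf; apply/foundP.
    by exists (s + x); split.
  have late v : 0 <= v -> S v = pt lam j x -> s + x + d <= v.
    move=> v0 Sv; have [vs|sv] := leP v (s + x).
      by exfalso; apply: nf; apply/foundP; exists v.
    by have := SL sx0 sv; rewrite Sv -/d; lra.
  pose E := open_arc j `\` [set q : Q | arc q = Some j /\ radius q <= x].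
  have mE : measurable (E : set BQ).
    by apply: measurableD; [exact: measurable_arc|exact: measurable_arc_radius].
  have Ed q : E q -> ((s + d)%:E <= delay S q)%E.
    rewrite /E open_arcE => -[/= qj nq].
    have xq : x < radius q by rewrite ltNge; apply/negP => qx; apply: nq.
    have /andP[q0 ql] := radius_arc qj.
    rewrite /delay leeBrDr//; apply: le_ereal_inf_tmp => _ [u [u0 Su] <-].
    have /foundP[v [v0 vu Sv]] : found S u (pt lam j x).
      apply: (@found_below _ _ _ _ _ _ (radius q)) => //.
        by rewrite (ltW x0) ltW.
      by rewrite pt_arc//; apply/foundP; exists u.
    rewrite -EFinD lee_fin; have := late v v0 Sv.
    have := radius_lip_path SL v0 vu; rewrite Su Sv radius_pt ?(ltW x0) ?(ltW xl)//.
    by rewrite ler_norml => /andP[]; lra.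
  have PE : 0 < prob h E.
    have : prob h (open_arc j) <= prob h E + arc_mass h j x.
      rewrite -probU//; first last.
      - by apply/seteqP; split=> // q [[_ ne]].
      - exact: measurable_arc_radius.
      apply: le_prob.
      - exact: measurable_arc.
      - by apply: measurableU => //; exact: measurable_arc_radius.
      move=> q qj; have [qx|qx] := pselect (arc q = Some j /\ radius q <= x).
        by right.
      by left.
    rewrite balanced_arc//; have := arc_tail_gt0 xl; lra.
  have : ((capped_delay h S s)%:E + (d * prob h E)%:E <= \int[h]_q delay S q)%E.
    rewrite -(capped_delayE h SS s0) -integral_indicM ?(ltW d0)// -ge0_integralD//.
    - apply: ge0_le_integral => //.
      + move=> q _; rewrite adde_ge0 ?capped_ge0// -EFinM lee_fin mulr_ge0 ?(ltW d0)//.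
      + by apply: emeasurable_funD; [exact: measurable_capped|exact: measurable_indicM].
      + exact: measurable_delay.
      move=> q _; rewrite indicE; case: (asboolP (E q)) => [Eq|nE].
        rewrite mem_set// mule1; apply: le_trans (Ed q Eq); rewrite EFinD leeD2r//.
        by rewrite ge_min lexx orbT.
      by rewrite memNset// mule0 adde0 ge_min lexx.
    - by move=> q _; exact: capped_ge0.
    - exact: measurable_capped.
    - by move=> q _; rewrite -EFinM lee_fin mulr_ge0 ?(ltW d0).
    - exact: measurable_indicM.
  have Tle : (\int[h]_q delay S q <= (optimal_delay h)%:E)%E.
    by move: tight; rewrite search_timeE// EFinD leeD2rE.
  move=> /le_trans/(_ Tle); rewrite Bs -EFinD lee_fin.
  have : 0 < d * prob h E by rewrite mulr_gt0.
  lra.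
move=> y /andP[y0 yl].
have [->|yn0] := eqVneq y 0; first by rewrite addr0 pt0.
have {yn0}y_gt0 : 0 < y by rewrite lt0r yn0.
have [yl'|ly] := ltP y (lam j); first exact: inner.
have -> : y = lam j by apply/eqP; rewrite eq_le yl.
apply/eqP; rewrite -[_ == _]negbK -mdist_gt0 -leNgt; apply/ler_addgt0Pl => e e0.
have l0 := lam_gt0 j; pose x := Num.max (lam j / 2) (lam j - e / 2).
have xl : x < lam j by rewrite gt_max; apply/andP; split; lra.
have x0 : 0 < x by rewrite lt_max; apply/orP; left; lra.
have xe : lam j - e / 2 <= x by rewrite le_max lexx orbT.
have h1 : mdist (S (s + x)) (S (s + lam j)) <= lam j - x.
  have sx : 0 <= s + x by lra.
  have xs : s + x <= s + lam j by lra.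
  by have := nonexpanding_le SL sx xs; lra.
have h2 : mdist (pt lam j x) (pt lam j (lam j)) = lam j - x.
  rewrite dist_pt ?lexx ?lam_ge0 ?(ltW x0) ?(ltW xl)//.
  by rewrite ltr0_norm ?subr_lt0// opprB.
rewrite inner// in h1; rewrite addr0.
have := mdist_triangle (pt lam j x) (S (s + lam j)) (pt lam j (lam j)).
rewrite h2 (mdist_sym (S (s + lam j)) (pt lam j x)); lra.
Qed.

(** At leaves and at visits of the root the search agrees with a tour, and at unit speed it has
    no choice in between. *)
Theorem tight_tour : exists s : 'S_n, forall t, 0 <= t ->
  t <= start s last_leg + lam (s last_leg) -> S t = tour s t.
Proof.
have [l Tl sl] := toured_exists (pred_ltn n1).
have [ul Tr Tlf Tf] := Tl.
have [j jl] : exists j, j \notin l.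
  apply: contrapT => /forallNP H; have : (size (enum 'I_n) <= size l)%N.
    apply: uniq_leq_size; first exact: enum_uniq.
    by move=> i _; apply: contrapT => /negP; exact: H.
  by rewrite size_enum_ord sl leqNgt pred_ltn.
have usz : size (rcons l j) = n by rewrite size_rcons sl prednK// ltnW.
have ur : uniq (rcons l j) by rewrite rcons_uniq jl.
have all_l i : i != j -> i \in l.
  move=> ij; have : i \in rcons l j.
    have [//|nin] := boolP (i \in rcons l j).
    have ui : uniq (i :: rcons l j) by rewrite /= nin.
    by have := max_card (mem (i :: rcons l j)); rewrite (card_uniqP ui) /= usz card_ord ltnn.
  by rewrite mem_rcons inE (negbTE ij).
have straight := last_leg_straight Tl jl all_l.
have f_inj : injective (fun k : 'I_n => nth first_leg (rcons l j) k).
  by move=> k k' /eqP; rewrite nth_uniq ?usz// => /eqP; exact: val_inj.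
pose s := perm f_inj.
have sE k : s k = nth first_leg (rcons l j) k by rewrite permE.
have startE k : start s k = legs_start l k.
  have kl : (k <= size l)%N by rewrite sl; have := le_last_leg n1 k.
  rewrite -(legs_start_rcons j kl) /tour_start /legs_start.
  rewrite (big_ord_widen n (fun m => 2 * lam (nth first_leg (rcons l j) m))) 1?ltnW//.
  by apply: eq_bigr => i _; rewrite sE.
have s_last : s last_leg = j by rewrite sE nth_rcons sl /= ltnn eqxx.
exists s => t t0 tl.
have tl2 : t < start s last_leg + 2 * lam (s last_leg).
  by have := lam_gt0 (s last_leg); lra.
have [k /andP[kt tk]] : exists k, on_leg s t k by exact: leg_cover tl2.
have Tdf : df_tour (lam := lam) s (tour s) by exact: df_tour_tour.
have [kl|lk] := ltnP k last_leg; last first.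
  have kE : k = last_leg by apply: val_inj; apply/eqP; rewrite eqn_leq lk le_last_leg.
  rewrite kE in kt tk; have hy : 0 <= t - start s last_leg <= lam (s last_leg).
    by apply/andP; split; lra.
  have [+ _] := Tdf last_leg _ hy; rewrite addrC subrK => ->.
  rewrite s_last in hy *; rewrite -straight//.
  by congr (S _); rewrite startE sl /=; lra.
have kl' : (k < size l)%N by rewrite sl.
have skl : s k = nth first_leg l k by rewrite sE nth_rcons kl'.
have leaf : S (start s k + lam (s k)) = pt lam (s k) (lam (s k)).
  by rewrite startE skl Tlf.
have rootk : S (start s k) = root lam by rewrite startE Tr// ltnW.
have rootk' : S (start s k + 2 * lam (s k)) = root lam.
  by rewrite startE skl -legs_startS Tr.
have st0 := tour_start_ge0 lam_gt0 s k.
have [yl|ly] := leP (t - start s k) (lam (s k)).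
  have hy : 0 <= t - start s k <= lam (s k) by apply/andP; split; lra.
  have [+ _] := Tdf k _ hy.
  have := straight_out SL st0 rootk hy (lexx _) leaf.
  by rewrite [start s k + _]addrC subrK => -> ->.
have hy : 0 <= start s k + 2 * lam (s k) - t <= lam (s k) by apply/andP; split; lra.
have [_ +] := Tdf k _ hy.
have lk0 := lam_ge0 (s k).
have := @straight_back _ _ _ S (start s k + 2 * lam (s k)) (s k) (lam (s k))
  (start s k + 2 * lam (s k) - t) SL _ rootk' hy (lexx _) _.
have -> : start s k + 2 * lam (s k) - (start s k + 2 * lam (s k) - t) = t by lra.
move=> Sback ->; apply: Sback; first lra.
by rewrite -leaf; congr (S _); lra.
Qed.

End TightSearch.
End Rigidity.

(** * Geodesics and limits of searches *)

Section Geodesics.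
Context {R : realType} {n : nat} {lam : 'I_n -> R}.
Context (lam_gt0 : forall j, 0 < lam j) (n1 : (1 < n)%N).
Local Notation Q := (star lam).
Implicit Types (i j k : 'I_n) (u v w t : R) (p q z : Q).

Let lam_ge0 j : 0 <= lam j. Proof. exact: ltW. Qed.

(** Two arcs together form an interval in which the root is the origin. *)
Definition line i k u : Q := if u <= 0 then pt lam i (- u) else pt lam k u.

Lemma line_dist i k u v : i != k -> - lam i <= u <= lam k -> - lam i <= v <= lam k ->
  mdist (line i k u) (line i k v) = `|u - v|.
Proof.
move=> ik /andP[u1 u2] /andP[v1 v2]; rewrite /line.
case: (leP u 0) => hu; case: (leP v 0) => hv.
- have hu' : 0 <= - u <= lam i by apply/andP; split; lra.
  have hv' : 0 <= - v <= lam i by apply/andP; split; lra.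
  by rewrite dist_pt// -opprD normrN.
- have hu' : 0 <= - u <= lam i by apply/andP; split; lra.
  have hv' : 0 <= v <= lam k by apply/andP; split; lra.
  by rewrite dist_pt2// ltr0_norm; lra.
- have hu' : 0 <= u <= lam k by apply/andP; split; lra.
  have hv' : 0 <= - v <= lam i by apply/andP; split; lra.
  by rewrite mdist_sym dist_pt2// gtr0_norm; lra.
- have hu' : 0 <= u <= lam k by apply/andP; split; lra.
  have hv' : 0 <= v <= lam k by apply/andP; split; lra.
  by rewrite dist_pt.
Qed.

Lemma line_swap i k u : line i k u = line k i (- u).
Proof.
rewrite /line opprK oppr_le0; case: (ltrgtP u 0) => // ->.
by rewrite oppr0 !pt0.
Qed.

Lemma line_arc i k u j : arc (line i k u) = Some j -> - lam i <= u <= lam k ->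
  (j = i /\ u < 0) \/ (j = k /\ 0 < u).
Proof.
rewrite /line => + /andP[u1 u2]; case: (leP u 0) => hu; last first.
  by rewrite arc_pt ?hu// => -[<-]; right.
have [->|u0] := eqVneq u 0; first by rewrite oppr0 pt0.
have u_lt0 : u < 0 by rewrite lt_neqAle u0.
have hu' : 0 < - u <= lam i by apply/andP; split; lra.
by rewrite arc_pt// => -[<-]; left.
Qed.

Lemma other_arc k : exists i, i != k.
Proof.
have [k0|k0] := eqVneq k (first_leg n1); last by exists (first_leg n1); rewrite eq_sym.
exists (last_leg n1); rewrite k0 -val_eqE /= gt_eqF//; exact: first_lt_last.
Qed.

Lemma common_line p q : exists i k u v, [/\ i != k, - lam i <= u, u <= v, v <= lam k &
  p = line i k u /\ q = line i k v].
Proof.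
suff [i [k [u [v [ik /andP[u1 u2] /andP[v1 v2] [pu qv]]]]]] : exists i k u v,
    [/\ i != k, - lam i <= u <= lam k, - lam i <= v <= lam k &
     p = line i k u /\ q = line i k v].
  have [uv|vu] := leP u v; first by exists i, k, u, v.
  exists k, i, (- u), (- v); split.
  - by rewrite eq_sym.
  - by rewrite lerN2.
  - by rewrite lerN2 ltW.
  - by rewrite lerNl.
  - by rewrite -!line_swap.
have on r i k : arc r = Some k -> r = line i k (radius r) /\ - lam i <= radius r <= lam k.
  move=> rk; have /andP[r0 rl] := radius_arc rk.
  rewrite /line leNgt r0 /= pt_arc//; split=> //; rewrite rl andbT.
  by apply: le_trans (ltW r0); rewrite oppr_le0.
have onN r i k : arc r = Some i -> r = line i k (- radius r) /\ - lam i <= - radius r <= lam k.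
  move=> ri; have /andP[r0 rl] := radius_arc ri.
  rewrite /line oppr_le0 (ltW r0) opprK pt_arc//; split=> //; rewrite lerN2 rl /=.
  by apply: (@le_trans _ _ 0); rewrite ?oppr_le0 ?(ltW r0).
have on0 r i k : arc r = None -> r = line i k 0 /\ - lam i <= 0 <= lam k.
  by move/eqP; rewrite arc_root => /eqP ->; rewrite /line lexx oppr0 pt0 oppr_le0 !lam_ge0.
case ap : (arc p) => [a|]; case aq : (arc q) => [b|].
- have [ab|ab] := eqVneq a b.
    have [i ib] := other_arc b; rewrite ab in ap.
    have [p1 p2] := on p i b ap; have [q1 q2] := on q i b aq.
    by exists i, b, (radius p), (radius q).
  have [p1 p2] := onN p a b ap; have [q1 q2] := on q a b aq.
  by exists a, b, (- radius p), (radius q).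
- have [i ia] := other_arc a.
  have [p1 p2] := on p i a ap; have [q1 q2] := on0 q i a aq.
  by exists i, a, (radius p), 0.
- have [i ib] := other_arc b.
  have [p1 p2] := on0 p i b ap; have [q1 q2] := on q i b aq.
  by exists i, b, 0, (radius q).
- have [i ib] := other_arc (first_leg n1).
  have [p1 p2] := on0 p i (first_leg n1) ap; have [q1 q2] := on0 q i (first_leg n1) aq.
  by exists i, (first_leg n1), 0, 0.
Qed.

Lemma geodesic p q : exists g : R -> Q, [/\ nonexpanding g, g 0 = p, g (mdist p q) = q &
  forall z, path_between p q z -> g (mdist p z) = z].
Proof.
have [i [k [u [v [ik u1 uv v2 [pE qE]]]]]] := common_line p q.
have hu : - lam i <= u <= lam k by rewrite u1 (le_trans uv).
have hv : - lam i <= v <= lam k by rewrite v2 (le_trans u1).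
have dpq : mdist p q = v - u by rewrite pE qE line_dist// ler0_norm ?subr_le0// opprB.
exists (fun t => line i k (u + Num.min t (v - u))).
have rng t : 0 <= t -> - lam i <= u + Num.min t (v - u) <= lam k.
  by move=> t0; case: (leP t (v - u)) => ?; apply/andP; split; lra.
split.
- move=> t1 t2 t10 t12; rewrite line_dist ?rng//; last lra.
  by case: (leP t1 (v - u)) => ?; case: (leP t2 (v - u)) => ?;
    rewrite ler_norml; apply/andP; split; lra.
- by rewrite min_l ?subr_ge0// addr0.
- by rewrite dpq minxx addrC subrK.
move=> z pz.
have [w [hw zE]] : exists w, - lam i <= w <= lam k /\ z = line i k w.
  case az : (arc z) => [j|]; last first.
    exists 0; rewrite oppr_le0 !lam_ge0; split=> //.
    by move/eqP: az; rewrite arc_root => /eqP ->; rewrite /line lexx oppr0 pt0.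
  have /andP[z0 zl] := radius_arc az.
  suff [ji|jk] : j = i \/ j = k.
  - exists (- radius z); rewrite -ji lerN2 zl /line oppr_le0 (ltW z0) opprK pt_arc//.
    by split=> //; apply: (@le_trans _ _ 0); rewrite ?oppr_le0 ?(ltW z0).
  - exists (radius z); rewrite -jk zl andbT /line [radius z <= 0]leNgt z0 /= pt_arc//; split=> //.
    by apply: (@le_trans _ _ 0); rewrite ?oppr_le0 ?(ltW z0).
  have [[a _]|[a _]] := path_between_arc pz az.
    by move: a; rewrite pE => /line_arc/(_ hu)[[-> _]|[-> _]]; [left|right].
  by move: a; rewrite qE => /line_arc/(_ hv)[[-> _]|[-> _]]; [left|right].
move: pz; rewrite /path_between /= dpq zE pE qE !line_dist// => e.
have [uw wv] : u <= w /\ w <= v.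
  by move: e; case: (ger0P (u - w)) => h1; case: (ger0P (w - v)) => h2 e; split; lra.
rewrite (ler0_norm (_ : u - w <= 0)) ?subr_le0// min_l; last lra.
by congr (line i k); lra.
Qed.

End Geodesics.

Section Compactness.
Context {R : realType} {n : nat} {lam : 'I_n -> R}.
Context (lam_gt0 : forall j, 0 < lam j) (n1 : (1 < n)%N).
Local Notation Q := (star lam).
Local Notation BQ := (borel_star lam).
Implicit Types (j : 'I_n) (t e : R) (q : Q) (S : R -> Q).

Let lam_ge0 j : 0 <= lam j. Proof. exact: ltW. Qed.

Lemma compact_star : compact [set: Q].
Proof.
pose ray j t : Q := pt lam j (Num.min t (lam j)).
have rayL j : nonexpanding (ray j).
  move=> t1 t2 t10 t12; have lj := lam_gt0 j; rewrite /ray dist_pt.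
  - by case: (leP t1 (lam j)) => ?; case: (leP t2 (lam j)) => ?;
      rewrite ler_norml; apply/andP; split; lra.
  - by rewrite le_min t10 lam_ge0 ge_min lexx orbT.
  - by rewrite le_min (le_trans t10 (ltW t12)) lam_ge0 ge_min lexx orbT.
have -> : [set: Q] = \big[setU/set0]_(j < n) ((fun t => ray j (Num.max 0 t)) @` `[0, lam j]).
  apply/seteqP; split=> q // _.
  have [j qj] : exists j, arc q = Some j \/ q = root lam.
    case aq : (arc q) => [j|]; first by exists j; left.
    by exists (first_leg n1); right; apply/eqP; rewrite -arc_root aq.
  rewrite (bigD1 j)//=; left; case: qj => [qj|->].
    have /andP[q0 ql] := radius_arc qj; exists (radius q).
      by rewrite /= in_itv /= ql ltW.
    by rewrite /ray max_r ?(ltW q0)// min_l// pt_arc.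
  by exists 0; rewrite /= ?in_itv /= ?lexx ?lam_ge0// /ray maxxx min_l// pt0.
apply: bigsetU_compact => j _; apply: continuous_compact; last exact: segment_compact.
apply: continuous_subspaceT; exact: continuous_path.
Qed.

(** Searches are equicontinuous maps into a compact space: a pointwise cluster point, found by
    compactness of the product space, is approximated uniformly on bounded time intervals. *)
Lemma limit_search (S_ : nat -> R -> Q) : (forall k, lip_search (S_ k)) ->
  exists S (sg : nat -> nat), [/\ lip_search S, forall N, (N <= sg N)%N &
    forall N t, 0 <= t <= N.+1%:R -> mdist (S_ (sg N) t) (S t) <= 3 / N.+1%:R].
Proof.
move=> SP.
have cpt : compact [set: {ptws R -> Q}].
  have := @tychonoff _ (fun _ : R => _) _ (fun=> compact_star).
  by congr (compact _); rewrite eqEsubset.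
have [|p [_ clp]] := cpt ((S_ : nat -> {ptws R -> Q}) @ \oo) _; first exact: filterT.
have pick (ts : seq R) (e : R) (N : nat) : 0 < e ->
    exists k, (N <= k)%N /\ forall t, t \in ts -> mdist (S_ k t) (p t) < e.
  move=> e0.
  have nb : nbhs (p : {ptws R -> Q}) [set f : {ptws R -> Q} |
      forall t, t \in ts -> mdist (f t) (p t) < e].
    elim: ts => [|t ts IH]; first by apply: filterS filterT => f _ t.
    have nt : nbhs (p : {ptws R -> Q}) [set f : {ptws R -> Q} | ball (p t) e (f t)].
      apply: (@proj_continuous R (fun=> Q) t p (ball (p t) e)).
      exact: (nbhsx_ballx (p t) (PosNum e0)%:num).
    apply: filterS (filterI nt IH) => f [ft fts] t'; rewrite inE => /predU1P[->|/fts//].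
    by move: ft; rewrite ballEmdist /= mdist_sym.
  have tail : (((S_ : nat -> {ptws R -> Q}) @ \oo) : set_system _)
      [set f | exists2 k, (N <= k)%N & S_ k = f].
    by exists N => // k /= Nk; exists k.
  have [f [[k Nk <-] fc]] := clp _ _ tail nb.
  by exists k.
have pL : lip_search p.
  split.
    apply: mdist_positivity; apply/eqP; rewrite eq_le mdist_ge0 andbT.
    apply/ler_addgt0Pl => e e0; rewrite addr0.
    have [k [_ /(_ 0)]] := pick [:: 0] e 0%N e0; rewrite mem_head => /(_ isT).
    by have [-> _] := SP k; rewrite mdist_sym => /ltW.
  move=> t1 t2 t10 t12; apply/ler_addgt0Pl => e e0.
  have e20 : 0 < e / 2 by lra.
  have [k [_ H]] := pick [:: t1; t2] _ 0%N e20.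
  have h1 := H t1 (mem_head _ _); have h2 : mdist (S_ k t2) (p t2) < e / 2.
    by apply: H; rewrite !inE eqxx orbT.
  have [_ /(_ t1 t2 t10 t12) h3] := SP k.
  have := mdist_triangle (S_ k t1) (p t1) (p t2).
  have := mdist_triangle (S_ k t2) (S_ k t1) (p t2).
  rewrite (mdist_sym (p t1) (S_ k t1)); lra.
have H N : exists k, (N <= k)%N /\ forall t, 0 <= t <= N.+1%:R ->
    mdist (S_ k t) (p t) <= 3 / N.+1%:R.
  have N0 : 0 < N.+1%:R :> R by rewrite ltr0n.
  have [k [Nk kP]] := pick [seq m%:R / N.+1%:R | m <- iota 0 (N.+1 * N.+1).+1] _ N
    (divr_gt0 ltr01 N0).
  exists k; split=> // t /andP[t0 tN].
  pose m := Num.truncn (t * N.+1%:R); pose tm : R := m%:R / N.+1%:R.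
  have tN0 : 0 <= t * N.+1%:R by exact: mulr_ge0 t0 (ltW N0).
  have /andP[m1 m2] := truncn_itv tN0.
  have tm0 : 0 <= tm by rewrite divr_ge0 ?ler0n.
  have tmt : tm <= t by rewrite ler_pdivrMr.
  have ttm : t - tm <= 1 / N.+1%:R.
    by rewrite lerBlDl -mulrDl ler_pdivlMr// natr1 ltW.
  have htm : mdist (S_ k tm) (p tm) < 1 / N.+1%:R.
    apply: kP; apply/mapP; exists m => //; rewrite mem_iota /= add0n ltnS.
    rewrite -(ler_nat R) (le_trans m1)// natrM; exact: ler_wpM2r (ltW N0) _ _ tN.
  have [_ kL] := SP k; have [_ pL'] := pL.
  have h1 := nonexpanding_le kL tm0 tmt; have h2 := nonexpanding_le pL' tm0 tmt.
  have := mdist_triangle (S_ k tm) (S_ k t) (p t).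
  have := mdist_triangle (p tm) (S_ k tm) (p t).
  rewrite (mdist_sym (S_ k t) (S_ k tm)).
  move: ttm htm h1 h2; set i := N.+1%:R^-1; clearbody i; lra.
have [sg sgP] := choice H.
by exists p, sg; split=> // N; have [] := sgP N.
Qed.

Definition search_limit (S_ : nat -> R -> Q) (S : R -> Q) := forall N t, 0 <= t <= N.+1%:R ->
  mdist (S_ N t) (S t) <= 3 / N.+1%:R.

(** What the limit has found by time [t] is closed, so a point missing from it keeps a
    positive distance from what the searches near the limit have found. *)
Lemma hit_time_limit (S_ : nat -> R -> Q) S q : (forall k, lip_search (S_ k)) -> lip_search S ->
  search_limit S_ S ->
  (hit_time S q <= limn_einf (fun N => hit_time (S_ N) q))%E.
Proof.
move=> SP [S0 SL] lim; rewrite leNgt; apply/negP => lt.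
have [t [t0 t1 t2]] : exists t : R, [/\ 0 <= t,
    (limn_einf (fun N => hit_time (S_ N) q) < t%:E)%E & (t%:E < hit_time S q)%E].
  have ge0 : (0 <= limn_einf (fun N => hit_time (S_ N) q))%E.
    rewrite limn_einf_lim; apply: lime_ge; first exact: is_cvg_einfs.
    by apply: nearW => m; apply: le_ereal_inf_tmp => _ [k _ <-]; exact: hit_time_ge0.
  move: lt ge0; case: (limn_einf _) => [a| |]; case: (hit_time S q) => [b| |] //.
    rewrite lte_fin lee_fin => ab a0; exists ((a + b) / 2); rewrite !lte_fin; split; lra.
  rewrite lee_fin => _ a0; exists (a + 1); rewrite lte_fin ltry; split=> //; lra.
have often M : exists2 k, (M <= k)%N & found (S_ k) t q.
  have : (einfs (fun N => hit_time (S_ N) q) M < t%:E)%E.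
    apply: le_lt_trans t1; rewrite limn_einf_lim; apply: lime_ge; first exact: is_cvg_einfs.
    near=> m; apply: nondecreasing_einfs; near: m; exact: nbhs_infty_ge.
  move=> /ereal_inf_lt[_ [k /= Mk <-] /ltW kt]; exists k => //.
  by apply/(hit_time_le _ _ t0) => //; have [] := SP k.
suff : found S t q by move=> /(hit_time_le _ SL t0); rewrite leNgt t2.
apply: contrapT => nf.
have : open (~` found S t) by rewrite openC; exact: closed_found.
rewrite openE => /(_ q nf); rewrite /interior -nbhs_ballE => -[e /= e0 eP].
pose M := maxn (Num.truncn t) (Num.truncn (3 / e)).
have [k Mk /foundP[u [u0 ut Su]]] := often M.
have k0 : 0 < k.+1%:R :> R by rewrite ltr0n.
have tk : t <= k.+1%:R.
  apply: ltW; apply: lt_le_trans (truncnS_gt t) _; rewrite ler_nat ltnS.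
  by apply: leq_trans Mk; exact: leq_maxl.
have ek : 3 / k.+1%:R < e.
  rewrite ltr_pdivrMr// mulrC -ltr_pdivrMr//; apply: lt_le_trans (truncnS_gt _) _.
  by rewrite ler_nat ltnS; apply: leq_trans Mk; exact: leq_maxr.
have := lim k u; rewrite u0 (le_trans ut tk) Su => /(_ isT) d.
apply: (eP (S u)); last by apply/foundP; exists u.
by rewrite ballEmdist /=; exact: le_lt_trans ek.
Unshelve. all: by end_near. Qed.

Context (m : {measure set BQ -> \bar R}).

Lemma mean_hit_limit (S_ : nat -> R -> Q) S : (forall k, lip_search (S_ k)) -> lip_search S ->
  search_limit S_ S ->
  (\int[m]_q hit_time S q <= limn_einf (fun N => \int[m]_q hit_time (S_ N) q))%E.
Proof.
move=> SP SS lim; have [_ SL] := SS.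
have mS k : measurable_fun setT (hit_time (S_ k) : BQ -> \bar R).
  by apply: measurable_hit_time; have [] := SP k.
apply: (@le_trans _ _ (\int[m]_q limn_einf (fun N => hit_time (S_ N) q))%E); last first.
  by apply: fatou => // k q _; exact: hit_time_ge0.
apply: ge0_le_integral => //.
- by move=> q _; exact: hit_time_ge0.
- exact: measurable_hit_time.
- rewrite /limn_einf; apply: (@measurableT_comp _ _ _ _ _ _ -%E) => //.
  apply: (@measurable_fun_limn_esup _ BQ R setT (fun N q => - hit_time (S_ N) q)%E) => k.
  exact: measurableT_comp.
- by move=> q _; exact: hit_time_limit.
Qed.

Lemma exists_minimizer (P : (R -> Q) -> Prop) : (forall S, P S -> lip_search S) ->
  (forall (S_ : nat -> R -> Q) S, (forall k, P (S_ k)) -> lip_search S -> search_limit S_ S -> P S) ->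
  (exists S, P S) ->
  exists2 S, P S & forall S', P S' -> (\int[m]_q hit_time S q <= \int[m]_q hit_time S' q)%E.
Proof.
move=> PL Plim [S1 PS1].
pose V := [set (\int[m]_q hit_time S q)%E | S in [set S | P S]].
have V0 : V != set0 by apply/set0P; exists (\int[m]_q hit_time S1 q)%E; exists S1.
have [u uV ulim] := ereal_inf_seq V0.
have uV' k : exists S, P S /\ (\int[m]_q hit_time S q)%E = u k.
  by have [S PS] := uV k; exists S.
have [S_ S_P] := choice uV'.
have SL k : lip_search (S_ k) by apply: PL; have [] := S_P k.
have [S [sg [SS sgN lim]]] := limit_search SL.
have limS : search_limit (fun N => S_ (sg N)) S by move=> N t; exact: lim.
exists S.
  by apply: Plim limS => // k; have [] := S_P (sg k).
move=> S' PS'; apply: (@le_trans _ _ (ereal_inf V)); last first.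
  by apply: ereal_inf_lbound; exists S'.
have := mean_hit_limit (fun k => SL (sg k)) SS limS.
suff -> : limn_einf (fun N => \int[m]_q hit_time (S_ (sg N)) q)%E = ereal_inf V by [].
have E : (fun N => \int[m]_q hit_time (S_ (sg N)) q)%E = u \o sg.
  by apply/funext => N /=; have [_ ->] := S_P (sg N).
have sgoo : sg N @[N --> \oo] --> \oo.
  apply/cvgnyPge => A; near=> N; apply: leq_trans (sgN N); near: N; exact: nbhs_infty_ge.
by have [einf_lim _] := cvg_limn_einf_sup (cvg_comp _ _ sgoo ulim); rewrite E.
Unshelve. all: by end_near. Qed.

End Compactness.

(** * Existence of optimal searches *)

Section Shortcut.
Context {R : realType} {n : nat} {lam : 'I_n -> R}.
Context (lam_gt0 : forall j, 0 < lam j) (n1 : (1 < n)%N).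
Local Notation Q := (star lam).
Implicit Types (j : 'I_n) (t u : R) (q : Q) (S : R -> Q).

(** Replacing a detour that covers no more than the path between its ends by the direct way
    along this path: nothing is found later, and whatever the detour delays is found earlier. *)
Lemma shortcut S t1 t2 : lip_search S -> 0 <= t1 -> t1 < t2 ->
  S @` `[t1, t2] = path_between (S t1) (S t2) ->
  exists S', [/\ lip_search S',
    forall q, (hit_time S' q <= hit_time S q)%E &
    forall q, (t2%:E <= hit_time S q)%E ->
      (hit_time S' q + (t2 - t1 - mdist (S t1) (S t2))%:E <= hit_time S q)%E].
Proof.
move=> [S0 SL] t10 t12 img.
have [g [gL g0 gd gP]] := geodesic lam_gt0 n1 (S t1) (S t2).
set d := mdist (S t1) (S t2) in gd *.
have d0 : 0 <= d by exact: mdist_ge0.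
have dle : d <= t2 - t1 by exact: SL.
pose S2 t := S (t2 + t); pose S1 := concat g d S2; pose S' := concat S t1 S1.
have S20 : g d = S2 0 by rewrite gd /S2 addr0.
have S10 : S t1 = S1 0 by rewrite /S1 concat0.
have late u : t2 <= u -> S' (u - (t2 - t1 - d)) = S u.
  move=> t2u; rewrite /S' concat_ge; last lra.
  by rewrite /S1 concat_ge; [rewrite /S2; congr S; lra|lra].
exists S'; split.
- split; first by rewrite /S' concat0.
  apply: concat_nonexpanding => //; first by move=> v w v0 vw _; exact: SL.
  apply: concat_nonexpanding => //; first by move=> v w v0 vw _; exact: gL.
  by move=> v w v0 vw; have := SL (t2 + v) (t2 + w); rewrite /S2 => H; have := H; lra.
- move=> q; apply: le_ereal_inf_tmp => _ [u [u0 Su] <-].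
  have [ut1|t1u] := ltP u t1; first by apply: hit_time_lb; rewrite /S' ?concat_lt.
  have [ut2|t2u] := leP u t2; last first.
    apply: (@le_trans _ _ (u - (t2 - t1 - d))%:E); last by rewrite lee_fin; lra.
    by apply: hit_time_lb; [lra|rewrite late// ltW].
  have pq : path_between (S t1) (S t2) q.
    by rewrite -img; exists u => //; rewrite /= in_itv /= t1u.
  have dq : mdist (S t1) q <= u - t1 by rewrite -Su; exact: nonexpanding_le.
  have dqd : mdist (S t1) q <= d.
    by have := mdist_ge0 q (S t2); move: pq; rewrite /path_between /= -/d; lra.
  have q0 := mdist_ge0 (S t1) q.
  apply: (@le_trans _ _ (t1 + mdist (S t1) q)%:E); last by rewrite lee_fin; lra.
  apply: hit_time_lb; first lra.
  rewrite /S' concat_ge; last lra.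
  rewrite [t1 + _]addrC addrK /S1; have [lt|ge] := ltP (mdist (S t1) q) d.
    by rewrite concat_lt// gP.
  have E : mdist (S t1) q = d by apply/eqP; rewrite eq_le dqd.
  by rewrite concat_ge// E subrr -S20 -E gP.
- move=> q hq; apply: le_ereal_inf_tmp => _ [u [u0 Su] <-].
  have t2u : t2 <= u by rewrite -lee_fin; apply: le_trans hq _; exact: hit_time_lb.
  rewrite -leeBrDr// -EFinB; apply: hit_time_lb; [lra|by rewrite late].
Qed.

End Shortcut.

Section Existence.
Context {R : realType} {n : nat} {lam : 'I_n -> R}.
Context (lam_gt0 : forall j, 0 < lam j) (n1 : (1 < n)%N).
Local Notation Q := (star lam).
Local Notation BQ := (borel_star lam).
Implicit Types (j : 'I_n) (t u : R) (q : Q) (S : R -> Q).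

Local Notation A0 := (probe (lam := lam) n1 1%g 0).
Local Notation T0 :=
  (2 * 0 + tour_start (lam := lam) 1 (last_leg n1) + lam ((1%g : 'S_n) (last_leg n1))).

Let A0lip : lip_search A0. Proof. exact: probe_lip. Qed.

Let A0found q : found A0 T0 q. Proof. exact: probe_found. Qed.

Let T0_ge0 : 0 <= T0.
Proof. by rewrite mulr0 add0r addr_ge0 ?tour_start_ge0 ?ltW. Qed.

(** Indexed by natural numbers, as the summands of [msum] are. *)
Definition leaf (k : nat) : Q := if insub k is Some j then pt lam j (lam j) else root lam.

Lemma leafE j : leaf j = pt lam j (lam j). Proof. by rewrite /leaf valK. Qed.

(** Its integral of the hitting time is the sum of the times at which the leaves are reached, so
    that this sum is minimised in the same way as the search time. *)
Definition leaf_measure : {measure set BQ -> \bar R} :=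
  msum (fun k => dirac (leaf k : BQ) : {measure set BQ -> \bar R}) n.

Lemma integral_leaf_measure S : nonexpanding S ->
  (\int[leaf_measure]_q hit_time S q = \sum_(j < n) hit_time S (pt lam j (lam j)))%E.
Proof.
move=> SL; have mS := measurable_hit_time SL.
rewrite ge0_integral_measure_sum//; last by move=> q _; exact: hit_time_ge0.
by apply: eq_bigr => j _; rewrite integral_dirac// diracE in_setT mul1e leafE.
Qed.

Context (h : probability BQ R).

Lemma search_time_le S T : lip_search S -> 0 <= T -> (forall q, found S T q) ->
  (search_time S h <= T%:E)%E.
Proof.
move=> [_ SL] T0 Sf; rewrite -(integral_cst_prob h); apply: ge0_le_integral => //.
- by move=> q _; exact: hit_time_ge0.
- exact: measurable_hit_time.
- by move=> q _; apply/(hit_time_le _ SL T0).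
Qed.

(** Once almost all of the mass is found, it costs nothing to find everything else. *)
Lemma complete_search S t : lip_search S -> 0 <= t -> h [set q | (t%:E <= hit_time S q)%E] = 0%E ->
  exists S' T, [/\ lip_search S', 0 <= T, forall q, found S' T q &
    (search_time S' h <= search_time S h)%E].
Proof.
move=> [S0 SL] t0 null.
have [g [gL g0 gd _]] := geodesic lam_gt0 n1 (S t) (root lam).
set d := mdist _ _ in gd; have d0 : 0 <= d by exact: mdist_ge0.
have [A00 A0L] := A0lip.
have S20 : g d = A0 0 by rewrite gd A00.
have S10 : S t = concat g d A0 0 by rewrite concat0.
have L : lip_search (concat S t (concat g d A0)).
  split; first by rewrite concat0.
  apply: concat_nonexpanding => //; first by move=> v w v0 vw _; exact: SL.
  by apply: concat_nonexpanding => // v w v0 vw _; exact: gL.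
have [L0 LL] := L.
exists (concat S t (concat g d A0)), (t + (d + T0)); split=> //.
- by rewrite addr_ge0// addr_ge0.
- by move=> q; apply: found_concat_r => //; apply: found_concat_r.
apply: ae_ge0_le_integral => //.
- by move=> q _; exact: hit_time_ge0.
- exact: measurable_hit_time.
- by move=> q _; exact: hit_time_ge0.
- exact: measurable_hit_time.
exists [set q : BQ | (t%:E <= hit_time S q)%E]; split=> //.
  rewrite -[X in measurable X]setTI.
  exact: (emeasurable_fun_c_infty measurableT (measurable_hit_time SL)).
move=> q /=; apply: contra_notP => /negP; rewrite -ltNge => lt _.
apply: le_ereal_inf_tmp => _ [u [u0 Su] <-].
have [v [v0 vt Sv]] := found_before lt.
have [ut|tu] := ltP u t; first by apply: hit_time_lb => //; rewrite concat_lt.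
apply: (@le_trans _ _ v%:E); last by rewrite lee_fin (le_trans (ltW vt)).
by apply: hit_time_lb => //; rewrite concat_lt.
Qed.

(** Among the Lipschitz searches of minimal search time, those that reach the leaves earliest
    in total are normal, as a shortcut would bring some leaf forward. *)
Theorem exists_optimal_search : exists S, optimal_search h S.
Proof.
have [S1 S1L S1min] : exists2 S, lip_search S &
    forall S', lip_search S' -> (search_time S h <= search_time S' h)%E.
  by apply: (exists_minimizer lam_gt0 n1 h) => //; exists A0.
set c := search_time S1 h in S1min.
have cfin : (c < +oo)%E.
  apply: (le_lt_trans (S1min _ A0lip)); apply: le_lt_trans (ltry T0).
  exact: search_time_le.
pose P S := lip_search S /\ (search_time S h <= c)%E.
have [S [SP Sc] Smin] : exists2 S, P S & forall S', P S' ->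
    (\sum_(j < n) hit_time S (pt lam j (lam j)) <= \sum_(j < n) hit_time S' (pt lam j (lam j)))%E.
  have [|S_ S SP_ SL lim||S SP Smin] := @exists_minimizer R n lam lam_gt0 n1 leaf_measure P.
  - by move=> S [].
  - split=> //; apply: le_trans (mean_hit_limit h _ SL lim) _ => [k|].
      by have [] := SP_ k.
    rewrite limn_einf_lim; apply: lime_le; first exact: is_cvg_einfs.
    apply: nearW => N; apply: (@le_trans _ _ (search_time (S_ N) h)); last by have [] := SP_ N.
    by apply: ereal_inf_lbound; exists N => //=; exact: leqnn.
  - by exists S1; split.
  exists S => // S' SP'; have [[_ SL] _] := SP; have [[_ SL'] _] := SP'.
  by rewrite -!integral_leaf_measure//; exact: Smin.
have [S0 SL] := SP.
exists S; split; last first.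
  by move=> S' /is_search_lip SS'; exact: le_trans (S1min _ SS').
split=> // t1 t2 t10 t12 rel img.
have t20 : 0 <= t2 by exact: le_trans (ltW t12).
have [d_eq|d_ne] := eqVneq (mdist (S t1) (S t2)) (t2 - t1); first exact: full_speed_normal.
exfalso.
have k0 : 0 < t2 - t1 - mdist (S t1) (S t2).
  by rewrite subr_gt0 lt_neqAle d_ne SL.
have [S' [SP' le' lt']] := shortcut lam_gt0 n1 SP t10 t12 img.
set kp := t2 - t1 - _ in k0 lt'.
have [S0' SL'] := SP'.
have mS := measurable_hit_time SL; have mS' := measurable_hit_time SL'.
have PS' : P S'.
  split=> //; apply: le_trans Sc; apply: ge0_le_integral => //.
  - by move=> q _; exact: hit_time_ge0.
(* Some leaf is still missing at time t2, as points are found from the root outwards. *)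
have [j jt2] : exists j, (t2%:E <= hit_time S (pt lam j (lam j)))%E.
  have [_ nc] := rel.
  have [q nq] : exists q, ~ (S @` `[0, t2[) q.
    by apply: contra_notP nc => /forallNP H q _; apply: contrapT; exact: H.
  have t2_gt0 : 0 < t2 by exact: le_lt_trans t12.
  case aq : (arc q) => [j|]; last first.
    move/eqP: aq; rewrite arc_root => /eqP qr; exfalso; apply: nq; exists 0 => //.
      by rewrite /= in_itv /= lexx.
    by rewrite qr.
  exists j; rewrite leNgt; apply/negP => /found_before[u [u0 ut2 Su]]; apply: nq.
  have fl : found S u (pt lam j (lam j)) by apply/foundP; exists u.
  have /andP[r0 rl] := radius_arc aq.
  have : found S u (pt lam j (radius q)).
    by apply: (found_below SP _ (lexx _) fl); rewrite rl ltW.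
  rewrite pt_arc// => /foundP[w [w0 wu Sw]]; exists w => //.
  by rewrite /= in_itv /= w0 (le_lt_trans wu).
have Jfin : (\sum_(j < n) hit_time S (pt lam j (lam j)) < +oo)%E.
  have null : h [set q | (t2%:E <= hit_time S q)%E] = 0%E.
    pose B : set BQ := [set q | (t2%:E <= hit_time S q)%E].
    have mB : measurable B.
      rewrite -[B]setTI; exact: (emeasurable_fun_c_infty measurableT mS).
    have : (search_time S' h + (kp * prob h B)%:E <= c)%E.
      apply: le_trans Sc; rewrite -integral_indicM ?(ltW k0)//.
      rewrite -ge0_integralD//; last first.
      - exact: measurable_indicM.
      - by move=> q _; rewrite -EFinM lee_fin mulr_ge0 ?(ltW k0).
      - by move=> q _; exact: hit_time_ge0.
      apply: ge0_le_integral => //.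
      - by move=> q _; rewrite adde_ge0 ?hit_time_ge0// -EFinM lee_fin mulr_ge0 ?(ltW k0).
      - by apply: emeasurable_funD => //; exact: measurable_indicM.
      move=> q _; rewrite indicE; have [Bq|nBq] := boolP (q \in B).
        by rewrite mule1; apply: lt'; move: Bq; rewrite inE.
      by rewrite mule0 adde0.
    have cS' := S1min _ SP'.
    have ffin : search_time S' h \is a fin_num.
      have [_ S'c] := PS'.
      rewrite ge0_fin_numE; first exact: le_lt_trans cfin.
      by apply: integral_ge0 => q _; exact: hit_time_ge0.
    move=> H; have := le_trans H cS'; rewrite -{2}[search_time S' h]adde0 leeD2lE// lee_fin.
    rewrite pmulr_rle0// => p0; have pB : prob h B = 0.
      by apply/eqP; rewrite eq_le p0 prob_ge0.
    by have := probE h mB; rewrite pB.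
  have [S'' [T [SP'' T0 Sf'' Sc'']]] := complete_search SP t20 null.
  have [_ SL''] := SP''.
  apply: le_lt_trans (Smin S'' _) _; first by split=> //; exact: le_trans Sc.
  apply: (@le_lt_trans _ _ (\sum_(j < n) T%:E)%E); last by rewrite sumEFin ltry.
  by apply: lee_sum => i _; apply/(hit_time_le _ SL'' T0).
have := Smin S' PS'; rewrite leNgt => /negP; apply.
move: Jfin; rewrite !(bigD1 (P := xpredT) j)//=.
have Sge0 (f : R -> Q) : (0 <= \sum_(i < n | i != j) hit_time f (pt lam i (lam i)))%E.
  by apply: sume_ge0 => i _; exact: hit_time_ge0.
move=> Jfin.
have jfin : hit_time S (pt lam j (lam j)) \is a fin_num.
  rewrite ge0_fin_numE ?hit_time_ge0//; apply: le_lt_trans Jfin; exact: leeDl.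
have rle : (\sum_(i < n | i != j) hit_time S' (pt lam i (lam i))
    <= \sum_(i < n | i != j) hit_time S (pt lam i (lam i)))%E.
  by apply: lee_sum => i _; exact: le'.
have rfin : (\sum_(i < n | i != j) hit_time S' (pt lam i (lam i)))%E \is a fin_num.
  rewrite ge0_fin_numE//; apply: le_lt_trans rle _; apply: le_lt_trans Jfin.
  by rewrite addeC; apply: leeDl; exact: hit_time_ge0.
apply: lte_leD => //.
apply: lt_le_trans (lt' _ jt2).
have j'fin : hit_time S' (pt lam j (lam j)) \is a fin_num.
  rewrite ge0_fin_numE ?hit_time_ge0//; apply: le_lt_trans (le' _) _.
  by rewrite -ge0_fin_numE ?hit_time_ge0.
by rewrite lteDl// lte_fin.
Qed.

End Existence.

(** * Comparing searches with tours *)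

Section Optimality.
Context {R : realType} {n : nat} {lam : 'I_n -> R}.
Context (lam_gt0 : forall j, 0 < lam j) (n1 : (1 < n)%N).
Context (h : probability (borel_star lam) R) (hb : balanced h).
Local Notation Q := (star lam).
Local Notation mu := (total_length lam).
Local Notation kap := (mean_density h).
Local Notation last_leg := (last_leg n1).
Local Notation tour_time := ((optimal_delay h + mean_radius h)%:E).
Local Notation slow j x := (arc_mass h j x * (x + (mu - lam j)) <= kap * mu * x).
Local Notation strictly_slow j x := (arc_mass h j x * (x + (mu - lam j)) < kap * mu * x).
Implicit Types (s : 'S_n) (j : 'I_n) (x : R) (S : R -> Q).

Lemma forward_biased_mass : forward_biased h <->
  forall j x, 0 <= x <= lam j -> slow j x.
Proof. by split=> H j x xl; have := H j x xl; rewrite bias_le. Qed.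

Lemma arc_mass0 j : arc_mass h j 0 = 0.
Proof.
rewrite /arc_mass (_ : [set _ | _] = set0) ?/prob ?measure0//.
by apply/seteqP; split=> // q [/radius_arc/andP[r0 _]] /=; rewrite leNgt r0.
Qed.

(** At the two ends of an arc, balance makes the bias condition an equality. *)
Lemma bias_ends j x : 0 <= x <= lam j -> ~~ (0 < x < lam j) -> slow j x.
Proof.
move=> /andP[x0 xl] nx; have [x_eq0|xn0] := eqVneq x 0.
  by rewrite x_eq0 arc_mass0 mul0r mulr0.
have -> : x = lam j.
  apply/eqP; rewrite eq_le xl /= leNgt; apply: contra nx => ->.
  by rewrite lt_neqAle eq_sym xn0 x0.
by rewrite arc_mass_lam balanced_arc// [lam j + _]addrC subrK mulrAC.
Qed.

Lemma exists_last j : exists s, s last_leg = j.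
Proof. by exists (tperm last_leg j); rewrite tpermL. Qed.

Lemma tour_search_time s : (search_time (probe n1 s 0) h <= tour_time)%E.
Proof.
have := probe_search_time lam_gt0 hb (lexx 0) (lam_gt0 (s last_leg)).
by rewrite arc_mass0 mul0r !mulr0 subrr mulr0 addr0.
Qed.

Lemma forward_biased_optimal S : forward_biased h -> depth_first S ->
  (search_time S h <= tour_time)%E -> optimal_search h S.
Proof.
move=> /forward_biased_mass fb [SS _] le; split=> // S' /is_search_lip SS'.
exact: le_trans (search_time_lower_bound lam_gt0 hb n1 fb SS').
Qed.

(** If too much mass lies within the first [x] of an arc, exploring that part first beats every
    tour. *)
Lemma simply_searchable_biased : simply_searchable h -> forward_biased h.
Proof.
move=> [S Sdf [_ Smin]]; apply/forward_biased_mass => j x xl.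
have [/andP[x0 xlt]|] := boolP (0 < x < lam j); last exact: bias_ends.
rewrite leNgt; apply/negP => lt.
have [s sj] := exists_last j; rewrite -sj in xlt lt.
have P := probe_search_time lam_gt0 hb (ltW x0) xlt.
have D := depth_first_search_time lam_gt0 n1 hb Sdf.
have M := Smin _ (probe_search lam_gt0 (ltW x0) xlt).
have := le_trans D (le_trans M P); rewrite lee_fin; lra.
Qed.

Lemma biased_simply_searchable : forward_biased h -> simply_searchable h.
Proof.
move=> fb; have df := probe0_depth_first lam_gt0 n1 1%g.
by exists (probe n1 1%g 0) => //; apply: forward_biased_optimal => //; exact: tour_search_time.
Qed.

Lemma strictly_biased_strongly : strictly_forward_biased h -> strongly_simply_searchable h.
Proof.
move=> [fb sfb] S [SS Smin].
have {}sfb j x : 0 < x < lam j -> strictly_slow j x.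
  move=> /[dup] xl /andP[x0 xlt]; have := sfb j x xl.
  by rewrite bias_lt// (ltW x0) (ltW xlt).
have tight : (search_time S h <= tour_time)%E.
  apply: le_trans (tour_search_time 1%g); apply: Smin.
  by have [] := probe0_depth_first lam_gt0 n1 1%g.
have [s sP] := tight_tour lam_gt0 n1 hb (forward_biased_mass.1 fb) sfb (is_search_lip SS) tight.
split=> //; exists s, (tour s); split; first exact: df_tour_tour.
move=> t [t0 nc]; apply: (sP) => //; rewrite leNgt; apply/negP => lt; apply: nc => q _.
(* By the turning point of the last leg, the tour has been everywhere. *)
have /foundP[u [u0 ul Su]] := probe_found lam_gt0 (s := s) (lexx 0) (lam_gt0 (s last_leg)) q.
move: ul Su; rewrite probe_tour ?mulr0// add0r subr0 => ul Su.
exists u; last by rewrite sP.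
by rewrite /= in_itv /= u0 (le_lt_trans ul).
Qed.

(** In the case of equality at [x], exploring the first [x] of the arc before the tour costs
    nothing, and is not depth-first. *)
Lemma strongly_strictly_biased : strongly_simply_searchable h -> strictly_forward_biased h.
Proof.
move=> strong.
have fb : forward_biased h.
  have [S Sopt] := exists_optimal_search lam_gt0 n1 h.
  by apply: simply_searchable_biased; exists S => //; exact: strong.
split=> // j x /andP[x0 xlt]; rewrite bias_lt ?(ltW x0) ?(ltW xlt)// lt_neqAle.
have /forward_biased_mass fbm := fb.
rewrite fbm ?(ltW x0) ?(ltW xlt)// andbT; apply/eqP => E.
have [s sj] := exists_last j; rewrite -sj in xlt E.
apply: (probe_not_depth_first lam_gt0 (ltW x0) xlt x0); apply: strong.
split; first exact: probe_search (ltW x0) xlt.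
move=> S' /is_search_lip SS'.
apply: le_trans (search_time_lower_bound lam_gt0 hb n1 fbm SS').
have := probe_search_time lam_gt0 hb (ltW x0) xlt.
by rewrite E subrr mulr0 addr0.
Qed.

End Optimality.

Theorem theorem6 (R : realType) (n : nat) (lam : 'I_n -> R)
    (h : probability (borel_star lam) R) :
  (1 < n)%N ->
  (forall j, 0 < lam j) ->
  balanced h ->
  (simply_searchable h <-> forward_biased h) /\
  (strongly_simply_searchable h <-> strictly_forward_biased h).
Proof.
move=> n1 lam_gt0 hb; split; split.
- exact: simply_searchable_biased.
- exact: biased_simply_searchable.
- exact: strongly_strictly_biased.
- exact: strictly_biased_strongly.
Qed.
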